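(* Let $d\ge 2$ and let $\Gamma\in\mathbb{R}^{d\times d}$ be a symmetric positive definite matrix with smallest eigenvalue $\lambda_{\min}$. For $k=1,\dots,d-1$ let $A_k\in\mathbb{R}^{(d-k)\times k}$ be the subdiagonal block of $\Gamma$ consisting of its rows $k+1,\dots,d$ and columns $1,\dots,k$, with singular values $\sigma_1^k\ge\sigma_2^k\ge\cdots$. Assume there are constants $\alpha,\theta>0$ such that $\sigma_i^k\le\alpha e^{-\theta i}$ for all $k=1,\dots,d-1$ and all $i$. Let $f_\Gamma:\mathbb{R}^d\to\mathbb{R}$, $f_\Gamma(x)=e^{-\frac12 x^\top\Gamma x}$, and put $$C:=\max\left\{\sqrt8,\ \frac5\theta,\ \frac{e^\theta}{1+e^\theta}\,\frac{4\alpha}{\lambda_{\min}}\right\}.$$ Then for every $\varepsilon>0$ there exists an approximation $\hat f$ to $f_\Gamma$ with $$\|f_\Gamma-\hat f\|_{L^2(\mathbb{R}^d)}\le\varepsilon\,\|f_\Gamma\|_{L^2(\mathbb{R}^d)}$$ whose functional tensor-train (FTT) ranks $r_k$, $k=1,\dots,d-1$, are bounded by $$r_k\le\exp\left(\frac{3\alpha}{\lambda_{\min}\theta}\right)\left(3\log\left(C\frac d\varepsilon\right)\right)^{\frac2\theta\log\left(C\frac d\varepsilon\right)}=\exp\left(\frac{3\alpha}{\lambda_{\min}\theta}\right)\left(C\frac d\varepsilon\right)^{\frac2\theta\log\left(3\log\left(C\frac d\varepsilon\right)\right)}.$$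
   Context: A function $g\in L^2(\mathbb{R}^d)$ has a functional tensor-train (FTT) decomposition with finite FTT ranks $(r_1,\dots,r_{d-1})$, $r_k\in\mathbb{N}$ (with $r_0=r_d=1$), if there are functions $\gamma_j:\{1,\dots,r_{j-1}\}\times\mathbb{R}\times\{1,\dots,r_j\}\to\mathbb{R}$, $j=1,\dots,d$, measurable in the real variable, such that $$g(x_1,\dots,x_d)=\sum_{\alpha_1=1}^{r_1}\cdots\sum_{\alpha_{d-1}=1}^{r_{d-1}}\gamma_1(1,x_1,\alpha_1)\,\gamma_2(\alpha_1,x_2,\alpha_2)\cdots\gamma_d(\alpha_{d-1},x_d,1)$$ in $L^2(\mathbb{R}^d)$. ''The FTT ranks of $\hat f$ are bounded by given numbers'' means that such a decomposition of $\hat f$ exists with ranks satisfying these bounds. $\log$ is the natural logarithm. *)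

(* Defs.v *)
From HB Require Import structures.
From mathcomp Require Import all_boot all_order all_algebra.
From mathcomp Require Import all_classical all_reals all_analysis.
From mathcomp Require Import polyrcf.

Set Implicit Arguments.
Unset Strict Implicit.
Unset Printing Implicit Defensive.

Import Order.TTheory GRing.Theory Num.Theory.
Import numFieldNormedType.Exports.

Local Open Scope classical_set_scope.
Local Open Scope ring_scope.

Section LebesgueTuple.
Context {R : realType}.
Local Open Scope ereal_scope.
Local Notation TR := (measurableTypeR R).
Local Notation leb := (@lebesgue_measure R).

Definition tuple_of_pair n (x : TR * n.-tuple TR) : n.+1.-tuple TR :=
  [the n.+1.-tuple TR of x.1 :: x.2].

Lemma measurable_tuple_of_pair n :
  measurable_fun [set: TR * n.-tuple TR] (@tuple_of_pair n).
Proof. exact: measurable_cons. Qed.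

Section step.
Variables (n : nat) (mu : {sigma_finite_measure set (n.-tuple TR) -> \bar R}).

Definition lebesgue_step : set (n.+1.-tuple TR) -> \bar R :=
  pushforward (leb \x mu) (@tuple_of_pair n).

Let mpre A : measurable A -> measurable (@tuple_of_pair n @^-1` A).
Proof.
by move=> mA; rewrite -[X in measurable X]setTI; exact: measurable_tuple_of_pair.
Qed.

Let lebesgue_step0 : lebesgue_step set0 = 0.
Proof. by rewrite /lebesgue_step /pushforward preimage_set0 measure0. Qed.

Let lebesgue_step_ge0 A : 0 <= lebesgue_step A.
Proof. by rewrite /lebesgue_step /pushforward; exact: measure_ge0. Qed.

Let lebesgue_step_sigma_additive : semi_sigma_additive lebesgue_step.
Proof.
move=> F mF tF mUF; rewrite /lebesgue_step /pushforward preimage_bigcup.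
apply: measure_semi_sigma_additive.
- by move=> i; exact: mpre.
- apply/trivIsetP => /= i j _ _ ij; rewrite -preimage_setI.
  by move/trivIsetP : tF => /(_ _ _ _ _ ij) ->//; rewrite preimage_set0.
- by rewrite -preimage_bigcup; exact: mpre.
Qed.

HB.instance Definition _ := isMeasure.Build _ _ _ lebesgue_step
  lebesgue_step0 lebesgue_step_ge0 lebesgue_step_sigma_additive.

Lemma lebesgue_step_prod (A : set TR) (B : set (n.-tuple TR)) :
  measurable A -> measurable B ->
  lebesgue_step [set t | A (thead t) /\ B [tuple of behead t]] = leb A * mu B.
Proof.
move=> mA mB; rewrite -product_measure1E//; congr ((_ \x _) _).
apply/seteqP; split => -[x t] /=.
  rewrite theadE; case=> Ax Bt; split=> //=.
  by rewrite (_ : t = [tuple of behead (tuple_of_pair (x, t))])//; exact: val_inj.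
case=> /= Ax Bt; rewrite theadE; split=> //.
by rewrite (_ : [tuple of _] = t)//; exact: val_inj.
Qed.

Lemma measurable_cons_set (A : set TR) (B : set (n.-tuple TR)) :
  measurable A -> measurable B ->
  measurable [set t : n.+1.-tuple TR | A (thead t) /\ B [tuple of behead t]].
Proof.
move=> mA mB; apply: measurableI.
- by rewrite -[X in measurable X]setTI; exact: (@measurable_tnth _ _ _ ord0).
- by rewrite -[X in measurable X]setTI; exact: (@measurable_behead _ _ n).
Qed.

Let lebesgue_step_sigma_finite : sigma_finite setT lebesgue_step.
Proof.
have /sigma_finiteP[F [TF ndF Foo]] := sigma_finiteT leb.
have /sigma_finiteP[G [TG ndG Goo]] := sigma_finiteT mu.
exists (fun k => [set t | F k (thead t) /\ G k [tuple of behead t]]).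
  apply/esym; rewrite -subTset => t _.
  have [i _ Fi] : (\bigcup_k F k) (thead t) by rewrite -TF.
  have [j _ Gj] : (\bigcup_k G k) [tuple of behead t] by rewrite -TG.
  exists (maxn i j) => //; split.
  - by move: Fi; exact/subsetPset/ndF/leq_maxl.
  - by move: Gj; exact/subsetPset/ndG/leq_maxr.
move=> k; have [mF Fk] := Foo k; have [mG Gk] := Goo k.
split; first exact: measurable_cons_set.
by rewrite lebesgue_step_prod// lte_mul_pinfty// ge0_fin_numE.
Qed.

HB.instance Definition _ := Measure_isSigmaFinite.Build _ _ _ lebesgue_step
  lebesgue_step_sigma_finite.

End step.

(* R^n is [n.-tuple TR] with the product (= Borel) sigma-algebra; see
   [lebesgue_tuple_box] for the values on boxes. *)
Fixpoint lebesgue_tuple n :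
    {sigma_finite_measure set (n.-tuple TR) -> \bar R} :=
  if n is m.+1 then lebesgue_step (lebesgue_tuple m) else \d_[tuple].

Lemma lebesgue_tuple_box n (A : 'I_n -> set TR) :
  (forall i, measurable (A i)) ->
  lebesgue_tuple n [set t | forall i, A i (tnth t i)] = \prod_(i < n) leb (A i).
Proof.
elim: n A => [|n IHn] A mA.
  by rewrite big_ord0 /= diracE mem_set//= => -[].
rewrite big_ord_recl -IHn// -lebesgue_step_prod//; last first.
  rewrite (_ : mkset _ =
      \big[setI/setT]_(i < n) ((fun t => tnth t i) @^-1` A (lift ord0 i))).
    apply: bigsetI_measurable => i _; rewrite -[X in measurable X]setTI.
    exact: measurable_tnth.
  apply/seteqP; split => t /=.
    by move=> At; elim/big_ind: _ => //= i _; exact: At.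
  by move=> At i; move: At; rewrite (bigD1 i)//= => -[].
congr (lebesgue_step _ _); apply/seteqP; split => t /= At.
  split; first exact: At.
  by move=> i; have := At (lift ord0 i); rewrite [in X in X -> _](tuple_eta t) tnthS.
case: At => At0 At1 i; case: (unliftP ord0 i) => [j ->|->//].
by rewrite (tuple_eta t) tnthS.
Qed.

End LebesgueTuple.

Section MatrixNotions.
Context {R : realType}.

(* Real eigenvalues with algebraic multiplicity, in nonincreasing order: all
   eigenvalues when [M] is symmetric. *)
Definition eigenvalues n (M : 'M[R]_n) : seq R :=
  sort >=%R (flatten [seq nseq (mup x (char_poly M)) x
                     | x <- rootsR (char_poly M)]).

(* The [n - minn m n] eigenvalues of [A^T *m A] dropped here are zero. *)
Definition singular_values m n (A : 'M[R]_(m, n)) : seq R :=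
  [seq Num.sqrt x | x <- take (minn m n) (eigenvalues (A^T *m A))].

Definition posdefmx n (M : 'M[R]_n) : Prop :=
  forall x : 'cV[R]_n, x != 0 -> 0 < (x^T *m M *m x) 0 0.

Definition smallest_eigenvalue n (M : 'M[R]_n) (l : R) : Prop :=
  eigenvalue M l /\ forall l' : R, eigenvalue M l' -> l <= l'.

Definition subdiag_block d (k : 'I_d.+1) (M : 'M[R]_d) : 'M[R]_(d - k, k) :=
  let e : d = (k + (d - k))%N := esym (subnKC (leq_ord k)) in
  dlsubmx (castmx (e, e) M).

Lemma subdiag_blockE d (k : 'I_d.+1) (M : 'M[R]_d)
    (i : 'I_(d - k)) (j : 'I_k) (i' j' : 'I_d) :
  i' = (k + i)%N :> nat -> j' = j :> nat -> subdiag_block k M i j = M i' j'.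
Proof.
by move=> Ei Ej; rewrite !mxE castmxE; congr (M _ _); apply: val_inj.
Qed.

End MatrixNotions.

Section FunctionalTensorTrain.
Context {R : realType}.
Local Notation TR := (measurableTypeR R).

Definition gaussian d (M : 'M[R]_d) (x : d.-tuple TR) : R :=
  let v : 'cV[R]_d := \col_i tnth x i in
  expR (- (2^-1 * (v^T *m M *m v) 0 0)).

Section Evaluation.
Variables (d : nat) (r : 'I_d.+1 -> nat).

Definition ftt_cores : Type :=
  forall j : 'I_d, 'I_(r (widen_ord (leqnSn d) j)) -> R ->
                   'I_(r (lift ord0 j)) -> R.

(* Variables are numbered from 0, bonds from 0 to d: core [j] stands for
   gamma_(j+1) and links bond [j] to bond [j.+1].  In [has_ftt] the two end bonds
   have size 1, so the sum over [a] is the sum over alpha_1, ..., alpha_(d-1). *)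
Definition ftt_eval (gam : ftt_cores) (x : d.-tuple TR) : R :=
  \sum_(a : {dffun forall k : 'I_d.+1, 'I_(r k)})
    \prod_(j < d) gam j (a (widen_ord (leqnSn d) j)) (tnth x j) (a (lift ord0 j)).

Definition has_ftt (g : d.-tuple TR -> R) : Prop :=
  [/\ r ord0 = 1%N, r ord_max = 1%N &
    exists gam : ftt_cores,
      (forall j a b, measurable_fun [set: TR] (fun t : TR => gam j a t b)) /\
      g = ftt_eval gam %[ae lebesgue_tuple d]].

End Evaluation.
End FunctionalTensorTrain.

(* Main.v *)
(* Fix a cut k.  Whitening the two diagonal blocks of Gamma and a singular value
   decomposition of the whitened block A_k give coordinates, separate on both
   sides of the cut, in which f is a product of functions of pairs
   exp (- x^2/2 - rho_i x y - y^2/2); by a min-max argument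
   rho_i <= s_i / (1 + s_i), where s_i = (alpha / lambda_min) e^(- theta i).
   Truncating the power series of exp (- rho_i x y) after N_i terms causes a
   relative L^2 error at most 2 (1 + 1 / (2 s_i))^(- N_i), so f is approximated by
   a sum of prod_i N_i products of a function of the first k and a function of
   the last d - k variables.  With L = log (C d / eps), N_i = floor (3 L (1 + 3 s_i))
   for i <= 2 L / theta and N_i = 1 beyond, the relative error is at most eps / d
   and prod_i N_i is below the claimed bound.
   The cuts are put together as in the tensor-train SVD: project f successively,
   for k = 1, ..., d - 1, onto the span of the right factors of cut k.  A projection
   acting on the last variables does not increase the error committed before and
   keeps the rank of the previous cuts, so the errors of the d - 1 cuts add up. *)
Require Import Defs.
From HB Require Import structures.
From mathcomp Require Import all_boot all_order all_algebra.
From mathcomp Require Import all_classical all_reals all_analysis.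
From mathcomp Require Import measurable_realfun polyrcf ring lra.

Set Implicit Arguments.
Unset Strict Implicit.
Unset Printing Implicit Defensive.

Import Order.TTheory GRing.Theory Num.Theory.
Import numFieldNormedType.Exports.

Local Open Scope classical_set_scope.
Local Open Scope ring_scope.

(** * Measures on [n.-tuple R] seen as integrals of functions on lists *)

(** The separable sums found at different cuts do not fit together into one train. Only the span of
    their right factors is kept, and the projection onto that span is at least as good as the sum
    itself. All functions have Gaussian decay, a property stable under slices and partial integrals,
    so each projection is an explicit finite sum of convergent integrals.

    Each entry of [C] pays for one loss. For [eps < 1] and [d >= 2] the error [h = eps / d] allowed
    per cut is at most 1/2, so [C >= sqrt 8] gives [(C / h)^2 >= 32] and [L >= 5/3]. Then
    [3 L (1 + 3 s_i) >= 5], and rounding down costs at most a fifth of the order. The factor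
    [1 + 3 s_i] makes up for the slow rate [log (1 + 1 / (2 s_i))] at large [s_i]; through
    [1 + 3 s <= e^(3 s)] and a geometric series it becomes the prefactor
    [exp (3 alpha / (lambda_min theta))] of the rank bound. The entry [5 / theta] controls the
    number [2 L / theta] of pairs that keep several terms and, together with the third entry, the
    geometric tail of the others. *)

Section SeqIntegral.
Context {R : realType}.
Local Notation TR := (measurableTypeR R).
Local Notation leb := (@lebesgue_measure R).
Local Open Scope ereal_scope.

(* A function of n real variables is represented by a function on lists of which
   only the values on lists of length n matter; this makes partial applications
   and changes of the number of variables free of dependent types. *)
Definition smfun d (T : measurableType d) n (F : seq R -> T) : Prop :=
  measurable_fun [set: n.-tuple TR] (fun t : n.-tuple TR => F t).

Definition eint n (F : seq R -> \bar R) : \bar R :=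
  \int[lebesgue_tuple n]_t F (t : n.-tuple TR).

Lemma smfun_comp d (T : measurableType d) n d' (T' : measurableType d')
    (F : seq R -> T) (h : T' -> n.-tuple TR) :
  smfun n F ->
  (forall i, measurable_fun [set: T'] (fun t => tnth (h t) i)) ->
  measurable_fun [set: T'] (fun t => F (h t)).
Proof.
move=> mF mh; apply: (measurableT_comp mF).
by apply/measurable_fun_tnthP => i; exact: mh.
Qed.

Lemma smfun_comp_seq d (T : measurableType d) n d' (T' : measurableType d')
    (F : seq R -> T) (h : T' -> seq R) :
  smfun n F -> (forall t, size (h t) = n) ->
  (forall i, (i < n)%N -> measurable_fun [set: T'] (fun t => (h t)`_i : TR)) ->
  measurable_fun [set: T'] (fun t => F (h t)).
Proof.
move=> mF sh mh; have sh' t : size (h t) == n by rewrite sh.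
apply: (smfun_comp (h := fun t => Tuple (sh' t))) => // i.
by under eq_fun do rewrite (tnth_nth 0%R) /=; exact: mh.
Qed.

Lemma measurable_nth_tuple n i :
  measurable_fun [set: n.-tuple TR] (fun t : n.-tuple TR => t`_i : TR).
Proof.
have [ni|ni] := ltnP i n.
  under eq_fun do rewrite -(tnth_nth _ _ (Ordinal ni)).
  exact: measurable_tnth.
under eq_fun do rewrite nth_default ?size_tuple//.
exact: measurable_cst.
Qed.

Lemma smfun_cat d (T : measurableType d) k n (F : seq R -> T) : smfun (k + n) F ->
  measurable_fun [set: k.-tuple TR * n.-tuple TR]
    (fun xy => F (xy.1 ++ xy.2)%SEQ).
Proof.
move=> mF.
apply: (smfun_comp_seq mF) => [t|i _]; first by rewrite size_cat !size_tuple.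
under eq_fun do rewrite nth_cat size_tuple.
case: ltnP => _.
  exact: (measurableT_comp (@measurable_nth_tuple k i)).
exact: (measurableT_comp (@measurable_nth_tuple n (i - k))).
Qed.

Lemma smfun_catl d (T : measurableType d) k n (F : seq R -> T) (x : seq R) :
  smfun (k + n) F -> size x = k -> smfun n (fun y => F (x ++ y)).
Proof.
move=> /smfun_cat mF sx.
have tx : size x == k by rewrite sx.
exact: (@measurableT_comp _ _ _ _ _ _ _ _ _ mF
  (@measurable_pair1 _ _ _ _ (Tuple tx))).
Qed.

Lemma eint0 (F : seq R -> \bar R) : eint 0 F = F [::].
Proof.
rewrite /eint /= integral_dirac//=.
  by rewrite diracT mul1e.
move=> mD Y mY; rewrite setTI.
have [h|h] := pselect (Y (F [::])).
  rewrite (_ : _ @^-1` _ = setT); first exact: measurableT.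
  by apply/seteqP; split => // t _ /=; rewrite (tuple0 t).
rewrite (_ : _ @^-1` _ = set0); first exact: measurable0.
by apply/seteqP; split => // t /=; rewrite (tuple0 t).
Qed.

Lemma eq_eint n (F G : seq R -> \bar R) :
  (forall s, size s = n -> F s = G s) -> eint n F = eint n G.
Proof. by move=> FG; apply: eq_integral => t _; rewrite FG ?size_tuple. Qed.

Lemma eint_ge0 n (F : seq R -> \bar R) :
  (forall s, size s = n -> 0 <= F s) -> 0 <= eint n F.
Proof. by move=> F0; apply: integral_ge0 => t _; rewrite F0 ?size_tuple. Qed.

Lemma eint_cons n (F : seq R -> \bar R) : smfun n.+1 F -> (forall s, 0 <= F s) ->
  measurable_fun [set: TR] (fun x => eint n (fun s => F (x :: s))) /\
  eint n.+1 F = \int[leb]_x eint n (fun s => F (x :: s)).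
Proof.
move=> mF F0.
have mF' : measurable_fun [set: TR * n.-tuple TR] (fun xt => F (xt.1 :: xt.2)).
  exact: (measurableT_comp mF (measurable_tuple_of_pair (n := n))).
split.
  exact: (@measurable_fun_fubini_tonelli_F _ _ _ _ _ (lebesgue_tuple n) _ mF').
rewrite {1}/eint /= ge0_integral_pushforward//; last exact: measurable_tuple_of_pair.
by rewrite preimage_setT (@fubini_tonelli1 _ _ _ _ _ leb (lebesgue_tuple n) _ mF').
Qed.

Lemma smfun_eint k n (F : seq R -> \bar R) : smfun (k + n) F -> (forall s, 0 <= F s) ->
  smfun k (fun x => eint n (fun y => F (x ++ y))).
Proof.
move=> /smfun_cat mF F0.
exact: (@measurable_fun_fubini_tonelli_F _ _ _ _ _ (lebesgue_tuple n) _ mF).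
Qed.

Lemma eint_cat k n (F : seq R -> \bar R) : smfun (k + n) F -> (forall s, 0 <= F s) ->
  eint (k + n) F = eint k (fun x => eint n (fun y => F (x ++ y))).
Proof.
elim: k F => [|k IHk] F mF F0; first by rewrite eint0.
rewrite addSn (eint_cons mF F0).2 (eint_cons (smfun_eint mF F0) _).2; last first.
  by move=> s; apply: eint_ge0.
apply: eq_integral => x _; rewrite IHk//.
exact: (@smfun_catl _ _ 1 (k + n) F [:: x]).
Qed.

End SeqIntegral.

(** * Linear changes of variables *)

Section ChangeOfVariables.
Context {R : realType}.
Local Notation TR := (measurableTypeR R).
Local Notation leb := (@lebesgue_measure R).
Local Open Scope ereal_scope.

Lemma measurable_affine (a b : R) :
  measurable_fun [set: TR] (fun x : TR => (a * x + b)%R : TR).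
Proof.
by apply: measurable_funD => //; apply: measurable_funM.
Qed.

(** Lebesgue measure is [a] times its pushforward under [phi]: by uniqueness it is enough to compare
    the two on half-open intervals. *)
Let ge0_integral_pos_affine (a b : R) (F : R -> \bar R) : (0 < a)%R ->
  measurable_fun [set: TR] F -> (forall x, 0 <= F x) ->
  \int[leb]_x F (a * x + b)%R = (a^-1)%:E * \int[leb]_x F x.
Proof.
move=> a0 mF F0; pose phi (x : TR) : TR := (a * x + b)%R.
have mphi : measurable_fun [set: TR] phi := measurable_affine a b.
have a0' : (0 <= a)%R := ltW a0.
have lebE A : measurable A -> leb A = mscale (NngNum a0') (pushforward leb phi) A.
  apply: lebesgue_measure_unique => _ [[x y]] _ <-.
  change (leb `]x, y] = a%:E * leb (phi @^-1` `]x, y])).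
  rewrite (_ : phi @^-1` _ = `]((x - b) / a)%R, ((y - b) / a)%R]%classic); last first.
    apply/seteqP; split => z; rewrite /= !in_itv /= /phi.
      by rewrite ltr_pdivrMr// ler_pdivlMr// mulrC ltrBlDr lerBrDr.
    by rewrite ltr_pdivrMr// ler_pdivlMr// mulrC ltrBlDr lerBrDr.
  rewrite !lebesgue_measure_itv /= !lte_fin ltr_pM2r ?invr_gt0//.
  rewrite ltrD2r; case: ifPn => xy; last by rewrite mule0.
  rewrite -!EFinB -EFinM; congr EFin; field; exact: lt0r_neq0.
transitivity (\int[pushforward leb phi]_x F x).
  by rewrite ge0_integral_pushforward.
rewrite [in RHS](@eq_measure_integral _ _ _ _ (mscale (NngNum a0') (pushforward leb phi)));
  last by move=> A mA _; exact: lebE.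
rewrite ge0_integral_mscale//= muleA -EFinM mulVf ?mul1e//.
exact: lt0r_neq0.
Qed.

Lemma ge0_integral_affine (a b : R) (F : R -> \bar R) : a != 0%R ->
  measurable_fun [set: TR] F -> (forall x, 0 <= F x) ->
  \int[leb]_x F (a * x + b)%R = (`|a|^-1)%:E * \int[leb]_x F x.
Proof.
move=> a0 mF F0; have [a_gt0|a_lt0|] := ltgtP a 0%R; last by move/eqP: a0.
(* Here [a < 0]: the reflection [x |-> - x] preserves Lebesgue measure and turns the slope into
   [- a]. *)
- rewrite -(ge0_integral_pos_affine b _ mF)// ?normr_gt0// ltr0_norm//.
  pose G (x : TR) := F (- a * x + b)%R.
  transitivity (\int[pushforward leb (-%R : TR -> TR)]_x G x).
    rewrite ge0_integral_pushforward//=; last 2 first.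
    - exact: (measurableT_comp mF (measurable_affine _ _)).
    - by move=> *; exact: F0.
    by apply: eq_integral => x _ /=; rewrite /G mulrNN.
  by apply: eq_measure_integral => A mA _; exact: lebesgue_measureN.
- by rewrite ge0_integral_pos_affine ?gtr0_norm.
Qed.

Definition afseq n (A : 'M[R]_n) (b : 'cV[R]_n) (s : seq R) : seq R :=
  [seq (\sum_j A i j * s`_j + b i ord0)%R | i : 'I_n].

Lemma size_afseq n (A : 'M[R]_n) b s : size (afseq A b s) = n.
Proof. by rewrite size_map size_enum_ord. Qed.

Lemma nth_afseq n (A : 'M[R]_n) b s (i : 'I_n) :
  (afseq A b s)`_i = (\sum_j A i j * s`_j + b i ord0)%R.
Proof.
rewrite (nth_map i) ?size_enum_ord//; congr (_ + b _ _)%R; last first.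
  by rewrite nth_ord_enum.
by apply: eq_bigr => j _; rewrite nth_ord_enum.
Qed.

Lemma afseqM n (A B : 'M[R]_n) b s :
  afseq (A *m B) b s = afseq A b (afseq B 0 s).
Proof.
apply: eq_map => i; congr (_ + _)%R.
under [RHS]eq_bigr do rewrite nth_afseq mxE addr0 mulr_sumr.
rewrite exchange_big; apply: eq_bigr => j _ /=.
by rewrite mxE mulr_suml; apply: eq_bigr => l _; rewrite mulrA.
Qed.

Lemma afseqS n (A : 'M[R]_n.+1) b x s :
  afseq A b (x :: s) =
  (A ord0 ord0 * x + \sum_j A ord0 (lift ord0 j) * s`_j + b ord0 ord0)%R ::
  [seq (A (lift ord0 i) ord0 * x + \sum_j A (lift ord0 i) (lift ord0 j) * s`_j
       + b (lift ord0 i) ord0)%R | i : 'I_n].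
Proof.
rewrite /afseq /image_mem enum_ordSl /=; congr (_ :: _).
  by rewrite big_ord_recl.
by rewrite -map_comp; apply: eq_map => i /=; rewrite big_ord_recl.
Qed.

Lemma measurable_nth_afseq n (A : 'M[R]_n) b i :
  measurable_fun [set: n.-tuple TR] (fun t : n.-tuple TR => (afseq A b t)`_i : TR).
Proof.
have [ni|ni] := ltnP i n.
  under eq_fun => t do rewrite (nth_afseq _ _ _ (Ordinal ni)).
  apply: measurable_funD => //; apply: measurable_sum => j.
  by apply: measurable_funM => //; exact: measurable_nth_tuple.
under eq_fun do rewrite nth_default ?size_afseq//.
exact: measurable_cst.
Qed.

Lemma smfun_afseq d (T : measurableType d) n (A : 'M[R]_n) b (F : seq R -> T) :
  smfun n F -> smfun n (F \o afseq A b).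
Proof.
move=> mF; apply: (smfun_comp_seq mF) => [t|i ni]; first exact: size_afseq.
exact: measurable_nth_afseq.
Qed.

Lemma smfun_cons_tuple d (T : measurableType d) d' (T' : measurableType d') n
    (f : T' -> R) (g : T' -> seq R) (F : seq R -> T) :
  smfun n.+1 F -> (forall t, size (g t) = n) -> measurable_fun [set: T'] f ->
  (forall i, (i < n)%N -> measurable_fun [set: T'] (fun t => (g t)`_i : TR)) ->
  measurable_fun [set: T'] (fun t => F (f t :: g t)).
Proof.
move=> mF sg mf mg; apply: (smfun_comp_seq mF) => [t|[|i] ni//=].
  by rewrite /= sg.
exact: mg.
Qed.

(* The constant is [`|\det A|^-1], a fact that is never needed: norms are only
   compared with each other. *)
Definition jac n (A : 'M[R]_n) : Prop :=
  exists2 c : R, (0 < c)%R &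
    forall b (F : seq R -> \bar R), smfun n F -> (forall s, 0 <= F s) ->
      eint n (fun s => F (afseq A b s)) = c%:E * eint n F.

Lemma jacM n (A B : 'M[R]_n) : jac A -> jac B -> jac (A *m B).
Proof.
move=> [c c0 cP] [e e0 eP]; exists (e * c)%R; first exact: mulr_gt0.
move=> b F mF F0; under eq_eint => s _ do rewrite afseqM.
rewrite (eP 0%R (F \o afseq A b)); last by move=> s; exact: F0.
  by rewrite cP// EFinM muleA.
exact: smfun_afseq.
Qed.

Lemma block_mx1E n (A : 'M[R]_1) (u : 'rV[R]_n) (v : 'cV[R]_n) (D : 'M[R]_n)
    (M := block_mx A u v D : 'M[R]_n.+1) :
  [/\ M ord0 ord0 = A ord0 ord0,
      forall j, M ord0 (lift ord0 j) = u ord0 j,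
      forall i, M (lift ord0 i) ord0 = v i ord0 &
      forall i j, M (lift ord0 i) (lift ord0 j) = D i j].
Proof.
have l0 : ord0 = lshift n (ord0 : 'I_1) :> 'I_(1 + n) by exact: val_inj.
split=> [|j|i|i j]; rewrite -?rshift1 ?l0.
- exact: (block_mxEul A u v D).
- exact: (block_mxEur A u v D).
- exact: (block_mxEdl A u v D).
- exact: (block_mxEdr A u v D).
Qed.

(** For fixed trailing variables only the first one moves, by an affine map of slope [a]; Tonelli is
    applied twice, to make that integral the inner one and back. The hypothesis on [1%:M] then
    removes the shift of the trailing variables. *)
Lemma jac_upper n (a : R) (u : 'rV[R]_n) : a != 0%R -> jac (1%:M%R : 'M[R]_n) ->
  jac (block_mx a%:M u 0 1%:M : 'M[R]_(1 + n))%R.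
Proof.
move=> a0 [c c0 cP]; exists (`|a|^-1 * c)%R.
  by rewrite mulr_gt0// invr_gt0 normr_gt0.
move=> b F mF F0; rewrite (eint_cons mF F0).2.
rewrite (eint_cons (smfun_afseq _ b mF) _).2/=; last by move=> s; exact: F0.
pose b' : 'cV[R]_n := \col_i b (lift ord0 i) ord0.
have E x s : afseq (block_mx a%:M u 0 1%:M : 'M[R]_(1 + n))%R b (x :: s) =
    (a * x + (\sum_j u ord0 j * s`_j + b ord0 ord0))%R :: afseq 1%:M%R b' s.
  have [E1 E2 E3 E4] := block_mx1E a%:M u 0%R 1%:M.
  rewrite afseqS E1 mxE -addrA; congr (_ :: _).
    by congr (_ + (_ + _))%R; apply: eq_bigr => j _; rewrite E2.
  apply: eq_map => i; rewrite E3 mxE mul0r add0r [b' _ _]mxE.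
  by congr (_ + _)%R; apply: eq_bigr => j _; rewrite E4.
under eq_integral => x _.
  under eq_eint => s _ do rewrite E.
  over.
have mF3 : measurable_fun [set: TR * n.-tuple TR] (fun xt =>
    F ((a * xt.1 + (\sum_j u ord0 j * (val xt.2)`_j + b ord0 ord0))%R ::
        afseq 1%:M%R b' (xt.2))).
  apply: (smfun_cons_tuple mF) => [||i ni]; first by move=> t; exact: size_afseq.
    apply: measurable_funD; first exact: measurable_funM.
    apply: measurable_funD => //; apply: measurable_sum => j.
    apply: measurable_funM => //.
    exact: (measurableT_comp (@measurable_nth_tuple _ n j)).
  exact: (measurableT_comp (@measurable_nth_afseq _ _ b' i)).
have mF4 : measurable_fun [set: TR * n.-tuple TR] (fun xt =>
    F (xt.1 :: afseq 1%:M%R b' (xt.2))).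
  apply: (smfun_cons_tuple mF) => // [t|i ni]; first exact: size_afseq.
  exact: (measurableT_comp (@measurable_nth_afseq _ _ b' i)).
rewrite (@fubini_tonelli _ _ _ _ _ leb (lebesgue_tuple n) _ mF3)//=.
under eq_integral => t _.
  rewrite (@ge0_integral_affine a _ (fun y => F (y :: afseq 1%:M%R b' t)))//; last first.
    exact: (@measurableT_comp _ _ _ _ _ _ _ _ _ mF4
      (@measurable_pair2 _ _ _ _ t)).
  over.
rewrite ge0_integralZl//=; last 2 first.
- exact: (@measurable_fun_fubini_tonelli_G _ _ _ _ _ leb _ mF4).
- by move=> t _; apply: integral_ge0.
rewrite -(@fubini_tonelli _ _ _ _ _ leb (lebesgue_tuple n) _ mF4)//=.
rewrite EFinM -muleA; congr (_ * _).
transitivity (\int[leb]_x (c%:E * eint n (fun s => F (x :: s)))).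
  apply: eq_integral => x _; apply: (cP b' (fun s => F (x :: s))) => //.
  exact: (smfun_catl (k := 1) (x := [:: x]) mF).
rewrite ge0_integralZl//=; last 3 first.
- exact: (eint_cons mF F0).1.
- by move=> t _; apply: integral_ge0.
- by rewrite lee_fin ltW.
Qed.

(** Once the first variable is fixed, its contribution to the lower rows is a mere translation. This
    is why [jac] asks for one constant valid for all shifts [b]. *)
Lemma jac_lower n (v : 'cV[R]_n) (D : 'M[R]_n) : jac D ->
  jac (block_mx 1%:M 0 v D : 'M[R]_(1 + n))%R.
Proof.
move=> [c c0 cP]; exists c => // b F mF F0.
rewrite (eint_cons mF F0).2.
rewrite (eint_cons (smfun_afseq _ b mF) _).2/=; last by move=> s; exact: F0.
pose b' x : 'cV[R]_n := \col_i (v i ord0 * x + b (lift ord0 i) ord0)%R.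
have E x s : afseq (block_mx 1%:M 0 v D : 'M[R]_(1 + n))%R b (x :: s) =
    (1 * x + b ord0 ord0)%R :: afseq D (b' x) s.
  have [E1 E2 E3 E4] := block_mx1E (1%:M : 'M[R]_1) 0%R v D.
  rewrite afseqS E1 mxE; congr (_ :: _).
    by rewrite big1 ?addr0// => j _; rewrite E2 mxE mul0r.
  apply: eq_map => i; rewrite E3 [b' _ _ _]mxE addrA.
  rewrite [in RHS](addrC (\sum_j _)%R); congr (_ + _ + _)%R.
  by apply: eq_bigr => j _; rewrite E4.
transitivity (\int[leb]_x (c%:E * eint n (fun s => F ((1 * x + b ord0 ord0)%R :: s)))).
  apply: eq_integral => x _; under eq_eint => s _ do rewrite E.
  apply: (cP (b' x) (fun s => F ((1 * x + b ord0 ord0)%R :: s))) => //.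
  exact: (smfun_catl (k := 1) (x := [:: (1 * x + b ord0 ord0)%R]) mF).
have [mG _] := eint_cons mF F0.
rewrite ge0_integralZl//=; last 3 first.
- exact: (measurableT_comp mG (measurable_affine 1 (b ord0 ord0))).
- by move=> t _; apply: integral_ge0.
- by rewrite lee_fin ltW.
rewrite (ge0_integral_affine (b ord0 ord0) (oner_neq0 R) mG); last first.
  by move=> x; apply: integral_ge0.
by rewrite normr1 invr1 mul1e.
Qed.

(* If the pivot [A 0 0] is nonzero, [A] factors into a block lower and a block upper
   triangular matrix; if it is zero, adding another row to the first one makes it
   nonzero. *)
Lemma jac_unitmx n (A : 'M[R]_n) : A \in unitmx -> jac A.
Proof.
elim: n A => [|n IHn] A uA.
  exists 1%R => // b F _ _; rewrite !eint0 mul1e; congr F.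
  by apply: size0nil; rewrite size_afseq.
have jac1 : jac (1%:M : 'M[R]_n)%R by apply: IHn; exact: unitmx1.
have pivot (B : 'M[R]_(1 + n)) : B \in unitmx -> ulsubmx B ord0 ord0 != 0%R -> jac B.
  move=> uB B0; set a := ulsubmx B ord0 ord0 in B0.
  have aM : ulsubmx B = a%:M%R by rewrite [LHS]mx11_scalar.
  pose c := (a^-1 *: dlsubmx B)%R; pose D := (drsubmx B - c *m ursubmx B)%R.
  have BE : B = (block_mx 1%:M 0 c D *m block_mx a%:M (ursubmx B) 0 1%:M)%R.
    rewrite mulmx_block !mul1mx !mul0mx !mulmx0 !mulmx1 !addr0 ?add0r.
    rewrite -[LHS]submxK aM /D addrC subrK; congr block_mx.
    by rewrite /c -scalemxAl mul_mx_scalar scalerA mulVf// scale1r.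
  have [uL _] : (block_mx 1%:M 0 c D : 'M[R]_(1 + n))%R \in unitmx /\ True.
    by move: uB; rewrite BE unitmx_mul => /andP[].
  rewrite BE; apply: jacM; last exact: jac_upper.
  apply: jac_lower; apply: IHn.
  by move: uL; rewrite !unitmxE det_lblock det1 mul1r.
have [A0|A0] := eqVneq (ulsubmx (A : 'M[R]_(1 + n)) ord0 ord0) 0%R; last first.
  exact: pivot.
(* A zero pivot with only zeros below it would be a zero column, hence a zero determinant. *)
have [j Aj0] : exists j : 'I_n, dlsubmx (A : 'M[R]_(1 + n)) j ord0 != 0%R.
  apply/existsP; apply: contraLR uA; rewrite negb_exists => /forallP A1.
  rewrite unitmxE unitfE negbK (expand_det_col A ord0) big1// => i _.
  rewrite (_ : A i ord0 = 0%R) ?mul0r//.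
  have l0 : ord0 = lshift n (ord0 : 'I_1) :> 'I_(1 + n) by exact: val_inj.
  case: (unliftP ord0 i) => [k ->|->]; last first.
    by move: A0; rewrite !mxE -l0.
  by have /negbNE/eqP := A1 k; rewrite !mxE -l0 rshift1.
pose e (x : R) : 'M[R]_(1 + n) := (block_mx 1%:M (x *: delta_mx 0 j) 0 1%:M)%R.
have eM x : e (- x)%R *m e x = 1%:M%R.
  rewrite /e mulmx_block !mul1mx !mul0mx !mulmx0 !mulmx1 !addr0 ?add0r.
  by rewrite scaleNr addrN -scalar_mx_block.
have ue x : e x \in unitmx by have /mulmx1_unit[] := eM x.
rewrite (_ : A = e (- 1)%R *m (e 1%R *m A)); last by rewrite mulmxA eM mul1mx.
apply: jacM; first by apply: jac_upper; first exact: oner_neq0.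
apply: pivot; first by rewrite unitmx_mul ue.
rewrite -[A in ulsubmx (_ *m A)](submxK (A : 'M[R]_(1 + n))) mulmx_block.
rewrite block_mxKul mul1mx mxE A0 add0r scale1r mxE (bigD1 j)//= big1.
  by rewrite mxE !eqxx mul1r addr0.
by move=> k kj; rewrite mxE (negbTE kj) andbF mul0r.
Qed.

End ChangeOfVariables.

(** * Functions with Gaussian decay *)

Section Decay.
Context {R : realType}.
Local Notation TR := (measurableTypeR R).

Definition sqn (s : seq R) : R := \sum_(x <- s) x ^+ 2.

Lemma sqn_ge0 s : 0 <= sqn s.
Proof. by apply: sumr_ge0 => x _; exact: sqr_ge0. Qed.

Lemma sqn_cat s t : sqn (s ++ t) = sqn s + sqn t.
Proof. by rewrite /sqn big_cat. Qed.

Lemma sqn_cons x s : sqn (x :: s) = x ^+ 2 + sqn s.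
Proof. by rewrite /sqn big_cons. Qed.

Lemma smfun_sqn n : smfun n sqn.
Proof.
rewrite /smfun /sqn; under eq_fun do rewrite big_tuple.
apply: measurable_sum => i; apply: measurable_funX; exact: measurable_tnth.
Qed.

(* All functions of the proof lie in this class, which is stable under slices,
   partial integrals, products and invertible linear substitutions. *)
Definition dec n (F : seq R -> R) : Prop := smfun n F /\
  exists K a : R, [/\ 0 <= K, 0 < a &
    forall s, size s = n -> `|F s| <= K * expR (- (a * sqn s))].

Definition rint n (F : seq R -> R) : R :=
  (\int[lebesgue_tuple n]_t F (t : n.-tuple TR))%R.

Lemma smfun_EFin n (F : seq R -> R) : smfun n F -> smfun n (fun s => (F s)%:E).
Proof. by move=> mF; apply/measurable_EFinP. Qed.

Lemma smfun_gauss n (a : R) : smfun n (fun s => expR (- (a * sqn s))).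
Proof.
apply: measurableT_comp => //; apply: measurableT_comp => //.
by apply: measurable_funM => //; exact: smfun_sqn.
Qed.

Lemma eint_gauss_lty n (a : R) : 0 < a ->
  (eint n (fun s => (expR (- (a * sqn s)))%:E) < +oo)%E.
Proof.
move=> a0; elim: n => [|n IHn]; first by rewrite eint0 ltry.
have mE : smfun n.+1 (fun s => (expR (- (a * sqn s)))%:E).
  exact: (smfun_EFin (smfun_gauss _)).
rewrite (eint_cons mE _).2; last by move=> s; rewrite lee_fin expR_ge0.
pose r := Num.sqrt a; have r0 : r != 0 by rewrite sqrtr_eq0 -ltNge.
have fE x : (eint n (fun s => (expR (- (a * sqn (x :: s))))%:E) =
    (gauss_fun (r * x + 0))%:E * eint n (fun s => (expR (- (a * sqn s)))%:E))%E.
  rewrite -ge0_integralZl//=; last 2 first.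
  - exact: (smfun_EFin (smfun_gauss _)).
  - by rewrite lee_fin expR_ge0.
  apply: eq_integral => t _; rewrite -EFinM /gauss_fun -expRD; congr ((expR _)%:E).
  by rewrite sqn_cons addr0 exprMn sqr_sqrtr ?ltW// mulrDr opprD.
under eq_integral => x _ do rewrite fE muleC.
rewrite ge0_integralZl//=; last 3 first.
- apply/measurable_EFinP.
  exact: (measurableT_comp (@measurable_gauss_fun R) (measurable_affine r 0)).
- by move=> x _; rewrite lee_fin expR_ge0.
- by apply: eint_ge0 => s _; rewrite lee_fin expR_ge0.
rewrite (@ge0_integral_affine _ r 0 (fun x => (gauss_fun x)%:E) r0); last 2 first.
- by apply/measurable_EFinP; exact: measurable_gauss_fun.
- by move=> x; rewrite lee_fin expR_ge0.
rewrite integralT_gauss -EFinM lte_mul_pinfty//.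
  by apply: eint_ge0 => s _; rewrite lee_fin expR_ge0.
by rewrite ge0_fin_numE// eint_ge0// => s _; rewrite lee_fin expR_ge0.
exact: ltry.
Qed.

Lemma dec_gauss n (a : R) : 0 < a -> dec n (fun s => expR (- (a * sqn s))).
Proof.
move=> a0; split; first exact: smfun_gauss.
by exists 1, a; split=> // s _; rewrite mul1r ger0_norm ?expR_ge0.
Qed.

Lemma dec_bounded_M n (F G : seq R -> R) (K : R) : dec n F -> smfun n G ->
  (forall s, size s = n -> `|G s| <= K) -> dec n (fun s => G s * F s).
Proof.
move=> [mF [C [a [C0 a0 FC]]]] mG GK; split; first exact: measurable_funM.
exists (`|K| * C), a; split=> // [|s ss]; first exact: mulr_ge0.
rewrite normrM -mulrA ler_pM// ?FC//.
by rewrite (le_trans (GK _ ss))// ler_norm.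
Qed.

Lemma dec_int n F : dec n F ->
  (lebesgue_tuple n).-integrable setT (fun t : n.-tuple TR => (F t)%:E).
Proof.
move=> [mF [K [a [K0 a0 FK]]]].
apply: (@le_integrable _ _ _ _ _ measurableT _
    (fun t : n.-tuple TR => (K * expR (- (a * sqn t)))%:E)).
- exact/measurable_EFinP.
- move=> t _; rewrite /= lee_fin [leRHS]ger0_norm ?FK ?size_tuple//.
  by rewrite mulr_ge0// expR_ge0.
- under eq_fun do rewrite EFinM; apply: integrableZl => //.
  apply/integrableP; split; first exact: (smfun_EFin (smfun_gauss _)).
  under eq_integral do rewrite /= ger0_norm ?expR_ge0//.
  exact: eint_gauss_lty.
Qed.

Lemma EFin_rint n F : dec n F -> (rint n F)%:E = eint n (EFin \o F).
Proof. by move=> dF; rewrite fineK// integrable_fin_num//; exact: dec_int. Qed.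

Lemma eq_rint n F G : (forall s, size s = n -> F s = G s) -> rint n F = rint n G.
Proof. by move=> FG; apply: eq_Rintegral => t _; rewrite FG ?size_tuple. Qed.

Lemma dec_eq n F G : (forall s, size s = n -> F s = G s) -> dec n F -> dec n G.
Proof.
move=> FG [mF [K [a [K0 a0 FK]]]]; split.
  by move: mF; congr measurable_fun; apply/funext => t; rewrite FG ?size_tuple.
by exists K, a; split=> // s ss; rewrite -FG ?FK.
Qed.

Lemma dec0 n : dec n (fun=> 0).
Proof.
split; first exact: measurable_cst.
by exists 0, 1; split=> // s _; rewrite normr0 mul0r.
Qed.

Lemma decZ n c F : dec n F -> dec n (fun s => c * F s).
Proof.
move=> dF; apply: (dec_bounded_M (K := `|c|) dF) => //; exact: measurable_cst.
Qed.

Lemma dec_bound n F : dec n F -> exists2 K, 0 <= K & forall s, size s = n -> `|F s| <= K.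
Proof.
move=> [mF [K [a [K0 a0 FK]]]]; exists K => // s ss.
rewrite (le_trans (FK s ss))// ler_piMr// -expR0 ler_expR oppr_le0.
by rewrite mulr_ge0 ?sqn_ge0// ltW.
Qed.

Lemma decM n F G : dec n F -> dec n G -> dec n (fun s => F s * G s).
Proof.
move=> dF dG; have [K K0 FK] := dec_bound dF.
exact: (dec_bounded_M dG dF.1 FK).
Qed.

Lemma decD n F G : dec n F -> dec n G -> dec n (fun s => F s + G s).
Proof.
move=> [mF [K [a [K0 a0 FK]]]] [mG [L [b [L0 b0 GL]]]]; split.
  exact: measurable_funD.
exists (K + L), (Num.min a b); split; first exact: addr_ge0.
  by rewrite lt_min a0.
move=> s ss; rewrite (le_trans (ler_normD _ _))// mulrDl lerD//.
  rewrite (le_trans (FK s ss))// ler_wpM2l// ler_expR lerN2 ler_wpM2r ?sqn_ge0//.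
  by rewrite ge_min lexx.
rewrite (le_trans (GL s ss))// ler_wpM2l// ler_expR lerN2 ler_wpM2r ?sqn_ge0//.
by rewrite ge_min lexx orbT.
Qed.

Lemma decB n F G : dec n F -> dec n G -> dec n (fun s => F s - G s).
Proof.
move=> dF dG; apply: decD => //.
by apply: dec_eq (decZ (-1) dG) => s _; rewrite mulN1r.
Qed.

Lemma dec_sum n (T : Type) (r : seq T) (F : T -> seq R -> R) :
  (forall i, dec n (F i)) -> dec n (fun s => \sum_(i <- r) F i s).
Proof.
move=> dF; elim: r => [|i r IHr].
  by apply: dec_eq (dec0 n) => s _; rewrite big_nil.
by apply: dec_eq (decD (dF i) IHr) => s _; rewrite big_cons.
Qed.

Lemma dec_catl k n F x : dec (k + n) F -> size x = k -> dec n (fun y => F (x ++ y)).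
Proof.
move=> [mF [K [a [K0 a0 FK]]]] sx; split; first exact: smfun_catl mF sx.
exists K, a; split=> // s ss; rewrite (le_trans (FK _ _)) ?size_cat ?sx ?ss//.
rewrite ler_wpM2l// ler_expR lerN2 ler_wpM2l ?(ltW a0)// sqn_cat.
by rewrite lerDr sqn_ge0.
Qed.

Lemma dec_consl n F t : dec n.+1 F -> dec n (fun y => F (t :: y)).
Proof. by move=> dF; exact: (@dec_catl 1 n F [:: t] dF erefl). Qed.

Lemma smfun_take d (T : measurableType d) k n (u : seq R -> T) : smfun k u ->
  smfun (k + n) (fun s => u (take k s)).
Proof.
move=> mu; apply: (smfun_comp_seq mu) => [t|i ik].
  by rewrite size_takel// size_tuple leq_addr.
by under eq_fun do rewrite nth_take//; exact: measurable_nth_tuple.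
Qed.

Lemma smfun_drop d (T : measurableType d) k n (u : seq R -> T) : smfun n u ->
  smfun (k + n) (fun s => u (drop k s)).
Proof.
move=> mu; apply: (smfun_comp_seq mu) => [t|i ik].
  by rewrite size_drop size_tuple addKn.
by under eq_fun do rewrite nth_drop//; exact: measurable_nth_tuple.
Qed.

Lemma dec_tensor k n u v : dec k u -> dec n v ->
  dec (k + n) (fun s => u (take k s) * v (drop k s)).
Proof.
move=> [mu [K [a [K0 a0 uK]]]] [mv [L [b [L0 b0 vL]]]]; split.
  by apply: measurable_funM; [exact: smfun_take|exact: smfun_drop].
exists (K * L), (Num.min a b); split; first exact: mulr_ge0.
  by rewrite lt_min a0.
move=> s ss; have st : size (take k s) = k by rewrite size_takel// ss leq_addr.
have sd : size (drop k s) = n by rewrite size_drop ss addKn.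
rewrite -{3}(cat_take_drop k s) sqn_cat mulrDr opprD expRD mulrACA normrM.
apply: ler_pM => //.
  rewrite (le_trans (uK _ st))// ler_wpM2l// ler_expR lerN2 ler_wpM2r ?sqn_ge0//.
  by rewrite ge_min lexx.
rewrite (le_trans (vL _ sd))// ler_wpM2l// ler_expR lerN2 ler_wpM2r ?sqn_ge0//.
by rewrite ge_min lexx orbT.
Qed.

Lemma rint_ge0 n F : (forall s, size s = n -> 0 <= F s) -> 0 <= rint n F.
Proof. by move=> F0; apply: Rintegral_ge0 => t _; rewrite F0 ?size_tuple. Qed.

Lemma rintD n F G : dec n F -> dec n G -> rint n (fun s => F s + G s) = rint n F + rint n G.
Proof. by move=> dF dG; rewrite /rint RintegralD//; exact: dec_int. Qed.

Lemma rintB n F G : dec n F -> dec n G -> rint n (fun s => F s - G s) = rint n F - rint n G.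
Proof. by move=> dF dG; rewrite /rint RintegralB//; exact: dec_int. Qed.

Lemma rintZ n c F : dec n F -> rint n (fun s => c * F s) = c * rint n F.
Proof. by move=> dF; rewrite /rint RintegralZl//; exact: dec_int. Qed.

Lemma rint_sum n (T : Type) (r : seq T) (F : T -> seq R -> R) :
  (forall i, dec n (F i)) ->
  rint n (fun s => \sum_(i <- r) F i s) = \sum_(i <- r) rint n (F i).
Proof.
move=> dF; elim: r => [|i r IHr].
  rewrite big_nil -[RHS](mul0r (rint n (fun=> 0))) -(rintZ 0 (dec0 n)).
  by apply: eq_rint => s _; rewrite big_nil mul0r.
rewrite big_cons -IHr -rintD//; last exact: dec_sum.
by apply: eq_rint => s _; rewrite big_cons.
Qed.

Lemma le_rint n F G : dec n F -> dec n G -> (forall s, size s = n -> F s <= G s) ->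
  rint n F <= rint n G.
Proof.
move=> dF dG FG; apply: le_Rintegral => //; [exact: dec_int..|].
by move=> t _; rewrite FG ?size_tuple.
Qed.

Lemma rint0 F : rint 0 F = F [::].
Proof. by rewrite /rint /Rintegral -/(eint 0 (EFin \o F)) eint0. Qed.

Lemma dec_norm n F : dec n F -> dec n (fun s => `|F s|).
Proof.
move=> [mF [K [a [K0 a0 FK]]]]; split; first exact: measurableT_comp.
by exists K, a; split=> // s ss; rewrite normr_id FK.
Qed.

Lemma smfun_part k n (F : seq R -> R) : smfun (k + n) F -> (forall s, 0 <= F s) ->
  smfun k (fun x => rint n (fun y => F (x ++ y))).
Proof.
move=> /smfun_EFin mF F0; apply: (measurableT_comp (fine_measurable measurableT)).
by apply: (smfun_eint mF) => s; rewrite lee_fin.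
Qed.

Lemma dec_part k n F : dec (k + n) F -> dec k (fun x => rint n (fun y => F (x ++ y))).
Proof.
move=> dF; have [mF [K [a [K0 a0 FK]]]] := dF; have [mN _] := dec_norm dF; split.
  (* Tonelli gives measurable partial integrals for nonnegative functions only, so [F] is written as
     [(F + |F|) - |F|]. *)
  have m1 := smfun_part mN (fun s => normr_ge0 (F s)).
  have m2 : smfun k (fun x => rint n (fun y => F (x ++ y) + `|F (x ++ y)|)).
    apply: (smfun_part (F := fun s => F s + `|F s|)) => [|s].
      exact: measurable_funD.
    by rewrite -lerBlDl sub0r -normrN ler_norm.
  have := measurable_funB m2 m1; congr measurable_fun; apply/funext => t /=.
  have dt := dec_catl dF (size_tuple t).
  by rewrite rintD ?addrK//; exact: dec_norm.
exists (K * rint n (fun s => expR (- (a * sqn s)))), a; split=> //.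
  by rewrite mulr_ge0// rint_ge0// => s _; exact: expR_ge0.
move=> s ss; have dg := dec_gauss n a0.
rewrite (le_trans (le_normr_Rintegral _ _))//; first by exact: (dec_int (dec_catl dF ss)).
rewrite mulrAC -rintZ//.
apply: (le_rint (F := fun y => `|F (s ++ y)|)); first by apply: dec_norm; exact: dec_catl dF ss.
  exact: decZ.
move=> t st; rewrite (le_trans (FK _ _)) ?size_cat ?ss ?st//.
by rewrite sqn_cat mulrDr opprD expRD mulrA.
Qed.

Lemma rint_cat k n F : dec (k + n) F -> (forall s, 0 <= F s) ->
  rint (k + n) F = rint k (fun x => rint n (fun y => F (x ++ y))).
Proof.
move=> dF F0; have [mF _] := dF.
have mE : smfun (k + n) (EFin \o F) by exact: smfun_EFin.
apply: EFin_inj; rewrite EFin_rint// EFin_rint//; last exact: dec_part.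
rewrite eint_cat//; apply: eq_eint => x sx /=.
by rewrite EFin_rint//; exact: dec_catl dF sx.
Qed.

End Decay.

(** * Scalar products, orthogonal projections and Gram-Schmidt *)

Section InnerProduct.
Context {R : realType}.
Implicit Types (F G H : seq R -> R) (n k r : nat).

Definition ip n F G : R := rint n (fun s => F s * G s).
Definition nrm n F : R := Num.sqrt (ip n F F).

Lemma ipC n F G : ip n F G = ip n G F.
Proof. by apply: eq_rint => s _; rewrite mulrC. Qed.

Lemma eq_ip n F F' G G' : (forall s, size s = n -> F s = F' s) ->
  (forall s, size s = n -> G s = G' s) -> ip n F G = ip n F' G'.
Proof. by move=> FF GG; apply: eq_rint => s ss; rewrite FF ?GG. Qed.

Lemma eq_nrm n F F' : (forall s, size s = n -> F s = F' s) -> nrm n F = nrm n F'.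
Proof. by move=> FF; congr Num.sqrt; exact: eq_ip. Qed.

Lemma ip_ge0 n F : 0 <= ip n F F.
Proof. by apply: rint_ge0 => s _; rewrite -expr2 sqr_ge0. Qed.

Lemma ipDl n F G H : dec n F -> dec n G -> dec n H ->
  ip n (fun s => F s + G s) H = ip n F H + ip n G H.
Proof.
move=> dF dG dH; rewrite -rintD; [|exact: decM..].
by apply: eq_rint => s _; rewrite mulrDl.
Qed.

Lemma ipBl n F G H : dec n F -> dec n G -> dec n H ->
  ip n (fun s => F s - G s) H = ip n F H - ip n G H.
Proof.
move=> dF dG dH; rewrite -rintB; [|exact: decM..].
by apply: eq_rint => s _; rewrite mulrBl.
Qed.

Lemma ipZl n c F H : dec n F -> dec n H ->
  ip n (fun s => c * F s) H = c * ip n F H.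
Proof.
move=> dF dH; rewrite -rintZ; last exact: decM.
by apply: eq_rint => s _; rewrite mulrA.
Qed.

Lemma ip_suml n (T : Type) (l : seq T) (F : T -> seq R -> R) H :
  (forall i, dec n (F i)) -> dec n H ->
  ip n (fun s => \sum_(i <- l) F i s) H = \sum_(i <- l) ip n (F i) H.
Proof.
move=> dF dH; rewrite -rint_sum; last by move=> i; exact: decM.
by apply: eq_rint => s _; rewrite mulr_suml.
Qed.

Lemma nrm_ge0 n F : 0 <= nrm n F.
Proof. exact: sqrtr_ge0. Qed.

Lemma sqr_nrm n F : nrm n F ^+ 2 = ip n F F.
Proof. by rewrite sqr_sqrtr ?ip_ge0. Qed.

Lemma ip_sqrD n F G t : dec n F -> dec n G ->
  ip n (fun s => F s + t * G s) (fun s => F s + t * G s) =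
  ip n F F + 2 * t * ip n F G + t ^+ 2 * ip n G G.
Proof.
move=> dF dG; have dtG := decZ t dG; have dFG := decD dF dtG.
rewrite ipDl// ipZl// (ipC _ F) (ipC _ G) ipDl// ipDl// !ipZl// (ipC _ G F).
by ring.
Qed.

Lemma CauchySchwarz n F G : dec n F -> dec n G ->
  ip n F G ^+ 2 <= ip n F F * ip n G G.
Proof.
move=> dF dG; have P t := ip_ge0 n (fun s => F s + t * G s).
have {}P t : 0 <= ip n F F + 2 * t * ip n F G + t ^+ 2 * ip n G G.
  by rewrite -ip_sqrD.
have F0 := ip_ge0 n F; have G0 := ip_ge0 n G.
set a := ip n F F in P F0 *; set c := ip n G G in P G0 *; set b := ip n F G in P *.
have [c0|c0] := eqVneq c 0.
  have [->|b0] := eqVneq b 0; first by rewrite expr0n mulr_ge0.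
  (* With [c = 0] the quadratic is affine in [t], and at this point its value would be -1. *)
  have := P (- (a + 1) / (2 * b)); rewrite c0 mulr0 addr0.
  rewrite (_ : 2 * _ * b = - (a + 1)); last by field.
  by rewrite opprD addNKr oppr_ge0 ler10.
have {}c0 : 0 < c by rewrite lt_neqAle eq_sym c0.
have := P (- b / c); rewrite (_ : _ + _ = (a * c - b ^+ 2) / c); last first.
  by field; exact: lt0r_neq0.
by rewrite pmulr_lge0 ?invr_gt0// subr_ge0.
Qed.

(** Functions equal almost everywhere are not identified; a difference of norm zero is discarded
    through this consequence of Cauchy-Schwarz instead. *)
Lemma ip_null n F G : dec n F -> dec n G -> ip n F F = 0 -> ip n F G = 0.
Proof.
move=> dF dG F0; have := CauchySchwarz dF dG; rewrite F0 mul0r => h.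
by apply/eqP; rewrite -sqrf_eq0 eq_le h sqr_ge0.
Qed.

Lemma ler_nrmD n F G : dec n F -> dec n G ->
  nrm n (fun s => F s + G s) <= nrm n F + nrm n G.
Proof.
move=> dF dG; rewrite -(ler_pXn2r (_ : 0 < 2)%N) ?nnegrE ?addr_ge0 ?nrm_ge0//.
have -> : nrm n (fun s => F s + G s) = nrm n (fun s => F s + 1 * G s).
  by apply: eq_nrm => s _; rewrite mul1r.
rewrite sqrrD !sqr_nrm ip_sqrD// expr1n mul1r mulr1 lerD2r lerD2l.
rewrite -[leRHS]mulr_natl ler_pM2l// (le_trans (ler_norm _))//.
rewrite -(ler_pXn2r (_ : 0 < 2)%N) ?nnegrE ?mulr_ge0 ?nrm_ge0//.
by rewrite exprMn !sqr_nrm real_normK ?num_real// CauchySchwarz.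
Qed.

Lemma nrmZ n c F : dec n F -> nrm n (fun s => c * F s) = `|c| * nrm n F.
Proof.
move=> dF; rewrite /nrm ipZl//; last exact: decZ.
by rewrite ipC ipZl// mulrA -expr2 sqrtrM ?sqr_ge0// sqrtr_sqr.
Qed.

Definition oproj n r (e : nat -> seq R -> R) F (s : seq R) : R :=
  \sum_(i < r) ip n (e i) F * e i s.

(* Null vectors are allowed, so that Gram-Schmidt needs no linear independence. *)
Definition orthosys n r (e : nat -> seq R -> R) : Prop :=
  [/\ forall i, dec n (e i),
      forall i j, (i < r)%N -> (j < r)%N -> i != j -> ip n (e i) (e j) = 0 &
      forall i, (i < r)%N -> (forall s, e i s = 0) \/ ip n (e i) (e i) = 1].

Section Projection.
Variables (n r : nat) (e : nat -> seq R -> R).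
Hypothesis oe : orthosys n r e.

Lemma dec_proj F : dec n (oproj n r e F).
Proof. by have [de _ _] := oe; apply: dec_sum => i; apply: decZ. Qed.

Lemma ip_proj F j : dec n F -> (j < r)%N ->
  ip n (e j) (oproj n r e F) = ip n (e j) F.
Proof.
move=> dF jr; have [de o1 o2] := oe.
rewrite ipC ip_suml//; last by move=> i; exact: decZ.
under eq_bigr do rewrite ipZl//.
rewrite (bigD1 (Ordinal jr))//= big1 ?addr0 => [|i ij]; last first.
  by rewrite (o1 i j)// mulr0.
case: (o2 j jr) => [e0|->]; last by rewrite mulr1.
have E0 G : ip n (e j) G = 0.
  rewrite -[RHS](mul0r (rint n (fun=> 0))) -(rintZ 0 (dec0 n)).
  by apply: eq_rint => s _; rewrite e0 !mul0r.
by rewrite !E0 mul0r.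
Qed.

Lemma ip_proj_orth F G : dec n F -> dec n G ->
  ip n (fun s => F s - oproj n r e F s) (oproj n r e G) = 0.
Proof.
move=> dF dG; have [de o1 o2] := oe; have dP := dec_proj F.
have dB := decB dF dP.
rewrite ipC ip_suml//; last by move=> i; exact: decZ.
apply: big1 => i _; rewrite ipZl// [X in _ * X]ipC ipBl// [X in _ * (X - _)]ipC
  [X in _ * (_ - X)]ipC ip_proj//.
by rewrite subrr mulr0.
Qed.

Lemma ip_proj_pyth F : dec n F ->
  ip n F F = ip n (fun s => F s - oproj n r e F s) (fun s => F s - oproj n r e F s) +
             ip n (oproj n r e F) (oproj n r e F).
Proof.
move=> dF; have dP := dec_proj F; have dB := decB dF dP.
pose P := oproj n r e F; pose B s := F s - P s.
have BP : ip n B P = 0 := ip_proj_orth dF dF.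
have FP : ip n F P = ip n P P.
  by apply/eqP; rewrite -subr_eq0 -[X in X == _](ipBl dF dP dP); exact/eqP.
have BB : ip n B B = ip n F B - ip n P B := ipBl dF dP dB.
rewrite -/P -[X in _ = X + _]/(ip n B B) BB (ipC n P B) BP subr0 (ipC n F B).
by rewrite [X in _ = X + _](ipBl dF dP dF) (ipC n P) FP subrK.
Qed.

Lemma ip_proj_le F : dec n F -> ip n (oproj n r e F) (oproj n r e F) <= ip n F F.
Proof. by move=> dF; rewrite [leRHS]ip_proj_pyth// lerDr ip_ge0. Qed.

(** The residual of [F] is orthogonal to the range of the projection, and also to every [u i], which
    differs from its own projection by a function of norm zero. Pythagoras then applies to
    [(F - P F) + (P F - G)], where [P] is the projection and [G] the competing sum. *)
Lemma ip_proj_best F (u : nat -> seq R -> R) (a : nat -> R) :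
  dec n F -> (forall i, dec n (u i)) ->
  (forall i, (i < r)%N -> ip n (fun s => u i s - oproj n r e (u i) s)
     (fun s => u i s - oproj n r e (u i) s) = 0) ->
  ip n (fun s => F s - oproj n r e F s) (fun s => F s - oproj n r e F s) <=
  ip n (fun s => F s - \sum_(i < r) a i * u i s)
       (fun s => F s - \sum_(i < r) a i * u i s).
Proof.
move=> dF du u0; have dP := dec_proj F; have dB := decB dF dP.
pose G s := \sum_(i < r) a i * u i s.
have dG : dec n G by apply: dec_sum => i; apply: decZ.
have ou i : (i < r)%N -> ip n (fun s => F s - oproj n r e F s) (u i) = 0.
  move=> ir; have dPu := dec_proj (u i).
  have := ip_null (decB (du i) dPu) dB (u0 i ir).
  rewrite ipBl// [X in _ - X]ipC ip_proj_orth// subr0 => h.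
  by rewrite ipC.
have dPG := decB dP dG.
rewrite -[X in _ <= X](_ : ip n (fun s => (F s - oproj n r e F s) + 1 *
    (oproj n r e F s - G s)) (fun s => (F s - oproj n r e F s) + 1 *
    (oproj n r e F s - G s)) = _); last first.
  by apply: eq_ip => s _; rewrite mul1r addrA subrK.
have h : ip n (fun s => F s - oproj n r e F s) (fun s => oproj n r e F s - G s) = 0.
  rewrite ipC ipBl// [X in X - _]ipC ip_proj_orth// sub0r.
  rewrite ip_suml//; last by move=> i; exact: decZ.
  rewrite big1 ?oppr0// => i _.
  by rewrite ipZl// [X in _ * X]ipC ou// mulr0.
by rewrite ip_sqrD// h mulr0 addr0 expr1n mul1r lerDl ip_ge0.
Qed.

End Projection.

Lemma GramSchmidt n (u : nat -> seq R -> R) r : (forall i, dec n (u i)) ->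
  exists e, orthosys n r e /\
    forall i, (i < r)%N -> ip n (fun s => u i s - oproj n r e (u i) s)
      (fun s => u i s - oproj n r e (u i) s) = 0.
Proof.
move=> du; elim: r => [|r [e [oe ue]]].
  by exists (fun _ _ => 0); split=> //; split=> // i; exact: dec0.
have [de o1 o2] := oe.
pose w s := u r s - oproj n r e (u r) s.
have dPu F := dec_proj oe F.
have dw : dec n w by exact: decB.
(* A residual of norm zero contributes the zero function, so every [u i] still owns one index and
   the size of the system is known in advance. *)
pose c := if ip n w w == 0 then 0 else (nrm n w)^-1.
pose e' i := if (i < r)%N then e i else fun s => c * w s.
have de' i : dec n (e' i) by rewrite /e'; case: ifP => _ //; exact: decZ.
have er i : (i < r)%N -> e' i = e i by rewrite /e' => ->.
have err : e' r = (fun s => c * w s) by rewrite /e' ltnn.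
have ow i : (i < r)%N -> ip n (e i) w = 0.
  by move=> ir; rewrite ipC ipBl// !(ipC _ _ (e i)) (ip_proj oe)// subrr.
have oe' : orthosys n r.+1 e'.
  split=> // [i j|i]; rewrite !ltnS.
    rewrite leq_eqVlt => /orP[/eqP ->|ir].
      rewrite leq_eqVlt => /orP[/eqP ->|jr]; first by rewrite eqxx.
      by rewrite err er// ipZl// ipC ow// mulr0.
    rewrite leq_eqVlt => /orP[/eqP ->|jr] ij.
      by rewrite err er// ipC ipZl// ipC ow// mulr0.
    by rewrite !er// o1.
  rewrite leq_eqVlt => /orP[/eqP ->|ir]; last by rewrite er//; exact: o2.
  rewrite err /c; case: ifPn => w0; first by left => s; rewrite mul0r.
  right; rewrite ipZl//; last exact: decZ.
  rewrite ipC ipZl// -sqr_nrm; field.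
  by rewrite sqrtr_eq0 -ltNge lt_neqAle eq_sym w0 ip_ge0.
exists e'; split=> // i.
have projE F : dec n F -> forall s,
    oproj n r.+1 e' F s = oproj n r e F s + c * ip n w F * (c * w s).
  move=> dF s; rewrite /oproj big_ord_recr /= err ipZl//; congr (_ + _).
  by apply: eq_bigr => k _ /=; rewrite er.
have pw F : dec n F -> ip n (oproj n r e F) w = 0.
  move=> dF; rewrite ip_suml//; last by move=> k; exact: decZ.
  by apply: big1 => k _; rewrite ipZl// ow// mulr0.
rewrite ltnS leq_eqVlt => /orP[/eqP ->|ir].
  have wu : ip n w (u r) = ip n w w.
    by rewrite [RHS](ipBl (du r) (dPu _) dw) pw// subr0 ipC.
  have E s : u r s - oproj n r.+1 e' (u r) s = (1 - c * c * ip n w w) * w s.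
    by rewrite projE// wu /w; ring.
  rewrite (@eq_ip n _ (fun s => (1 - c * c * ip n w w) * w s) _
    (fun s => (1 - c * c * ip n w w) * w s))//.
  rewrite ipZl//; last exact: decZ.
  rewrite ipC ipZl// /c; case: eqVneq => [->|w0]; first by rewrite !mulr0.
  rewrite -[ip n w w]sqr_nrm -expr2 exprVn mulVf ?subrr ?mul0r//.
  by rewrite sqr_nrm.
(* An earlier [u i] lies in the old span up to a null function, hence is orthogonal to [w], and the
   new vector leaves its projection unchanged. *)
have wi : ip n w (u i) = 0.
  have := ip_null (decB (du i) (dPu _ )) dw (ue i ir).
  by rewrite ipBl// pw// subr0 ipC.
rewrite -[RHS](ue i ir); apply: eq_ip => s _; by rewrite projE// wi mulr0 mul0r addr0.
Qed.

End InnerProduct.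

(** * Tensor trains by successive projections *)

Section FTTSum.
Context {R : realType}.
Variables (r : nat -> nat) (g : nat -> nat -> R -> nat -> R) (x : nat -> R).

(** The row vector obtained by multiplying the first [d] core matrices from left to right, started
    from a vector of ones. *)
Fixpoint tt_state d : nat -> R :=
  if d is d'.+1 then
    fun b => \sum_(a < r d') tt_state d' a * g d' a (x d') b
  else fun=> 1.

Definition bonds d := {dffun forall k : 'I_d.+1, 'I_(r k)}.

Lemma bonds_rcons_subproof d (a : bonds d) (b : 'I_(r d.+1)) (k : 'I_d.+2) :
  ((if (k < d.+1)%N then a (inord k) : nat else b) < r k)%N.
Proof.
case: (ltnP k d.+1) => kd; first by apply: leq_trans (ltn_ord _) _; rewrite inordK.
apply: leq_trans (ltn_ord _) _.
have -> // : k = d.+1 :> nat by apply/eqP; rewrite eqn_leq kd -ltnS ltn_ord.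
Qed.

Definition bonds_rcons d (p : bonds d * 'I_(r d.+1)) : bonds d.+1 :=
  [ffun k => Ordinal (bonds_rcons_subproof p.1 p.2 k)].

Definition bonds_split d (a : bonds d.+1) : bonds d * 'I_(r d.+1) :=
  ([ffun k : 'I_d.+1 => (a (widen_ord (leqnSn d.+1) k) : 'I_(r k))], a ord_max).

Lemma bonds_widen d (p : bonds d * 'I_(r d.+1)) (k : 'I_d.+1) (k' : 'I_d.+2) :
  k' = k :> nat -> bonds_rcons p k' = p.1 k :> nat.
Proof.
by move=> kk; rewrite ffunE /= kk ltn_ord inord_val.
Qed.

Lemma bonds_last d (p : bonds d * 'I_(r d.+1)) (k' : 'I_d.+2) :
  k' = d.+1 :> nat -> bonds_rcons p k' = p.2 :> nat.
Proof. by move=> kk; rewrite ffunE /= kk ltnn. Qed.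

Lemma bonds_rcons_bij d : bijective (@bonds_rcons d).
Proof.
exists (@bonds_split d) => [[a b]|a].
  apply: injective_projections => /=.
    apply/ffunP => k; rewrite ffunE; apply: val_inj.
    exact: (@bonds_widen _ (a, b) k).
  by apply: val_inj; exact: (@bonds_last _ (a, b) ord_max).
apply/ffunP => k; apply: val_inj; have [kd|kd] := ltnP k d.+1.
  rewrite /= (@bonds_widen _ _ (Ordinal kd))//= ffunE /=.
  by congr (nat_of_ord (a _)); apply: val_inj.
have kE : k = ord_max by apply: val_inj; apply/eqP; rewrite eqn_leq kd -ltnS ltn_ord.
move: kd; rewrite {}kE => _.
exact: (@bonds_last _ (bonds_split a) ord_max).
Qed.

(** The free weight [H] on the last bond drives the induction: peeling off the last core turns it
    into a weight on the bond before. *)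
Lemma sum_bonds d (H : nat -> R) :
  \sum_(a : bonds d) (\prod_(j < d)
     g j (a (widen_ord (leqnSn d) j)) (x j) (a (lift ord0 j))) * H (a ord_max) =
  \sum_(b < r d) tt_state d b * H b.
Proof.
elim: d H => [|d IHd] H.
  rewrite (reindex (fun b : 'I_(r 0) => [ffun k : 'I_1 =>
    cast_ord (congr1 r (esym (congr1 val (ord1 k)))) b] : bonds 0)) /=.
    apply: eq_bigr => b _; rewrite big_ord0 ffunE /=; congr (_ * H _).
  exists (fun a : bonds 0 => a ord0) => [b _|a _].
    by rewrite ffunE; apply: val_inj.
  by apply/ffunP => k; rewrite ffunE; apply: val_inj => /=; rewrite (ord1 k).
rewrite (reindex _ (onW_bij _ (bonds_rcons_bij d))) /=.
rewrite (eq_bigr (fun p : bonds d * 'I_(r d.+1) => (\prod_(j < d)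
     g j (p.1 (widen_ord (leqnSn d) j)) (x j) (p.1 (lift ord0 j))) *
     (g d (p.1 ord_max) (x d) p.2 * H p.2))); last first.
  move=> p _; rewrite big_ord_recr /= -mulrA; congr (_ * (_ * _)).
  - apply: eq_bigr => j _; congr g; first exact: bonds_widen.
    exact: bonds_widen.
  - by congr g; [exact: bonds_widen|exact: bonds_last].
  - by congr H; exact: bonds_last.
rewrite -(pair_bigA _ (fun (a : bonds d) (b : 'I_(r d.+1)) => (\prod_(j < d)
     g j (a (widen_ord (leqnSn d) j)) (x j) (a (lift ord0 j))) *
     (g d (a ord_max) (x d) b * H b))) exchange_big /=.
apply: eq_bigr => b _; rewrite (IHd (fun a => g d a (x d) b * H b)) mulr_suml.
by apply: eq_bigr => a _; rewrite mulrA.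
Qed.

End FTTSum.

(** * Projections across the cuts and the tensor train they produce *)

Section CutProjection.
Context {R : realType}.
Local Notation TR := (measurableTypeR R).
Implicit Types (F G H : seq R -> R) (n k r : nat).

(* The orthogonal projection, for the scalar product in the last [n] variables,
   onto the span of the [e i]. *)
Definition cutproj k n r (e : nat -> seq R -> R) F (s : seq R) : R :=
  \sum_(i < r) rint n (fun y => e i y * F (take k s ++ y)) * e i (drop k s).

Lemma dec_cut_part k n u F : dec n u -> dec (k + n) F ->
  dec k (fun x => rint n (fun y => u y * F (x ++ y))).
Proof.
move=> du dF; have [K K0 uK] := dec_bound du.
have dG : dec (k + n) (fun s => u (drop k s) * F s).
  apply: (dec_bounded_M (K := K) dF); first exact: (smfun_drop du.1).
  by move=> s ss; apply: uK; rewrite size_drop ss addKn.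
apply: dec_eq (dec_part dG) => x sx.
by apply: eq_rint => y _; rewrite drop_size_cat.
Qed.

Lemma ip_cut k n G : dec (k + n) G ->
  ip (k + n) G G = rint k (fun x => ip n (fun y => G (x ++ y)) (fun y => G (x ++ y))).
Proof.
move=> dG; rewrite /ip rint_cat//; first exact: decM.
by move=> s; rewrite -expr2 sqr_ge0.
Qed.

Lemma dec_ip_cut k n G : dec (k + n) G ->
  dec k (fun x => ip n (fun y => G (x ++ y)) (fun y => G (x ++ y))).
Proof. by move=> dG; exact: (dec_part (decM dG dG)). Qed.

Section Cut.
Variables (k n r : nat) (e : nat -> seq R -> R).
Hypothesis oe : orthosys n r e.

Lemma cutproj_cat F x y : size x = k ->
  cutproj k n r e F (x ++ y) = oproj n r e (fun y => F (x ++ y)) y.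
Proof. by move=> sx; rewrite /cutproj take_size_cat// drop_size_cat. Qed.

Lemma dec_cutproj F : dec (k + n) F -> dec (k + n) (cutproj k n r e F).
Proof.
move=> dF; have [de _ _] := oe; apply: dec_sum => i.
exact: dec_tensor (dec_cut_part (de i) dF) (de i).
Qed.

Lemma cutprojB F G : dec (k + n) F -> dec (k + n) G ->
  forall s, size s = (k + n)%N ->
  cutproj k n r e (fun s => F s - G s) s =
  cutproj k n r e F s - cutproj k n r e G s.
Proof.
move=> dF dG s ss; have [de _ _] := oe; rewrite -sumrB; apply: eq_bigr => i _.
have sx : size (take k s) = k by rewrite size_takel// ss leq_addr.
have dFx := dec_catl dF sx; have dGx := dec_catl dG sx.
rewrite -mulrBl -rintB; [|exact: decM..].
by congr (_ * _); apply: eq_rint => y _; rewrite mulrBr.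
Qed.

(** For each fixed head of length [k] the operator is an orthogonal projection in the last [n]
    variables, so the inequality holds slice by slice and is then integrated over the head. *)
Lemma nrm_cutproj_le F : dec (k + n) F ->
  nrm (k + n) (cutproj k n r e F) <= nrm (k + n) F.
Proof.
move=> dF; rewrite ler_wsqrtr// !ip_cut//; last exact: dec_cutproj.
apply: le_rint; [exact/dec_ip_cut/dec_cutproj|exact: dec_ip_cut|].
move=> x sx; have dFx := dec_catl dF sx.
rewrite (eq_ip (F' := oproj n r e (fun y => F (x ++ y)))
  (G' := oproj n r e (fun y => F (x ++ y)))); first exact: ip_proj_le.
all: by move=> y _; rewrite cutproj_cat.
Qed.

(** On the slice with head [x], the numbers [a i x] are competing coefficients for [ip_proj_best];
    the slice inequalities are then integrated over [x]. *)
Lemma nrm_cutproj_best F (u a : nat -> seq R -> R) : dec (k + n) F ->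
  (forall i, dec n (u i)) -> (forall i, dec k (a i)) ->
  (forall i, (i < r)%N -> ip n (fun s => u i s - oproj n r e (u i) s)
     (fun s => u i s - oproj n r e (u i) s) = 0) ->
  nrm (k + n) (fun s => F s - cutproj k n r e F s) <=
  nrm (k + n) (fun s => F s - \sum_(i < r) a i (take k s) * u i (drop k s)).
Proof.
move=> dF du da u0; have dP := dec_cutproj dF.
have dS : dec (k + n) (fun s => \sum_(i < r) a i (take k s) * u i (drop k s)).
  by apply: dec_sum => i; exact: dec_tensor.
have dFP := decB dF dP; have dFS := decB dF dS.
rewrite ler_wsqrtr// (ip_cut dFP) (ip_cut dFS).
apply: le_rint; [exact: dec_ip_cut dFP|exact: dec_ip_cut dFS|].
move=> x sx; have dFx := dec_catl dF sx.
have := ip_proj_best oe (fun i => a i x) dFx du u0.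
rewrite -[X in X <= _](_ : ip n (fun y => F (x ++ y) - cutproj k n r e F (x ++ y))
  (fun y => F (x ++ y) - cutproj k n r e F (x ++ y)) = _); last first.
  by apply: eq_ip => y _; rewrite cutproj_cat.
move=> /le_trans; apply; rewrite le_eqVlt; apply/orP; left; apply/eqP.
by apply: eq_ip => y _; rewrite take_size_cat// drop_size_cat.
Qed.

End Cut.

Lemma tt_state_take (r : nat -> nat) g (x x' : nat -> R) k b :
  (forall i, (i < k)%N -> x i = x' i) ->
  tt_state r g x k b = tt_state r g x' k b.
Proof.
elim: k b => //= k IHk b xx; apply: eq_bigr => a _.
by rewrite xx// IHk// => i ik; rewrite xx// ltnS ltnW.
Qed.

(* Each projection acts on the trailing variables only, so the terms of
   [tt_iter k] keep their rank in the cuts already treated. *)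
Fixpoint tt_iter d (r : nat -> nat) (e : nat -> nat -> seq R -> R) F k : seq R -> R :=
  if k is k'.+1 then cutproj k (d - k) (r k) (e k) (tt_iter d r e F k') else F.

(** The coefficient, along basis function [b] of the next cut, of basis function [a] of cut [k] with
    its first variable frozen at [t]. *)
Definition tt_core d (e : nat -> nat -> seq R -> R) k a t b : R :=
  rint (d - k.+1) (fun y => e k.+1 b y * e k a (t :: y)).

Section TTIter.
Variables (d : nat) (r : nat -> nat) (e : nat -> nat -> seq R -> R) (F : seq R -> R).
Hypotheses (dF : dec d F) (r0 : r 0 = 1%N) (e0 : forall a, e 0 a = F).
Hypothesis oe : forall k, (0 < k < d)%N -> orthosys (d - k) (r k) (e k).

Lemma dec_tt_iter k : (k < d)%N -> dec d (tt_iter d r e F k).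
Proof.
elim: k => [//|k IHk] kd.
have := @dec_cutproj k.+1 (d - k.+1) (r k.+1) (e k.+1) (@oe k.+1 kd) (tt_iter d r e F k).
by rewrite subnKC ?(ltnW kd)//; apply; apply: IHk; exact: ltnW.
Qed.

Lemma dec_basis k a : (k < d)%N -> dec (d - k) (e k a).
Proof.
case: k => [|k] kd; first by rewrite subn0 e0.
by have [] := @oe k.+1 kd.
Qed.

Lemma nrm_tt_iter k delta : (k < d)%N ->
  (forall j, (0 < j < d)%N ->
    nrm d (fun s => F s - cutproj j (d - j) (r j) (e j) F s) <= delta) ->
  nrm d (fun s => F s - tt_iter d r e F k s) <= k%:R * delta.
Proof.
move=> kd Fd; elim: k kd => [|k IHk] kd /=.
  rewrite mul0r (eq_nrm (F' := fun s => 0 * F s)); last first.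
    by move=> s _; rewrite subrr mul0r.
  by rewrite nrmZ// normr0 mul0r.
have kd' : (k < d)%N by exact: ltnW.
have dFk := dec_tt_iter kd'; have dB := decB dF dFk.
have Ek : (k.+1 + (d - k.+1))%N = d by rewrite subnKC// ltnW.
have ok := @oe k.+1 kd.
have P G : dec d G -> dec d (cutproj k.+1 (d - k.+1) (r k.+1) (e k.+1) G).
  by have := @dec_cutproj k.+1 _ _ _ ok G; rewrite Ek.
have PB s : size s = d -> cutproj k.+1 (d - k.+1) (r k.+1) (e k.+1)
      (fun s => F s - tt_iter d r e F k s) s =
    cutproj k.+1 (d - k.+1) (r k.+1) (e k.+1) F s -
    cutproj k.+1 (d - k.+1) (r k.+1) (e k.+1) (tt_iter d r e F k) s.
  by move=> ss; apply: (cutprojB ok); rewrite ?Ek.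
rewrite (eq_nrm (F' := fun s =>
   (F s - cutproj k.+1 (d - k.+1) (r k.+1) (e k.+1) F s) +
   cutproj k.+1 (d - k.+1) (r k.+1) (e k.+1)
     (fun s => F s - tt_iter d r e F k s) s)); last first.
  by move=> s ss; rewrite PB// addrA subrK.
apply: (le_trans (ler_nrmD (decB dF (P _ dF)) (P _ dB))).
rewrite -natr1 mulrDl mul1r addrC lerD//; last exact: Fd.
apply: le_trans (IHk kd').
by have := @nrm_cutproj_le k.+1 _ _ _ ok (fun s => F s - tt_iter d r e F k s); rewrite Ek; apply.
Qed.

(** The state at bond [k] depends on the first [k] variables only, so it leaves the integral of the
    next projection. What remains inside are scalar products of consecutive bases, that is, the
    entries of the next core. *)
Lemma tt_iterE k s : (k < d)%N -> size s = d ->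
  tt_iter d r e F k s =
  \sum_(a < r k) tt_state r (tt_core d e) (nth 0 s) k a * e k a (drop k s).
Proof.
elim: k s => [|k IHk] s kd ss.
  by rewrite /= r0 big_ord1 mul1r drop0 e0.
have kd' : (k < d)%N by exact: ltnW.
rewrite /=; apply: eq_bigr => b _; congr (_ * _).
have st : size (take k.+1 s) = k.+1 by rewrite size_takel// ss ltnW.
have E y : size y = (d - k.+1)%N -> e k.+1 b y * tt_iter d r e F k (take k.+1 s ++ y) =
    \sum_(a < r k) tt_state r (tt_core d e) (nth 0 s) k a *
       (e k.+1 b y * e k a (s`_k :: y)).
  move=> sy; rewrite IHk//; last by rewrite size_cat st sy subnKC// ltnW.
  rewrite mulr_sumr; apply: eq_bigr => a _; rewrite mulrCA; congr (_ * (_ * _)).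
    apply: tt_state_take => i ik; rewrite nth_cat st ltnS (ltnW ik) nth_take//.
    by rewrite ltnS ltnW.
  congr (e k a _); rewrite drop_cat st ltnSn (take_nth 0) ?ss//.
  by rewrite -cats1 drop_size_cat ?size_takel ?ss// ltnW.
rewrite (eq_rint E) rint_sum; last first.
  move=> a; apply/decZ/decM; first exact: dec_basis.
  by apply: dec_consl; rewrite subnSK//; exact: dec_basis.
apply: eq_bigr => a _; rewrite rintZ//; apply: decM; first exact: dec_basis.
by apply: dec_consl; rewrite subnSK//; exact: dec_basis.
Qed.

(** Decay of the basis at bond [k.+1] is a separate hypothesis, because for the last core
    [k.+1 = d], which [oe] does not cover. *)
Lemma measurable_tt_core k a b : (k < d)%N -> (forall c, dec (d - k.+1) (e k.+1 c)) ->
  measurable_fun [set: TR] (fun t : TR => tt_core d e k a t b).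
Proof.
move=> kd de; have dk : dec (1 + (d - k.+1)) (e k a).
  by rewrite add1n subnSK//; exact: dec_basis.
have [m _] := dec_cut_part (de b) dk.
apply: (smfun_comp_seq (h := fun t => [:: t]) m) => // -[|//] _.
exact: measurable_id.
Qed.

End TTIter.

End CutProjection.

Section TTApprox.
Context {R : realType}.
Local Notation TR := (measurableTypeR R).

Lemma dec1 : dec 0 (fun=> 1 : R).
Proof.
split; first exact: measurable_cst.
exists 1, 1; split=> // s /size0nil ->.
by rewrite /sqn big_nil mulr0 oppr0 expR0 mul1r normr1.
Qed.

Theorem tt_approx d (F : seq R -> R) (delta : R) (r : nat -> nat)
    (a u : nat -> nat -> seq R -> R) : (0 < d)%N -> dec d F ->
  (forall k, (0 < k < d)%N ->
    [/\ forall i, dec k (a k i), forall i, dec (d - k) (u k i) &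
      nrm d (fun s => F s - \sum_(i < r k) a k i (take k s) * u k i (drop k s))
        <= delta]) ->
  exists fhat : seq R -> R,
    [/\ dec d fhat, nrm d (fun s => F s - fhat s) <= d.-1%:R * delta &
      has_ftt (fun k : 'I_d.+1 => if (0 < k < d)%N then r k else 1%N)
        (fun t : d.-tuple TR => fhat t)].
Proof.
move=> d0 dF H.
have /choice[e eP] k : exists e, (0 < k < d)%N -> orthosys (d - k) (r k) e /\
    forall i, (i < r k)%N -> ip (d - k) (fun s => u k i s - oproj (d - k) (r k) e (u k i) s)
      (fun s => u k i s - oproj (d - k) (r k) e (u k i) s) = 0.
  have [/H[_ du _]|] := boolP (0 < k < d)%N; last by exists (fun _ _ => 0).
  by have [e eP] := GramSchmidt (r k) du; exists e.
pose r' k := if (0 < k < d)%N then r k else 1%N.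
(* Bond [0] carries [F] itself and bond [d] the constant 1 in no variables, so the first and last
   cores obey the same formula as the inner ones. *)
pose e' k := if k == 0%N then fun=> F else if k == d then fun _ _ => 1 else e k.
have ek k : (0 < k < d)%N -> e' k = e k.
  by rewrite /e' => /andP[]; case: k => // k _; case: ltngtP.
have rk k : (0 < k < d)%N -> r' k = r k by rewrite /r' => ->.
have r0 : r' 0 = 1%N by [].
have e0 i : e' 0 i = F by [].
have oe k : (0 < k < d)%N -> orthosys (d - k) (r' k) (e' k).
  by move=> kd; rewrite ek// rk//; have [] := eP k kd.
have dd : (d.-1 < d)%N by rewrite prednK.
exists (tt_iter d r' e' F d.-1); split.
- exact: dec_tt_iter.
- apply: nrm_tt_iter => // k kd; have [da du] := H k kd; apply: le_trans.
  rewrite ek// rk//; have [ok uk] := eP k kd.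
  have kd' : (k <= d)%N by case/andP: kd => _ /ltnW.
  have := @nrm_cutproj_best _ k (d - k) _ _ ok F (u k) (a k); rewrite subnKC//.
  exact.
- split; rewrite /= ?ltnn ?andbF//.
  exists (fun j i t l => tt_core d e' j i t l); split.
    move=> j i l; apply: (measurable_tt_core dF e0 oe) => // c.
    have [jd|jd] := ltnP j.+1 d; first exact: (dec_basis dF e0 oe).
    have -> : j.+1 = d by apply/eqP; rewrite eqn_leq jd ltn_ord.
    rewrite subnn /e' eqxx; case: eqP => [E|_]; first by rewrite E in d0.
    exact: dec1.
  apply: aeW => t _; rewrite (tt_iterE dF r0 e0 oe)// ?size_tuple//.
  rewrite /ftt_eval.
  have := @sum_bonds R r' (tt_core d e') (nth 0 t) d (fun=> 1).
  rewrite (eq_bigr (fun b : 'I_(r' d) => tt_state r' (tt_core d e') (nth 0 t) d b)); last first.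
    by move=> b _; rewrite mulr1.
  have rd : r' d = 1%N by rewrite /r' ltnn andbF.
  move=> E; transitivity (\sum_(b < r' d) tt_state r' (tt_core d e') (nth 0 t) d b).
    (* There are only [d.-1] projections. The last core integrates over no variables, so it
       evaluates the basis functions of bond [d.-1] at the last variable. *)
    rewrite rd big_ord1 [X in _ = tt_state _ _ _ X _](esym (prednK d0)) /=.
    apply: eq_bigr => i _; congr (_ * _).
    rewrite /tt_core prednK// subnn rint0 /e' eqxx.
    case: (d == 0%N) / eqP => [E0|_]; first by rewrite E0 in d0.
    rewrite mul1r (drop_nth 0) ?size_tuple// prednK// drop_oversize ?size_tuple//.
  rewrite -E; apply: eq_bigr => b _; rewrite mulr1; apply: eq_bigr => j _.
  by rewrite (tnth_nth 0).
Qed.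

End TTApprox.

(** * Singular value decomposition *)

Section Rayleigh.
Context {R : realType}.

Definition dotm n (u v : 'cV[R]_n) : R := (u^T *m v) 0 0.

Lemma dotmE n (u v : 'cV[R]_n) : dotm u v = \sum_i u i 0 * v i 0.
Proof. by rewrite /dotm mxE; apply: eq_bigr => i _; rewrite mxE. Qed.

Lemma dotmC n (u v : 'cV[R]_n) : dotm u v = dotm v u.
Proof. by rewrite !dotmE; apply: eq_bigr => i _; rewrite mulrC. Qed.

Lemma dotmDl n (u v w : 'cV[R]_n) : dotm (u + v) w = dotm u w + dotm v w.
Proof. by rewrite /dotm linearD mulmxDl mxE. Qed.

Lemma dotmDr n (u v w : 'cV[R]_n) : dotm u (v + w) = dotm u v + dotm u w.
Proof. by rewrite /dotm mulmxDr mxE. Qed.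

Lemma dotmZl n c (u v : 'cV[R]_n) : dotm (c *: u) v = c * dotm u v.
Proof. by rewrite /dotm linearZ -scalemxAl mxE. Qed.

Lemma dotmZr n c (u v : 'cV[R]_n) : dotm u (c *: v) = c * dotm u v.
Proof. by rewrite /dotm -scalemxAr mxE. Qed.

Lemma dotmNl n (u v : 'cV[R]_n) : dotm (- u) v = - dotm u v.
Proof. by rewrite -scaleN1r dotmZl mulN1r. Qed.

Lemma dotmNr n (u v : 'cV[R]_n) : dotm u (- v) = - dotm u v.
Proof. by rewrite dotmC dotmNl dotmC. Qed.

Lemma dotmMl m n (A : 'M[R]_(m, n)) u v : dotm (A *m u) v = dotm u (A^T *m v).
Proof. by rewrite /dotm trmx_mul mulmxA. Qed.

Lemma dotm_ge0 n (u : 'cV[R]_n) : 0 <= dotm u u.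
Proof. by rewrite dotmE sumr_ge0// => i _; rewrite -expr2 sqr_ge0. Qed.

Lemma dotm_eq0 n (u : 'cV[R]_n) : (dotm u u == 0) = (u == 0).
Proof.
apply/eqP/eqP => [|->]; last by rewrite /dotm mulmx0 mxE.
rewrite dotmE => /eqP; rewrite psumr_eq0; last first.
  by move=> i _; rewrite -expr2 sqr_ge0.
move=> /allP u0; apply/colP => i; rewrite mxE; apply/eqP.
by have := u0 i (mem_index_enum _); rewrite -expr2 sqrf_eq0.
Qed.

Lemma dotm_gt0 n (u : 'cV[R]_n) : (0 < dotm u u) = (u != 0).
Proof. by rewrite lt_neqAle eq_sym dotm_eq0 dotm_ge0 andbT. Qed.

Lemma dotm_delta n (u : 'cV[R]_n) i : dotm (delta_mx i 0) u = u i 0.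
Proof. by rewrite /dotm trmx_delta -rowE mxE. Qed.

(** The quadratic form attains its maximum on the compact unit sphere, and the first-order condition
    at a maximizer is the eigenvector equation. *)
Lemma rayleigh_max n (S : 'M[R]_n.+1) : S^T = S ->
  exists v mu, [/\ dotm v v = 1, S *m v = mu *: v &
    forall x, dotm x (S *m x) <= mu * dotm x x].
Proof.
move=> sS; pose q (v : 'rV[R]_n.+1) := dotm v^T (S *m v^T).
pose A : set 'rV[R]_n.+1 := [set v | dotm v^T v^T = 1].
have cq (M : 'M[R]_n.+1) : continuous (fun v : 'rV[R]_n.+1 => dotm v^T (M *m v^T)).
  rewrite (_ : (fun v => _) = (fun v : 'rV[R]_n.+1 =>
      \sum_i v 0 i * \sum_j M i j * v 0 j)); last first.
    apply/funext => v; rewrite dotmE; apply: eq_bigr => i _.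
    by rewrite !mxE; congr (_ * _); apply: eq_bigr => j _; rewrite mxE.
  have cadd : continuous (fun z : R * R => z.1 + z.2) by exact: add_continuous.
  have mul_c (f g : 'rV[R]_n.+1 -> R) : continuous f -> continuous g ->
      continuous (fun v => f v * g v).
    by move=> cf cg v; exact: cvgM (cf v) (cg v).
  apply: (continuous_big cadd) => i _; apply: (mul_c); first exact: coord_continuous.
  apply: (continuous_big cadd) => j _.
  by apply: (mul_c); [exact: (@cst_continuous _ _ (M i j))|exact: coord_continuous].
have A0 : A !=set0.
  exists (delta_mx 0 0); rewrite /A /= dotmE (bigD1 0)//= big1 ?addr0.
    by rewrite !mxE eqxx mulr1.
  by move=> i i0; rewrite !mxE (negbTE i0) mul0r.
have cA : compact A.
  apply: bounded_closed_compact.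
    exists 1; split; first exact: real1.
    move=> x x1 v /= Av; rewrite (le_trans _ (ltW x1))//.
    rewrite [leLHS]/Num.norm /= mx_normrE; apply/bigmax_leP; split=> // -[i j] _ /=.
    rewrite -(ler_pXn2r (_ : 0 < 2)%N) ?nnegrE// expr1n real_normK ?num_real//.
    rewrite -Av dotmE (bigD1 j)//= !mxE (ord1 i) -expr2 lerDl sumr_ge0// => k _.
    by rewrite -expr2 sqr_ge0.
  rewrite (_ : A = (fun v : 'rV[R]_n.+1 => dotm v^T (1%:M *m v^T)) @^-1` [set 1]).
    by apply: preimage_closed => [v _|]; [exact: cq|exact: closed_eq].
  by apply/seteqP; split => v; rewrite /A /= mul1mx.
have [v vA vmax] := EVT_max_rV A0 cA (continuous_subspaceT (cq S)).
pose mu := q v; have v1 : dotm v^T v^T = 1 by move: vA; rewrite inE.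
have Q x : dotm x (S *m x) <= mu * dotm x x.
  have [->|x0] := eqVneq x 0.
    by rewrite mulmx0 /dotm !mulmx0 mxE mulr0.
  have dx : 0 < dotm x x by rewrite dotm_gt0.
  pose c := (Num.sqrt (dotm x x))^-1.
  have c2 : c * c = (dotm x x)^-1.
    by rewrite -expr2 exprVn sqr_sqrtr// ltW.
  have := vmax (c *: x)^T; rewrite inE /A /= trmxK -scalemxAr !dotmZl !dotmZr.
  rewrite mulrA c2 mulVf ?lt0r_neq0// => /(_ erefl).
  by rewrite mulrA c2 mulrC ler_pdivrMr.
exists v^T, mu; split=> //; apply/eqP; rewrite -subr_eq0 -dotm_eq0.
set w := _ - _; set vt := v^T in v1 w *.
have b2 : dotm vt (S *m w) = dotm w (S *m vt).
  by rewrite -[in LHS]sS -dotmMl dotmC.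
pose c := mu * dotm w w - dotm w (S *m w).
have c0 : 0 <= c by rewrite subr_ge0.
have ww : dotm w w = dotm w (S *m vt) - mu * dotm w vt.
  by rewrite {2}/w dotmDr -scaleNr dotmZr mulNr.
clearbody w.
(* Moving the maximizer by [t] along the residual [w] gives [2 t |w|^2 <= t^2 c]; this [t] turns it
   into [2 t^2 (c + 1) <= t^2 c], which forces [t = 0] and so [w = 0]. *)
pose t := dotm w w / (c + 1).
have := Q (vt + t *: w).
rewrite mulmxDr -scalemxAr !(dotmDl, dotmDr, dotmZl, dotmZr) b2 v1.
rewrite -[dotm vt (S *m vt)]/mu (dotmC vt w) => h.
have c1 : c + 1 != 0 by rewrite lt0r_neq0// ltr_wpDl.
have {h} : 2 * t * dotm w w <= t ^+ 2 * c.
  by rewrite ww /c; move: h; lra.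
have -> : 2 * t * dotm w w = 2 * t ^+ 2 * (c + 1) by rewrite /t; field.
have t2 := sqr_ge0 t => h.
have {t2 h} : t ^+ 2 = 0.
  apply/eqP; rewrite eq_le t2 andbT; have := mulr_ge0 t2 c0; lra.
move/eqP; rewrite sqrf_eq0 /t mulf_eq0 invr_eq0 (negbTE c1) orbF.
by [].
Qed.

End Rayleigh.

Section SVD.
Context {R : realType}.

Lemma symmetricmx_tr n (G : 'M[R]_n) : G \is symmetricmx -> G^T = G.
Proof.
move=> /is_hermitianmxP; rewrite expr0 scale1r => {2}->.
by rewrite map_mx_id.
Qed.

(** Maximizing the form of [- G] yields an eigenvalue [mu] of [- G]; since [- mu] is an eigenvalue
    of [G], it is at least [l]. *)
Lemma rayleigh_min n (G : 'M[R]_n) l : G^T = G -> smallest_eigenvalue G l ->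
  forall x, l * dotm x x <= dotm x (G *m x).
Proof.
case: n G => [|n] G sG [_ lP] x; first by rewrite !dotmE !big_ord0 mulr0.
have sN : (- G)^T = - G by rewrite linearN /= sG.
have [v [mu [v1 Gv Q]]] := rayleigh_max sN.
have eG : eigenvalue G (- mu).
  apply/eigenvalueP; exists v^T.
    by rewrite -[in LHS]sG -trmx_mul -[G]opprK mulNmx Gv -scaleNr linearZ /=.
  by rewrite trmx_eq0 -dotm_eq0 v1 oner_neq0.
have := Q x; rewrite mulNmx -scaleN1r dotmZr mulN1r lerNl; apply: le_trans.
by rewrite -mulNr ler_wpM2r ?dotm_ge0// lP.
Qed.

Definition isometrymx n (U : 'M[R]_n) := U^T *m U = 1%:M.

Lemma isometrymxC n (U : 'M[R]_n) : isometrymx U -> U *m U^T = 1%:M.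
Proof. by move=> /mulmx1C. Qed.

Lemma isometrymxM n (U V : 'M[R]_n) : isometrymx U -> isometrymx V -> isometrymx (U *m V).
Proof.
by move=> oU oV; rewrite /isometrymx trmx_mul mulmxA -(mulmxA _ U^T) oU mulmx1.
Qed.

Lemma dotm_ortho n (U : 'M[R]_n) x y : isometrymx U -> dotm (U *m x) (U *m y) = dotm x y.
Proof. by move=> oU; rewrite dotmMl mulmxA oU mul1mx. Qed.

(** The reflection in the hyperplane orthogonal to [w = e - u] exchanges [e] and [u], because
    [|w|^2 = 2 <w, e>] for unit vectors. *)
Lemma householder n (u : 'cV[R]_n.+1) : dotm u u = 1 ->
  exists2 H, isometrymx H & H *m delta_mx 0 0 = u.
Proof.
move=> u1; pose e : 'cV[R]_n.+1 := delta_mx 0 0.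
have e1 : dotm e e = 1 by rewrite dotm_delta mxE !eqxx.
have [->|ue] := eqVneq u e; first by exists 1%:M; rewrite /isometrymx ?trmx1 mul1mx.
pose w := e - u; have w0 : dotm w w != 0 by rewrite dotm_eq0 subr_eq0 eq_sym.
have wE : dotm w w = 2 * dotm w e.
  rewrite /w !(dotmDl, dotmDr) !(dotmNl, dotmNr) e1 u1 (dotmC e u).
  by ring.
pose c := 2 / dotm w w; pose H : 'M[R]_n.+1 := 1%:M - c *: (w *m w^T).
have wx x : (w *m w^T) *m x = dotm w x *: w.
  by rewrite -mulmxA [w^T *m x]mx11_scalar mul_mx_scalar.
have sH : H^T = H by rewrite /H linearB linearZ /= trmx1 trmx_mul trmxK.
have Hw : H *m w = - w.
  rewrite /H mulmxBl mul1mx -scalemxAl wx scalerA /c divfK//.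
  by rewrite scaler_nat mulr2n opprD addNKr.
exists H.
  rewrite /isometrymx sH {2}/H mulmxBr mulmx1 -scalemxAr mulmxA Hw mulNmx.
  by rewrite scalerN opprK /H subrK.
rewrite /H mulmxBl mul1mx -scalemxAl wx scalerA (_ : c * _ = 1).
  by rewrite scale1r /w opprB addrCA subrr addr0.
by rewrite /c wE; field; move: w0; rewrite wE mulf_eq0 pnatr_eq0.
Qed.

Definition diagrect m n (rho : nat -> R) : 'M[R]_(m, n) :=
  \matrix_(i, j) (rho i *+ (i == j :> nat)).

Definition svd m n (B : 'M[R]_(m, n)) (U : 'M[R]_m) (V : 'M[R]_n) rho : Prop :=
  [/\ isometrymx U, isometrymx V, U^T *m B *m V = diagrect m n rho,
      (forall i, 0 <= rho i) /\ (forall i, (minn m n <= i)%N -> rho i = 0) &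
      forall i, rho i.+1 <= rho i].

(* Deflation: a maximizer [v] of [`|B x|] on the unit sphere and [u = B v / `|B v|]
   are moved to the first basis vectors by Householder reflections. *)
Lemma svd_exists m n (B : 'M[R]_(m, n)) : exists U V rho, svd B U V rho /\
  forall c, 0 <= c -> (forall x, dotm (B *m x) (B *m x) <= c * dotm x x) ->
    rho 0 ^+ 2 <= c.
Proof.
have ortho1 k : isometrymx (1%:M : 'M[R]_k) by rewrite /isometrymx trmx1 mul1mx.
have svd0 k l : svd (0 : 'M[R]_(k, l)) 1%:M 1%:M (fun=> 0).
  split=> //; rewrite mulmx0 mul0mx.
  by apply/matrixP => i j; rewrite !mxE mul0rn.
elim: m n B => [|m IHm] [|n] B.
- by exists 1%:M, 1%:M, (fun=> 0); split=> [|c c0 _]; rewrite ?[B]flatmx0// expr0n.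
- by exists 1%:M, 1%:M, (fun=> 0); split=> [|c c0 _]; rewrite ?[B]flatmx0// expr0n.
- by exists 1%:M, 1%:M, (fun=> 0); split=> [|c c0 _]; rewrite ?[B]thinmx0// expr0n.
have sB : (B^T *m B)^T = B^T *m B by rewrite trmx_mul trmxK.
have [v [mu [v1 Sv Q]]] := rayleigh_max sB.
have {}Q x : dotm (B *m x) (B *m x) <= mu * dotm x x by rewrite dotmMl mulmxA.
have muE : mu = dotm (B *m v) (B *m v) by rewrite dotmMl mulmxA Sv dotmZr v1 mulr1.
have mu0 : 0 <= mu by rewrite muE dotm_ge0.
have [mu00|muN0] := eqVneq mu 0.
  exists 1%:M, 1%:M, (fun=> 0); split=> [|c c0 _]; last by rewrite expr0n.
  suff -> : B = 0 by exact: svd0.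
  apply/matrixP => i j; rewrite [RHS]mxE.
  have /eqP := Q (delta_mx j 0); rewrite mu00 mul0r => /eqP Qj.
  have /eqP : dotm (B *m delta_mx j 0) (B *m delta_mx j 0) == 0.
    by rewrite eq_le Qj dotm_ge0.
  move=> /eqP; rewrite dotm_eq0 -colE => /eqP /colP /(_ i).
  by rewrite !mxE.
pose rh := Num.sqrt mu; have rh2 : rh ^+ 2 = mu by rewrite sqr_sqrtr.
have rhN0 : rh != 0 by rewrite -sqrf_eq0 rh2.
pose u := rh^-1 *: (B *m v).
have u1 : dotm u u = 1.
  by rewrite dotmZl dotmZr -muE -rh2; field.
have [U0 oU0 U0e] := householder u1; have [V0 oV0 V0e] := householder v1.
pose C : 'M[R]_(m.+1, n.+1) := U0^T *m B *m V0.
pose C' : 'M[R]_(m, n) := drsubmx (C : 'M[R]_(1 + m, 1 + n)).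
have U0u : U0^T *m u = delta_mx 0 0 by rewrite -U0e mulmxA oU0 mul1mx.
have V0v : V0^T *m v = delta_mx 0 0 by rewrite -V0e mulmxA oV0 mul1mx.
have Bv : B *m v = rh *: u by rewrite scalerA mulfV// scale1r.
(* The eigenvector equation for [B^T B] clears the first row of [C] off the diagonal, just as
   [B v = rh u] clears the first column. *)
have uB : u^T *m B = rh *: v^T.
  rewrite -[LHS]trmxK trmx_mul trmxK /u -scalemxAr mulmxA Sv scalerA -rh2.
  by rewrite linearZ; congr (_ *: _); field.
have C0 : C *m delta_mx 0 0 = rh *: delta_mx 0 0 :> 'cV[R]_m.+1.
  by rewrite /C -mulmxA V0e -mulmxA Bv -scalemxAr U0u.
have C0T : delta_mx 0 0 *m C = rh *: delta_mx 0 0 :> 'rV[R]_n.+1.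
  rewrite -[X in X *m _]trmxK trmx_delta /C -!mulmxA mulmxA -trmx_mul U0e mulmxA uB.
  by rewrite -scalemxAl -[v^T *m V0]trmxK trmx_mul trmxK V0v trmx_delta.
have CD : U0^T *m B *m V0 = C by [].
clearbody C.
have CE : C = block_mx rh%:M 0 0 C' :> 'M[R]_(1 + m, 1 + n).
  rewrite -[LHS](@submxK _ 1 m 1 n); congr block_mx.
  - apply/matrixP => i j; rewrite !ord1 !mxE eqxx mulr1n.
    have /colP/(_ 0) := C0; rewrite -colE !mxE !eqxx mulr1 => <-.
    by congr (C _ _); apply: val_inj.
  - apply/matrixP => i j; rewrite !ord1 !mxE.
    have /rowP/(_ (rshift 1 j)) := C0T; rewrite -rowE !mxE eqxx /= mulr0 => <-.
    by congr (C _ _); apply: val_inj.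
  - apply/matrixP => i j; rewrite !ord1 !mxE.
    have /colP/(_ (rshift 1 i)) := C0; rewrite -colE !mxE /= mulr0 => <-.
    by congr (C _ _); apply: val_inj.
have [U' [V' [rho' [[oU' oV' svd' [rho'0 rho'm] rho'd] max']]]] := IHm n C'.
have col0 k (x : 'cV[R]_k) : dotm (col_mx (0 : 'cV_1) x) (col_mx 0 x) = dotm x x.
  by rewrite /dotm tr_col_mx mul_row_col trmx0 mul0mx add0r.
(* The deflated block inherits the bound [mu]. The maximality clause carried by the induction
   converts this into [rho' 0 <= rh], the ordering of the singular values. *)
have Q' x : dotm (C' *m x) (C' *m x) <= mu * dotm x x.
  have oU0T : isometrymx U0^T by rewrite /isometrymx trmxK; exact: isometrymxC.
  pose x0 : 'cV[R]_(1 + n) := col_mx 0 x.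
  have Cx : C *m x0 = col_mx 0 (C' *m x) :> 'cV[R]_(1 + m).
    have E := mul_block_col (rh%:M : 'M[R]_1) 0 0 C' (0 : 'cV[R]_1) x.
    by rewrite !mul0mx mulmx0 !add0r in E; rewrite CE; exact: E.
  have := Q (V0 *m x0); rewrite (dotm_ortho _ _ oV0) col0.
  by rewrite -(dotm_ortho _ _ oU0T) !mulmxA CD Cx col0.
pose blk k (W : 'M[R]_k) : 'M[R]_(1 + k) := block_mx 1%:M 0 0 W.
have oblk k (W : 'M[R]_k) : isometrymx W -> isometrymx (blk k W).
  move=> oW; rewrite /isometrymx tr_block_mx mulmx_block !trmx0 trmx1.
  by rewrite !mul0mx !mulmx0 !mulmx1 !addr0 add0r oW -scalar_mx_block.
exists (U0 *m blk m U'), (V0 *m blk n V').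
exists (fun i => if i is i'.+1 then rho' i' else rh); split; last first.
  by move=> c c0 Bc; rewrite rh2 muE (le_trans (Bc v))// v1 mulr1.
split; [exact/isometrymxM/oblk|exact/isometrymxM/oblk| | |].
- have E : (blk m U')^T *m (block_mx rh%:M 0 0 C' : 'M[R]_(1 + m, 1 + n)) *m blk n V' =
      block_mx rh%:M 0 0 (U'^T *m C' *m V').
    rewrite tr_block_mx !mulmx_block !trmx0 trmx1.
    by do !rewrite (mul0mx, mulmx0, mul1mx, mulmx1, addr0, add0r).
  rewrite trmx_mul -!mulmxA (mulmxA U0^T) (mulmxA (U0^T *m B)) CD mulmxA CE.
  apply: etrans E _; rewrite svd'.
  apply/matrixP => i j; rewrite [RHS]mxE.
  case: (split_ordP i) => i' ->; case: (split_ordP j) => j' ->.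
  + by rewrite block_mxEul !ord1 mxE.
  + by rewrite block_mxEur !ord1 mxE.
  + by rewrite block_mxEdl !ord1 mxE.
  + by rewrite block_mxEdr mxE /= !add1n eqSS.
- split=> [[|i]|[|i]]//; first exact: sqrtr_ge0.
  - by rewrite minnSS.
  - by rewrite minnSS ltnS; exact: rho'm.
- move=> [|i]//; rewrite -(ler_pXn2r (_ : 0 < 2)%N) ?nnegrE ?sqrtr_ge0//.
  by rewrite rh2; exact: max'.
Qed.

End SVD.

Section Eigenvalues.
Context {R : realType}.

Lemma char_poly_ortho n (V D : 'M[R]_n) : isometrymx V ->
  char_poly (V *m D *m V^T) = char_poly D.
Proof.
move=> oV; rewrite /char_poly.
have -> : char_poly_mx (V *m D *m V^T) =
    map_mx polyC V *m char_poly_mx D *m map_mx polyC V^T.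
  rewrite /char_poly_mx mulmxBr mulmxBl !map_mxM; congr (_ - _).
  rewrite mul_mx_scalar -scalemxAl -map_mxM isometrymxC// map_mx1.
  by rewrite scalemx1.
rewrite !det_mulmx mulrAC -det_mulmx -map_mxM isometrymxC//.
by rewrite map_mx1 det1 mul1r.
Qed.

(** Both lists are sorted, so it suffices to compare multiplicities, and those are read off the
    factorization of the characteristic polynomial. *)
Lemma eigenvalues_diag n (V : 'M[R]_n) (mu : nat -> R) : isometrymx V ->
  (forall i, mu i.+1 <= mu i) ->
  eigenvalues (V *m diag_mx (\row_(j < n) mu j) *m V^T) = mkseq mu n.
Proof.
move=> oV mud; rewrite /eigenvalues char_poly_ortho// char_poly_trig; last first.
  by apply/is_trig_mxP => i j ij; rewrite mxE; case: eqP ij => [->|]; rewrite ?ltnn.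
set p := \prod_(_ < n) _.
have pE : p = \prod_(x <- mkseq mu n) ('X - x%:P).
  rewrite big_map -{1}(subn0 n) -/(index_iota 0 n) big_mkord.
  by apply: eq_bigr => i _; rewrite !mxE eqxx.
have p0 : p != 0 by rewrite pE monic_neq0// monic_prod_XsubC.
have ge_trans : transitive (>=%R : rel R) by move=> y x z /[swap]; exact: le_trans.
have ge_anti : antisymmetric (>=%R : rel R).
  by move=> x y /= /andP[xy yx]; apply: le_anti; apply/andP; split.
apply: (sorted_eq ge_trans ge_anti).
- by apply: sort_sorted => x y; rewrite /= le_total.
- by apply/(sortedP 0) => i; rewrite size_mkseq => ni; rewrite !nth_mkseq ?(ltnW ni)//=; exact: mud.
rewrite perm_sort; apply/allP => y _ /=; apply/eqP.
rewrite -[RHS]mu_prod_XsubC -pE count_flatten -map_comp sumnE big_map.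
under eq_bigr => x _ do rewrite /= count_nseq /=.
have uR : uniq (rootsR p) by exact: uniq_roots.
have [yp|yp] := boolP (y \in rootsR p).
  rewrite (bigD1_seq y)//= eqxx mul1n big1 ?addn0// => x xy.
  by rewrite (negbTE xy) mul0n.
rewrite big_seq big1 => [|x xp]; last first.
  have -> : (x == y) = false by apply: contraNF yp => /eqP <-.
  by rewrite mul0n.
by rewrite mupNroot//; move: yp; rewrite -roots_on_rootsR// in_itv.
Qed.

Lemma tr_diagrectM m n (rho : nat -> R) : (forall i, (minn m n <= i)%N -> rho i = 0) ->
  (diagrect m n rho)^T *m diagrect m n rho = diag_mx (\row_(j < n) rho j ^+ 2).
Proof.
move=> rho0; apply/matrixP => i j; rewrite !mxE.
under eq_bigr do rewrite !mxE.
have [im|im] := ltnP i m; last first.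
  rewrite (rho0 i) ?geq_min ?im// expr0n mul0rn big1// => a _.
  by rewrite (_ : (a == i :> nat) = false) ?mul0r// ltn_eqF// (leq_trans (ltn_ord a)).
rewrite (bigD1 (Ordinal im))//= eqxx mulr1n big1 ?addr0 => [|a ai]; last first.
  by rewrite (_ : (a == i :> nat) = false) ?mul0r//; exact: negbTE ai.
by rewrite mulrnAr -expr2; congr (_ *+ _).
Qed.

Lemma svd_tmul m n (B : 'M[R]_(m, n)) U V rho : svd B U V rho ->
  B^T *m B = V *m diag_mx (\row_(j < n) rho j ^+ 2) *m V^T.
Proof.
case=> oU oV UBV [_ rho0] _; rewrite -(tr_diagrectM rho0) -UBV !trmx_mul trmxK !mulmxA.
rewrite isometrymxC// mul1mx -!mulmxA isometrymxC// mulmx1 (mulmxA U) isometrymxC//.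
by rewrite mul1mx.
Qed.

(** Links the values defined through the eigenvalues of [B^T B] with the diagonal of any ordered
    decomposition. *)
Lemma svd_singular_values m n (B : 'M[R]_(m, n)) U V rho i : svd B U V rho ->
  (i < minn m n)%N -> (singular_values B)`_i = rho i.
Proof.
move=> sB imn; have [_ oV _ [rho_ge0 _] rhod] := sB.
rewrite /singular_values (svd_tmul sB) (eigenvalues_diag (mu := fun j => rho j ^+ 2) oV); last first.
  by move=> j; rewrite ler_pXn2r ?nnegrE.
rewrite (nth_map 0) ?size_take ?size_mkseq; last first.
  by case: ifP => //; rewrite leq_min in imn; case/andP: imn.
rewrite nth_take// nth_mkseq; last by rewrite leq_min in imn; case/andP: imn.
by rewrite sqrtr_sqr ger0_norm.
Qed.

End Eigenvalues.

(** * Normal form of a positive definite matrix split by a cut *)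

Section NormalForm.
Context {R : realType}.

(** Eliminating the first row and column leaves the Schur complement [D'], whose form is that of [S]
    on the vectors [L (0, y)] and hence positive definite. The pivot is normalized by
    [1 / sqrt a]. *)
Lemma posdef_whiten n (S : 'M[R]_n) : S^T = S -> posdefmx S ->
  exists P : 'M[R]_n, P^T *m S *m P = 1%:M.
Proof.
elim: n S => [|n IHn] S sS pS; first by exists 1%:M; rewrite [LHS]flatmx0 [RHS]flatmx0.
pose S' : 'M[R]_(1 + n) := S; have sS' : S'^T = S' := sS.
pose a := ulsubmx S' 0 0; pose r := ursubmx S'; pose D := drsubmx S'.
have SE : S' = block_mx a%:M r r^T D.
  rewrite -[LHS]submxK; congr block_mx; first by rewrite [LHS]mx11_scalar.
  by rewrite /r trmx_ursub sS'.
have a0 : 0 < a.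
  have := pS (delta_mx 0 0); rewrite -mulmxA -[(_ *m _) 0 0]/(dotm _ _) dotm_delta -colE mxE.
  move=> h; rewrite (_ : a = S 0 0); last by rewrite /a !mxE /S'; congr (S _ _); exact: val_inj.
  apply: h; apply/eqP => /colP/(_ 0); rewrite !mxE !eqxx => /eqP.
  by rewrite oner_eq0.
have aN0 : a != 0 by exact: lt0r_neq0.
pose L : 'M[R]_(1 + n) := block_mx 1%:M (- a^-1 *: r) 0 1%:M.
pose D' := D - a^-1 *: (r^T *m r).
have LSL : L^T *m S' *m L = block_mx a%:M 0 0 D'.
  rewrite SE /L tr_block_mx !trmx1 trmx0 mulmx_block !mul1mx !mul0mx !addr0.
  rewrite mulmx_block !mulmx1 !mulmx0 !addr0.
  have tr : (- a^-1 *: r)^T = - a^-1 *: r^T by rewrite linearZ.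
  have aa : (- a^-1 *: r^T) *m a%:M = - r^T.
    by rewrite mul_mx_scalar scalerA mulrN mulfV// scaleN1r.
  rewrite tr aa addNr !mul0mx add0r; congr block_mx.
    by rewrite mul_scalar_mx scalerA mulrN mulfV// scaleN1r addNr.
  by rewrite /D' -scalemxAl scaleNr addrC.
have sD' : D'^T = D'.
  rewrite /D' linearB linearZ /= trmx_mul trmxK; congr (_ - _).
  by rewrite /D trmx_drsub sS'.
have pD' : posdefmx D'.
  move=> y y0; pose x : 'cV[R]_(1 + n) := L *m col_mx 0 y.
  have x0 : x != 0.
    apply: contra_neq y0; rewrite /x mul_block_col; do !rewrite (mul1mx, mulmx0, mul0mx, add0r).
    by rewrite -[0 in RHS]col_mx0 => /eq_col_mx[].
  have E : x^T *m S *m x = (col_mx (0 : 'cV[R]_1) y)^T *m (L^T *m S' *m L) *m col_mx 0 y.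
    by rewrite /x trmx_mul !mulmxA.
  have := pS x x0; rewrite E LSL tr_col_mx mul_row_block.
  do !rewrite (mulmx0, trmx0, mul0mx, add0r).
  by rewrite mul_row_col mul0mx add0r.
have [P' P'E] := IHn _ sD' pD'.
pose c := (Num.sqrt a)^-1.
pose K : 'M[R]_(1 + n) := block_mx c%:M 0 0 P'.
exists (L *m K).
have -> : (L *m K)^T *m S *m (L *m K) = K^T *m (L^T *m S' *m L) *m K.
  by rewrite trmx_mul !mulmxA.
rewrite LSL /K tr_block_mx !trmx0 !mulmx_block.
do !rewrite (mul0mx, mulmx0, addr0, add0r).
rewrite P'E.
rewrite tr_scalar_mx -!scalar_mxM (_ : c * a * c = 1) -?scalar_mx_block//.
rewrite mulrAC -expr2 exprVn sqr_sqrtr ?mulVf//; exact: ltW.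
Qed.

End NormalForm.

Section CutNormalForm.
Context {R : realType}.

Lemma sum_ord_head n i (f : nat -> R) : (i < n)%N ->
  \sum_(j < n) (if (j <= i)%N then f j else 0) = \sum_(j < i.+1) f j.
Proof. by move=> ni; rewrite -big_mkcond (big_ord_widen n f ni). Qed.

(** Supplies the vector of the min-max argument: [i] orthogonality conditions on [i.+1] coefficients
    leave a nonzero solution. *)
Lemma exists_left_kernel i (M : 'M[R]_(i.+1, i)) : exists2 c : 'rV_i.+1, c != 0 & c *m M = 0.
Proof.
have : kermx M != 0.
  rewrite kermx_eq0 /row_free; apply/eqP => rM.
  by have := rank_leq_col M; rewrite rM ltnn.
by move=> /rowV0Pn[c cM c0]; exists c => //; exact/sub_kermxP.
Qed.

Lemma diagrectM m n (rho : nat -> R) (x : nat -> R) (i : 'I_m) :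
  (forall j, (n <= j)%N -> x j = 0) ->
  (diagrect m n rho *m \col_(j < n) x j) i 0 = rho i * x i.
Proof.
move=> x0; rewrite mxE; under eq_bigr do rewrite !mxE.
have [ni|ni] := ltnP i n; last first.
  rewrite x0// mulr0 big1// => j _.
  by rewrite gtn_eqF ?mul0r// (leq_trans (ltn_ord j)).
rewrite (bigD1 (Ordinal ni))//= eqxx mulr1n big1 ?addr0// => j ji.
by rewrite eq_sym (_ : (j == i :> nat) = false) ?mul0r//; exact: negbTE ji.
Qed.

Lemma svd_dotm m n (B : 'M[R]_(m, n)) U V rho x : svd B U V rho ->
  dotm (B *m x) (B *m x) =
  dotm (V^T *m x) (diag_mx (\row_(j < n) rho j ^+ 2) *m (V^T *m x)).
Proof. by move=> sB; rewrite !dotmMl trmxK !mulmxA (svd_tmul sB). Qed.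

(* The bound on [rho i] is a min-max argument: some nonzero [x] in the span of the
   first i+1 columns of [P] is orthogonal to the first i right singular vectors of
   [A], so [`|A x| <= sigma_i `|x|]; testing the positivity hypothesis on
   [(x, - y)], where [y] has the same coordinates in the columns of [Q], gives
   [lam * (|x|^2 + |y|^2) <= 2 (N - q)] with [rho i * N <= q] and
   [2 q <= sigma_i (|x|^2 + |y|^2)]. *)
Lemma cut_normal_form k n (G11 : 'M[R]_k) (G22 : 'M[R]_n) (A : 'M[R]_(n, k)) lam :
  0 < lam -> G11^T = G11 -> G22^T = G22 ->
  (forall x y, lam * (dotm x x + dotm y y) <=
     dotm x (G11 *m x) + 2 * dotm y (A *m x) + dotm y (G22 *m y)) ->
  exists (P : 'M[R]_k) (Q : 'M[R]_n) rho,
    [/\ P^T *m G11 *m P = 1%:M, Q^T *m G22 *m Q = 1%:M,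
        Q^T *m A *m P = diagrect n k rho,
        (forall i, 0 <= rho i) /\ (forall i, (minn n k <= i)%N -> rho i = 0) &
        forall i, (i < minn n k)%N ->
          rho i * (lam + (singular_values A)`_i) <= (singular_values A)`_i].
Proof.
move=> lam0 s11 s22 H.
have pd m (S : 'M[R]_m) : (forall x, lam * dotm x x <= dotm x (S *m x)) -> posdefmx S.
  move=> HS x x0; rewrite -mulmxA -[(_ *m _) 0 0]/(dotm x (S *m x)).
  by apply: lt_le_trans (HS x); rewrite mulr_gt0// dotm_gt0.
have d0 m (x : 'cV[R]_m) : dotm 0 x = 0 by rewrite /dotm trmx0 mul0mx mxE.
have p11 : posdefmx G11.
  by apply: pd => x; have := H x 0; rewrite !d0 mulr0 !addr0.
have p22 : posdefmx G22.
  by apply: pd => x; have := H 0 x; rewrite !mulmx0 (dotmC x 0) !d0 mulr0 !add0r.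
have [P0 P0E] := posdef_whiten s11 p11.
have [Q0 Q0E] := posdef_whiten s22 p22.
have [U [V [rho [[oU oV D [rho_ge0 rho0] rhod] _]]]] := svd_exists (Q0^T *m A *m P0).
have [U1 [V1 [sig [sA _]]]] := svd_exists A.
pose P := P0 *m V; pose Q := Q0 *m U.
have PE : P^T *m G11 *m P = 1%:M.
  by rewrite /P trmx_mul !mulmxA -(mulmxA _ P0^T) -(mulmxA _ _ P0) P0E mulmx1.
have QE : Q^T *m G22 *m Q = 1%:M.
  by rewrite /Q trmx_mul !mulmxA -(mulmxA _ Q0^T) -(mulmxA _ _ Q0) Q0E mulmx1.
have DE : Q^T *m A *m P = diagrect n k rho by rewrite -D /P /Q trmx_mul !mulmxA.
clearbody P Q.
have anti (f : nat -> R) a b : (forall i, f i.+1 <= f i) -> (a <= b)%N -> f b <= f a.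
  move=> fd /subnK <-; elim: (b - a)%N => [|l IHl]; first by [].
  by rewrite addSn (le_trans (fd _)).
exists P, Q, rho; split=> // i imn.
rewrite (svd_singular_values sA imn).
have [_ oV1 _ [sig_ge0 sig0] sigd] := sA.
have [i_n i_k] : (i < n)%N /\ (i < k)%N by move: imn; rewrite leq_min => /andP.
pose M : 'M[R]_(i.+1, i) := \matrix_(j, l) (V1^T *m P) (widen_ord (ltnW i_k) l) (widen_ord i_k j).
have [c c0 cM] := exists_left_kernel M.
pose cn j := if (j <= i)%N then c 0 (inord j) else 0.
have cn0 m j : (i < m)%N -> (m <= j)%N -> cn j = 0.
  by move=> im mj; rewrite /cn leqNgt (leq_trans im mj).
pose N := \sum_(j < i.+1) cn j ^+ 2.
have N0 : 0 < N.
  rewrite lt_neqAle sumr_ge0 ?andbT => [|j _]; last exact: sqr_ge0.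
  apply: contraNneq c0 => /esym/eqP; rewrite psumr_eq0 => [/allP cj|j _]; last exact: sqr_ge0.
  apply/eqP/rowP => j; rewrite mxE; have := cj j (mem_index_enum _).
  by rewrite sqrf_eq0 /cn -ltnS ltn_ord inord_val => /eqP.
pose cx : 'cV[R]_k := \col_(j < k) cn j; pose cy : 'cV[R]_n := \col_(j < n) cn j.
have cN m : (i < m)%N -> dotm (\col_(j < m) cn j) (\col_(j < m) cn j) = N.
  move=> im; rewrite dotmE /N -(sum_ord_head (fun j => cn j ^+ 2) im).
  apply: eq_bigr => j _; rewrite !mxE -expr2 /cn; case: ifP => // _.
  by rewrite expr0n.
pose x := P *m cx; pose y := - (Q *m cy).
have xG : dotm x (G11 *m x) = N.
  by rewrite /x dotmMl !mulmxA PE mul1mx cN.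
have yG : dotm y (G22 *m y) = N.
  by rewrite /y mulmxN dotmNl dotmNr opprK dotmMl !mulmxA QE mul1mx cN.
pose q := \sum_(j < i.+1) rho j * cn j ^+ 2.
have yx : dotm y (A *m x) = - q.
  rewrite /y dotmNl dotmMl !mulmxA DE; congr (- _).
  rewrite dotmE /q -(sum_ord_head (fun j => rho j * cn j ^+ 2) i_n).
  apply: eq_bigr => j _; rewrite diagrectM; last by move=> l; exact: cn0.
  rewrite mxE mulrCA -expr2 /cn; case: ifP => // _.
  by rewrite expr0n mulr0.
have qN : rho i * N <= q.
  rewrite /N mulr_sumr; apply: ler_sum => j _; rewrite ler_wpM2r ?sqr_ge0//.
  by rewrite anti// -ltnS ltn_ord.
have Ax : dotm (A *m x) (A *m x) <= sig i ^+ 2 * dotm x x.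
  pose w := V1^T *m x.
  have oV1T : isometrymx V1^T by rewrite /isometrymx trmxK; exact: isometrymxC.
  have ww : dotm w w = dotm x x by exact: dotm_ortho.
  have wl (l : 'I_k) : (l < i)%N -> w l 0 = 0.
    move=> li; rewrite /w /x mulmxA mxE (bigID (fun j : 'I_k => (j < i.+1)%N)) /=.
    rewrite [X in _ + X]big1 ?addr0 => [|j]; last first.
      by rewrite ltnS [cx _ _]mxE /cn => /negbTE ->; rewrite mulr0.
    rewrite (big_ord_narrow i_k); have /rowP/(_ (Ordinal li)) E0 := cM.
    rewrite [RHS]mxE mxE in E0; apply: etrans E0; apply: eq_bigr => j _.
    rewrite [M _ _]mxE [cx _ _]mxE /cn /= -ltnS ltn_ord.
    have -> : widen_ord (ltnW i_k) (Ordinal li) = l by exact: val_inj.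
    by rewrite inord_val mulrC.
  have -> : dotm (A *m x) (A *m x) = dotm w (diag_mx (\row_(j < k) sig j ^+ 2) *m w).
    exact: (svd_dotm x sA).
  rewrite -ww !dotmE mulr_sumr; apply: ler_sum => l _.
  have [li|li] := ltnP l i; first by rewrite wl// !mul0r mulr0.
  rewrite mul_diag_mx !mxE mulrCA -expr2 ler_wpM2r ?sqr_ge0//.
  by rewrite ler_pXn2r ?nnegrE// anti.
have x0 := dotm_ge0 x; have y0 := dotm_ge0 y; have s0 := sig_ge0 i.
(* Expand [|sig_i y + A x|^2 >= 0], insert [Ax] and divide by [sig_i]. If [sig_i = 0], then
   [A x = 0] and so [q = 0]. *)
have q2 : 2 * q <= sig i * (dotm x x + dotm y y).
  have [si0|siN0] := eqVneq (sig i) 0.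
    have : dotm (A *m x) (A *m x) == 0.
      by rewrite eq_le dotm_ge0 andbT (le_trans Ax)// si0 expr0n mul0r.
    rewrite dotm_eq0 => /eqP Ax0; move: yx; rewrite Ax0 dotmC d0 => /eqP.
    by rewrite eq_sym oppr_eq0 => /eqP ->; rewrite si0 mulr0 mul0r.
  have sp : 0 < sig i by rewrite lt_neqAle eq_sym siN0.
  have := dotm_ge0 (sig i *: y + A *m x).
  rewrite !(dotmDl, dotmDr, dotmZl, dotmZr) (dotmC (A *m x) y) yx => h.
  rewrite -(ler_pM2l sp); move: h Ax; rewrite expr2; nra.
have := H x y; rewrite xG yG yx => h.
have h2 : lam * (2 * q) <= sig i * (lam * (dotm x x + dotm y y)).
  by rewrite [leRHS]mulrCA ler_pM2l.
have h3 : sig i * (lam * (dotm x x + dotm y y)) <= sig i * (N + 2 * - q + N).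
  by rewrite ler_wpM2l.
(* Collecting the terms in [q] in [h2] and [h3] gives [q (lam + sig_i) <= sig_i N], and [qN] bounds
   [q] from below. *)
rewrite -(ler_pM2r N0); apply: (@le_trans _ _ (q * (lam + sig i))).
  by rewrite mulrAC ler_wpM2r// addr_ge0// ltW.
by have := le_trans h2 h3; lra.
Qed.

End CutNormalForm.

(** * Separable approximation of a Gaussian across one cut *)

Section LinearSubst.
Context {R : realType}.

Lemma sqn_nth n (s : seq R) : size s = n -> sqn s = \sum_(i < n) s`_i ^+ 2.
Proof. by move=> <-; rewrite /sqn (big_nth 0) big_mkord. Qed.

Lemma sqn_afseq_le n (A : 'M[R]_n) : exists2 C, 0 < C &
  forall s, size s = n -> sqn (afseq A 0 s) <= C * sqn s.
Proof.
pose b i := \sum_j `|A i j|.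
have b0 i : 0 <= b i by apply: sumr_ge0.
exists (1 + \sum_i b i ^+ 2) => [|s ss].
  by rewrite ltr_pwDl// sumr_ge0// => i _; exact: sqr_ge0.
rewrite (sqn_nth (size_afseq A 0 s)) mulrDl mul1r ler_wpDl ?sqn_ge0// mulr_suml.
apply: ler_sum => i _; rewrite nth_afseq mxE addr0.
pose r := Num.sqrt (sqn s).
have sr (j : 'I_n) : `|s`_j| <= r.
  rewrite -(ler_pXn2r (_ : 0 < 2)%N) ?nnegrE ?sqrtr_ge0//.
  rewrite real_normK ?num_real// sqr_sqrtr ?sqn_ge0// (sqn_nth ss) (bigD1 j)//= lerDl.
  by rewrite sumr_ge0// => l _; exact: sqr_ge0.
have h : `|\sum_j A i j * s`_j| <= b i * r.
  rewrite (le_trans (ler_norm_sum _ _ _))// mulr_suml ler_sum// => j _.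
  by rewrite normrM ler_wpM2l.
rewrite -(sqr_sqrtr (sqn_ge0 s)) -exprMn -[leLHS]real_normK ?num_real//.
by rewrite ler_pXn2r ?nnegrE// mulr_ge0 ?sqrtr_ge0.
Qed.

Lemma afseq1 n s : size s = n -> afseq (1%:M : 'M[R]_n) 0 s = s.
Proof.
move=> ss; apply: (@eq_from_nth _ 0); rewrite size_afseq// => i ni.
rewrite (nth_afseq _ _ _ (Ordinal ni)) mxE addr0 (bigD1 (Ordinal ni))//= big1 ?addr0.
  by rewrite mxE eqxx mul1r.
by move=> j ji; rewrite mxE eq_sym (negbTE ji) mul0r.
Qed.

(** Decay needs a lower bound for the norm of [A s]; it comes from the upper bound for [invmx A]
    applied to [A s]. *)
Lemma dec_lin n (A : 'M[R]_n) F : A \in unitmx -> dec n F ->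
  dec n (fun s => F (afseq A 0 s)).
Proof.
move=> uA [mF [K [a [K0 a0 FK]]]]; split; first exact: (smfun_afseq A 0 mF).
have [C C0 CP] := sqn_afseq_le (invmx A).
exists K, (a / C); split=> // [|s ss]; first exact: divr_gt0.
rewrite (le_trans (FK _ (size_afseq A 0 s)))// ler_wpM2l// ler_expR lerN2.
rewrite -mulrA ler_wpM2l ?(ltW a0)// mulrC ler_pdivrMr// mulrC.
by rewrite -{1}(afseq1 ss) -(mulVmx uA) afseqM CP// size_afseq.
Qed.

Lemma ip_lin n (A : 'M[R]_n) : A \in unitmx -> exists2 c, 0 < c &
  forall F, dec n F ->
    ip n (fun s => F (afseq A 0 s)) (fun s => F (afseq A 0 s)) = c * ip n F F.
Proof.
move=> uA; have [c c0 cP] := jac_unitmx uA; exists c => // F dF.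
have dFF := decM dF dF; have [mFF _] := dFF.
apply: EFin_inj; rewrite EFinM !EFin_rint//; last exact: (dec_lin uA dFF).
apply: (cP 0 (fun s => (F s * F s)%:E)); first exact: smfun_EFin.
by move=> s; rewrite lee_fin -expr2 sqr_ge0.
Qed.

End LinearSubst.

(** * Products over pairs of variables facing each other across the cut *)

Section Interleave.
Context {R : realType}.
Local Notation TR := (measurableTypeR R).

(** The two leading variables, one from each side, form a pair while both sides stay contiguous; the
    remaining list has the same shape, with its cut at [k]. *)
Definition interleave k (u v : seq R -> R) (s : seq R) : R :=
  u [:: s`_0; s`_k.+1] * v (take k (behead s) ++ drop k.+2 s).

Lemma interleave_cat k u v x (s : seq R) y (t : seq R) : size s = k ->
  interleave k u v ((x :: s) ++ (y :: t)) = u [:: x; y] * v (s ++ t).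
Proof.
move=> ss; rewrite /interleave /= nth_cat ss ltnn subnn take_size_cat//.
by rewrite -cat_rcons drop_size_cat// size_rcons ss.
Qed.

Lemma seq_split_cons k n (s : seq R) : size s = (k.+1 + n.+1)%N ->
  exists x s1 y s2, [/\ s = (x :: s1) ++ (y :: s2), size s1 = k & size s2 = n].
Proof.
case: s => [//|x s] /= [ss]; exists x, (take k s).
have: size (drop k s) = n.+1 by rewrite size_drop ss addKn.
case E: (drop k s) => [//|y s2] [s2n]; exists y, s2; split=> //.
  by rewrite /= -E cat_take_drop.
by rewrite size_takel// ss leq_addr.
Qed.

Lemma dec_interleave k n u v : dec 2 u -> dec (k + n) v ->
  dec (k.+1 + n.+1) (interleave k u v).
Proof.
move=> [mu [K [a [K0 a0 uK]]]] [mv [L [b [L0 b0 vL]]]]; split.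
  apply: measurable_funM.
    apply: (smfun_comp_seq mu) => // -[|[|//]] _ /=; exact: measurable_nth_tuple.
  have st (t : (k.+1 + n.+1).-tuple TR) : size (take k (behead t)) = k.
    by rewrite size_takel// size_behead size_tuple /= leq_addr.
  apply: (smfun_comp_seq mv) => [t|i ik].
    by rewrite size_cat size_drop st size_tuple addSn addnS !subSS addKn.
  under eq_fun do rewrite nth_cat st.
  case: ltnP => [ik'|_].
    by under eq_fun do rewrite nth_take// nth_behead; exact: measurable_nth_tuple.
  by under eq_fun do rewrite nth_drop; exact: measurable_nth_tuple.
exists (K * L), (Num.min a b); split; first exact: mulr_ge0.
  by rewrite lt_min a0.
move=> _ /seq_split_cons[x [s1 [y [s2 [-> s1k s2n]]]]].
rewrite interleave_cat// normrM.
have -> : sqn ((x :: s1) ++ (y :: s2)) = sqn [:: x; y] + sqn (s1 ++ s2).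
  by rewrite !sqn_cat !sqn_cons /sqn big_nil; ring.
rewrite mulrDr opprD expRD mulrACA; apply: ler_pM => //.
  rewrite (le_trans (uK _ _))// ler_wpM2l// ler_expR lerN2 ler_wpM2r ?sqn_ge0//.
  by rewrite ge_min lexx.
rewrite (le_trans (vL _ _)) ?size_cat ?s1k ?s2n//.
rewrite ler_wpM2l// ler_expR lerN2 ler_wpM2r ?sqn_ge0//.
by rewrite ge_min lexx orbT.
Qed.

(** Variables are never permuted. Both sides are sliced until the integrals run in the same order,
    head and tail of the left side, then of the right side, with each independent factor moved
    inside the next integral. *)
Lemma ip_interleave k n u v : dec 2 u -> dec (k + n) v ->
  ip (k.+1 + n.+1) (interleave k u v) (interleave k u v) = ip 2 u u * ip (k + n) v v.
Proof.
move=> du dv; have dw := dec_interleave du dv; have sq (F : seq R -> R) s : 0 <= F s * F s.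
  by rewrite -expr2 sqr_ge0.
have duu := decM du du; have dvv := decM dv dv; have dww := decM dw dw.
rewrite /ip (@rint_cat _ 1 1)// (@rint_cat _ k n)// (@rint_cat _ k.+1 n.+1)//.
have dp := dec_part dww; have dpu := @dec_part _ 1 1 _ duu; have dpv := dec_part dvv.
rewrite (@rint_cat _ 1 k)//; last by move=> s; exact: rint_ge0.
rewrite mulrC -rintZ//; apply: eq_rint => -[//|x []// _].
rewrite mulrC -rintZ//; apply: eq_rint => s ss.
rewrite (@rint_cat _ 1 n)//; last first.
  by apply: (@dec_catl _ k.+1 n.+1 _ (x :: s) dww); rewrite /= ss.
rewrite mulrC -rintZ; last exact: (@dec_catl _ 1 1 _ [:: x] duu).
apply: eq_rint => -[//|y []// _].
rewrite mulrC -rintZ; last exact: (dec_catl dvv).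
apply: eq_rint => t st; rewrite /= -!cat_cons interleave_cat//; ring.
Qed.

Lemma nrm_interleave k n u v : dec 2 u -> dec (k + n) v ->
  nrm (k.+1 + n.+1) (interleave k u v) = nrm 2 u * nrm (k + n) v.
Proof. by move=> du dv; rewrite /nrm ip_interleave// sqrtrM ?ip_ge0. Qed.

End Interleave.

Section PairProduct.
Context {R : realType}.
Implicit Types (G T : nat -> R -> R -> R).

(* Unpaired trailing variables carry the weight exp (- x ^ 2 / 2). *)
Fixpoint pairprod G (s1 s2 : seq R) {struct s1} : R :=
  match s1, s2 with
  | x :: s1', y :: s2' => G 0%N x y * pairprod (fun i => G i.+1) s1' s2'
  | _, _ => expR (- (2^-1 * sqn s1)) * expR (- (2^-1 * sqn s2))
  end.

Definition pairfun k G (s : seq R) : R := pairprod G (take k s) (drop k s).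

Definition fun2 (g : R -> R -> R) (s : seq R) : R := g s`_0 s`_1.

Lemma pairfun_cons k n G s : size s = (k.+1 + n.+1)%N ->
  pairfun k.+1 G s = interleave k (fun2 (G 0%N)) (pairfun k (fun i => G i.+1)) s.
Proof.
move=> /seq_split_cons[x [s1 [y [s2 [-> s1k s2n]]]]].
rewrite interleave_cat// /pairfun take_size_cat /= ?s1k// drop_size_cat//.
by rewrite take_size_cat// drop_size_cat.
Qed.

Lemma pairprod_nil G s1 s2 : s1 = [::] \/ s2 = [::] ->
  pairprod G s1 s2 = expR (- (2^-1 * sqn s1)) * expR (- (2^-1 * sqn s2)).
Proof. by case=> ->; [|case: s1]. Qed.

Lemma pairfun_min0 k n G s : minn k n = 0%N -> size s = (k + n)%N ->
  pairfun k G s = expR (- (2^-1 * sqn s)).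
Proof.
move=> kn ss; rewrite /pairfun pairprod_nil.
  by rewrite -expRD -opprD -mulrDr -sqn_cat cat_take_drop.
case: k n kn ss => [|k] [|n] kn ss; [left|left|right|by rewrite minnSS in kn].
- exact: take0.
- exact: take0.
- by rewrite drop_oversize// ss addn0.
Qed.

Lemma half_gt0 : 0 < 2^-1 :> R. Proof. by rewrite invr_gt0. Qed.

Lemma dec_pairfun k n G : (forall i, dec 2 (fun2 (G i))) -> dec (k + n) (pairfun k G).
Proof.
elim: k n G => [|k IHk] [|n] G dG.
- by apply: dec_eq (dec_gauss _ half_gt0) => s ss; rewrite (@pairfun_min0 _ 0).
- by apply: dec_eq (dec_gauss _ half_gt0) => s ss; rewrite (@pairfun_min0 _ n.+1)// min0n.
- by apply: dec_eq (dec_gauss _ half_gt0) => s ss; rewrite (@pairfun_min0 _ 0)// minn0.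
have dA := IHk n (fun i => G i.+1) (fun i => dG i.+1).
apply: dec_eq (dec_interleave (dG 0%N) dA) => s ss.
by rewrite (@pairfun_cons _ n).
Qed.

(* [G0 A - T0 B = G0 (A - B) + (G0 - T0) B], where the norms of products of
   functions of disjoint variables multiply. *)
Lemma nrm_pairfunB k n G T (e : nat -> R) :
  (forall i, dec 2 (fun2 (G i))) -> (forall i, dec 2 (fun2 (T i))) ->
  (forall i, 0 <= e i) ->
  (forall i, nrm 2 (fun s => fun2 (G i) s - fun2 (T i) s) <= e i * nrm 2 (fun2 (G i))) ->
  nrm (k + n) (fun s => pairfun k G s - pairfun k T s) <=
  (\prod_(i < minn k n) (1 + e i) - 1) * nrm (k + n) (pairfun k G).
Proof.
elim: k n G T e => [|k IHk] n G T e dG dT e0 He.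
  rewrite (eq_nrm (F' := fun s => 0 * pairfun 0 G s)) => [|s ss]; last first.
    by rewrite !(@pairfun_min0 _ n) ?min0n// subrr mul0r.
  by rewrite nrmZ; [rewrite normr0 mul0r min0n big_ord0 subrr mul0r|exact: dec_pairfun].
case: n => [|n].
  rewrite (eq_nrm (F' := fun s => 0 * pairfun k.+1 G s)) => [|s ss]; last first.
    by rewrite !(@pairfun_min0 _ 0) ?minn0// subrr mul0r.
  by rewrite nrmZ; [rewrite normr0 mul0r minn0 big_ord0 subrr mul0r|exact: dec_pairfun].
pose G' i := G i.+1; pose T' i := T i.+1; pose A := pairfun k G'; pose B := pairfun k T'.
have dA : dec (k + n) A by apply: dec_pairfun => i; exact: dG.
have dB : dec (k + n) B by apply: dec_pairfun => i; exact: dT.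
have := IHk n G' T' (fun i => e i.+1) (fun i => dG i.+1) (fun i => dT i.+1)
  (fun i => e0 i.+1) (fun i => He i.+1); rewrite -/A -/B => IH.
have EG s : size s = (k.+1 + n.+1)%N ->
    pairfun k.+1 G s = interleave k (fun2 (G 0%N)) A s by exact: pairfun_cons.
have ET s : size s = (k.+1 + n.+1)%N ->
    pairfun k.+1 T s = interleave k (fun2 (T 0%N)) B s by exact: pairfun_cons.
clearbody A B.
have dAB := decB dA dB; have dGT := decB (dG 0%N) (dT 0%N).
rewrite (eq_nrm (F' := fun s => interleave k (fun2 (G 0%N)) (fun s => A s - B s) s +
    interleave k (fun s => fun2 (G 0%N) s - fun2 (T 0%N) s) B s)) => [|s ss]; last first.
  by rewrite EG// ET// /interleave; ring.
apply: le_trans (ler_nrmD (dec_interleave (dG 0%N) dAB) (dec_interleave dGT dB)) _.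
rewrite !nrm_interleave//.
rewrite (eq_nrm EG).
rewrite nrm_interleave// minnSS big_ord_recl /=.
set p := \prod_(i < _) _ in IH *.
have nB : nrm (k + n) B <= nrm (k + n) A + nrm (k + n) (fun s => A s - B s).
  rewrite (eq_nrm (F' := fun s => A s + (-1) * (A s - B s))) => [|s _]; last by ring.
  apply: le_trans (ler_nrmD dA (decZ (-1) dAB)) _.
  by rewrite nrmZ// normrN1 mul1r.
have g0 := nrm_ge0 2 (fun2 (G 0%N)); have A0 := nrm_ge0 (k + n) A.
have := He 0%N; set gt := nrm 2 (fun s => _ - _) => Hgt.
have gt0 : 0 <= gt by exact: nrm_ge0.
set g := nrm 2 (fun2 (G 0%N)) in g0 Hgt *; set a := nrm (k + n) A in A0 IH nB *.
set b := nrm (k + n) B in nB *; set ab := nrm _ (fun s => A s - B s) in IH nB *.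
have h1 : g * ab <= g * ((p - 1) * a) by rewrite ler_wpM2l.
have h2 : gt * b <= e 0%N * g * (p * a).
  apply: ler_pM => //; [exact: nrm_ge0|lra].
rewrite (_ : _ * (g * a) = g * ((p - 1) * a) + e 0%N * g * (p * a)); last by ring.
exact: lerD.
Qed.

Lemma sum_divmod N r (f : nat -> nat -> R) :
  \sum_(i < N * r) f (i %/ r)%N (i %% r)%N = \sum_(a < N) \sum_(b < r) f a b.
Proof.
elim: N => [|N IHN]; first by rewrite !big_ord0.
rewrite big_ord_recr /= -IHN mulSnr big_split_ord /=; congr (_ + _).
apply: eq_bigr => b _; have r0 : (0 < r)%N by exact: leq_ltn_trans (ltn_ord b).
by rewrite divnMDl// divn_small// addn0 modnMDl modn_small.
Qed.

(** Expanding the product of the sums gives one term per multi-index; quotient and remainder encode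
    the multi-index as a single number below the product of the [N i]. *)
Lemma pairprod_separable k n T (N : nat -> nat) (phi psi : nat -> nat -> R -> R) :
  (forall i j, dec 1 (fun s => phi i j s`_0)) ->
  (forall i j, dec 1 (fun s => psi i j s`_0)) ->
  (forall i x y, T i x y = \sum_(j < N i) phi i j x * psi i j y) ->
  exists a u : nat -> seq R -> R,
    [/\ forall j, dec k (a j), forall j, dec n (u j) &
      forall s1 s2, size s1 = k -> size s2 = n ->
        pairprod T s1 s2 = \sum_(j < \prod_(i < minn k n) N i) a j s1 * u j s2].
Proof.
elim: k n T N phi psi => [|k IHk] n T N phi psi dphi dpsi TE.
  exists (fun _ s => expR (- (2^-1 * sqn s))), (fun _ s => expR (- (2^-1 * sqn s))).
  split=> [_|_|s1 s2 /size0nil -> _]; [exact/dec_gauss/half_gt0..|].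
  by rewrite min0n big_ord0 big_ord1.
case: n => [|n].
  exists (fun _ s => expR (- (2^-1 * sqn s))), (fun _ s => expR (- (2^-1 * sqn s))).
  split=> [_|_|s1 s2 _ /size0nil ->]; [exact/dec_gauss/half_gt0..|].
  by rewrite minn0 big_ord0 big_ord1 pairprod_nil//; right.
have [a [u [da du TE']]] := IHk n (fun i => T i.+1) (fun i => N i.+1)
  (fun i => phi i.+1) (fun i => psi i.+1) (fun i => dphi i.+1) (fun i => dpsi i.+1)
  (fun i => TE i.+1).
pose r := (\prod_(i < minn k n) N i.+1)%N.
exists (fun j s => phi 0%N (j %/ r)%N (take 1 s)`_0 * a (j %% r)%N (drop 1 s)).
exists (fun j s => psi 0%N (j %/ r)%N (take 1 s)`_0 * u (j %% r)%N (drop 1 s)).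
split=> [j|j|[//|x s1] [//|y s2] [s1k] [s2n]].
- exact: (@dec_tensor _ 1 k (fun s => phi 0%N (j %/ r)%N s`_0)).
- exact: (@dec_tensor _ 1 n (fun s => psi 0%N (j %/ r)%N s`_0)).
rewrite /= TE TE'// minnSS big_ord_recl /= !drop0.
rewrite -[X in \sum_(_ < _ * X) _]/r.
rewrite (sum_divmod _ _ (fun b c => phi 0%N b x * a c s1 * (psi 0%N b y * u c s2))).
rewrite mulr_suml; apply: eq_bigr => b _; rewrite mulr_sumr.
by apply: eq_bigr => c _; rewrite mulrACA.
Qed.

End PairProduct.

(** * Taylor truncation of the Gaussian of one pair *)

Section PairEstimate.
Context {R : realType}.
Local Notation TR := (measurableTypeR R).
Local Notation leb := (@lebesgue_measure R).

Lemma exp_partial_le (y : R) M : 0 <= y -> \sum_(0 <= n < M) exp_coeff y n <= expR y.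
Proof.
move=> y0; apply: (@nondecreasing_cvgn_le _ (series (exp_coeff y)) _ _ M).
  apply/nondecreasing_seqP => n; rewrite -subr_ge0 /series /= big_nat_recr//= addrAC subrr add0r.
  exact: exp_coeff_ge0.
exact: is_cvg_series_exp_coeff.
Qed.

(* Each term [t ^ n / n!] of the remainder has [n >= N], hence is at most
   [tau ^ - N] times the corresponding term for [tau * `|t|]. *)
Lemma exp_remainder (t tau : R) N : 1 <= tau ->
  `|expR t - \sum_(0 <= n < N) exp_coeff t n| * tau ^+ N <= expR (tau * `|t|).
Proof.
move=> tau1; have tau0 : 0 <= tau by exact: le_trans tau1.
set S := \sum_(_ <= n < _) _.
pose u n := `|series (exp_coeff t) n - S| * tau ^+ N.
have cu : u n @[n --> \oo] --> `|expR t - S| * tau ^+ N.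
  apply: cvgM; last exact: cvg_cst.
  apply: cvg_norm; apply: cvgB; last exact: cvg_cst.
  exact: is_cvg_series_exp_coeff.
rewrite -(cvg_lim _ cu)//; apply: limr_le; first by apply/cvg_ex; eexists; exact: cu.
near=> n; have Nn : (N <= n)%N by near: n; exact: nbhs_infty_ge.
rewrite /u /series /= (big_cat_nat (leq0n N) Nn)//= addrAC subrr add0r.
apply: le_trans (exp_partial_le n (mulr_ge0 tau0 (normr_ge0 t))).
rewrite [leRHS](big_cat_nat (leq0n N) Nn)//= ler_wpDl//.
  by apply: sumr_ge0 => i _; rewrite exp_coeff_ge0// mulr_ge0.
apply: (@le_trans _ _ ((\sum_(N <= i < n) `|exp_coeff t i|) * tau ^+ N)).
  by rewrite ler_wpM2r ?exprn_ge0// ler_norm_sum.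
rewrite mulr_suml; apply: ler_sum_nat => i /andP[Ni _]; rewrite /exp_coeff /= normrM normrX.
rewrite (ger0_norm (_ : 0 <= (i`!%:R)^-1))// exprMn [leLHS]mulrC -[leRHS]mulrA.
rewrite ler_wpM2r ?mulr_ge0 ?invr_ge0 ?exprn_ge0//.
exact: ler_weXn2l.
Unshelve. all: by end_near. Qed.

Lemma eint1 (g : R -> R) : measurable_fun [set: TR] g -> (forall x, 0 <= g x) ->
  eint 1 (fun s => (g s`_0)%:E) = (\int[leb]_x (g x)%:E)%E.
Proof.
move=> mg g0; have mg1 : smfun 1 (fun s => (g s`_0)%:E).
  apply: smfun_EFin; exact: (measurableT_comp mg (@measurable_nth_tuple _ 1 0)).
rewrite (eint_cons mg1 _).2; last by move=> s; rewrite lee_fin.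
by apply: eq_integral => x _; rewrite eint0.
Qed.

Lemma rint1_affine (h : R -> R) a b : a != 0 -> dec 1 (fun s => h s`_0) ->
  (forall x, 0 <= h x) ->
  rint 1 (fun s => h (a * s`_0 + b)) = `|a|^-1 * rint 1 (fun s => h s`_0).
Proof.
move=> a0 dh h0; have [mh _] := dh.
have mh1 : measurable_fun [set: TR] h.
  apply: (smfun_comp_seq (h := fun x : TR => [:: x]) mh) => // -[|//] _.
  exact: measurable_id.
have mha : measurable_fun [set: TR] (fun x => h (a * x + b)).
  exact: (measurableT_comp mh1 (measurable_affine a b)).
have E : eint 1 (fun s => (h (a * s`_0 + b))%:E) =
    ((`|a|^-1)%:E * (rint 1 (fun s => h s`_0))%:E)%E.
  rewrite (eint1 (g := fun x => h (a * x + b)))// EFin_rint// [in RHS](eint1 (g := h))//.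
  apply: (ge0_integral_affine b a0 (F := fun x => (h x)%:E)).
    exact/measurable_EFinP.
  by move=> x; rewrite lee_fin.
by rewrite [LHS](congr1 fine E) -EFinM.
Qed.

Definition gauss2 (r x y : R) : R :=
  expR (- (2^-1 * x ^+ 2)) * expR (- (2^-1 * y ^+ 2)) * expR (- (r * x * y)).

Definition gaussJ : R := rint 1 (fun s : seq R => expR (- s`_0 ^+ 2)).

Lemma sqn1 (s : seq R) : size s = 1%N -> sqn s = s`_0 ^+ 2.
Proof. by case: s => [//|x [|//]] _; rewrite /sqn big_seq1. Qed.

Lemma sqn2 (s : seq R) : size s = 2 -> sqn s = s`_0 ^+ 2 + s`_1 ^+ 2.
Proof. by case: s => [//|x [//|y [|//]]] _; rewrite !sqn_cons /sqn big_nil addr0. Qed.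

Lemma dec_gauss1 a : 0 < a -> dec 1 (fun s : seq R => expR (- (a * s`_0 ^+ 2))).
Proof. by move=> a0; apply: dec_eq (dec_gauss 1 a0) => s ss; rewrite sqn1. Qed.

Lemma dec_gauss2 r : `|r| < 1 -> dec 2 (fun2 (gauss2 r)).
Proof.
move=> r1; split.
  have m i : smfun 2 (fun s : seq R => s`_i) by exact: measurable_nth_tuple.
  rewrite /smfun /fun2 /gauss2; apply: measurable_funM; first apply: measurable_funM.
  - apply: measurableT_comp => //; apply: measurableT_comp => //.
    by apply: measurable_funM => //; apply: measurable_funX; exact: m.
  - apply: measurableT_comp => //; apply: measurableT_comp => //.
    by apply: measurable_funM => //; apply: measurable_funX; exact: m.
  - apply: measurableT_comp => //; apply: measurableT_comp => //.
    by apply: measurable_funM; [apply: measurable_funM => //|]; exact: m.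
exists 1, (2^-1 * (1 - `|r|)); split=> // [|s ss].
  by rewrite mulr_gt0 ?half_gt0// subr_gt0.
rewrite /fun2 /gauss2 -!expRD ger0_norm ?expR_ge0// mul1r ler_expR sqn2//.
set x := s`_0; set y := s`_1.
have : - (r * x * y) <= `|r| * (2^-1 * (x ^+ 2 + y ^+ 2)).
  rewrite (le_trans (ler_norm _))// normrN -mulrA normrM ler_wpM2l//.
  by rewrite ler_norml; have := sqr_ge0 (x + y); have := sqr_ge0 (x - y);
    rewrite !expr2 => h1 h2; apply/andP; split; lra.
by lra.
Qed.

Lemma gaussJ_gt0 : 0 < gaussJ.
Proof.
have E : eint 1 (fun s => (gauss_fun s`_0)%:E) = (Num.sqrt pi)%:E :> \bar R.
  rewrite (eint1 (g := @gauss_fun R)) ?integralT_gauss//.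
    exact: measurable_gauss_fun.
  by move=> x; exact: expR_ge0.
by rewrite /gaussJ [X in _ < X](congr1 fine E) sqrtr_gt0 pi_gt0.
Qed.

(** Complete the square: [x^2 + y^2 + 2 r x y = (1 - r^2) x^2 + (y + r x)^2]. The integral in [y] is
    a translate of [gaussJ], the one in [x] a rescaling of it. *)
Lemma ip_gauss2 r : `|r| < 1 ->
  ip 2 (fun2 (gauss2 r)) (fun2 (gauss2 r)) = gaussJ ^+ 2 / Num.sqrt (1 - r ^+ 2).
Proof.
move=> r1; have dg := dec_gauss2 r1; have dgg := decM dg dg.
have r2 : 0 < 1 - r ^+ 2.
  by rewrite subr_gt0 -[r ^+ 2]real_normK ?num_real// expr_lt1.
rewrite /ip (@rint_cat _ 1 1)//; last by move=> s; rewrite -expr2 sqr_ge0.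
have d1 : dec 1 (fun s : seq R => expR (- s`_0 ^+ 2)).
  by apply: dec_eq (dec_gauss1 ltr01) => s _; rewrite mul1r.
have E x y : fun2 (gauss2 r) [:: x; y] * fun2 (gauss2 r) [:: x; y] =
    expR (- ((1 - r ^+ 2) * x ^+ 2)) * expR (- (1 * y + r * x) ^+ 2).
  by rewrite /fun2 /gauss2 /= -!expRD; congr expR; field.
pose c := Num.sqrt (1 - r ^+ 2); have c0 : c != 0 by rewrite sqrtr_eq0 -ltNge.
transitivity (rint 1 (fun s : seq R => gaussJ * expR (- (c * s`_0 + 0) ^+ 2))).
  apply: eq_rint => -[//|x []// _].
  pose cx := expR (- ((1 - r ^+ 2) * x ^+ 2)).
  have cx0 : cx != 0 by rewrite lt0r_neq0// expR_gt0.
  have dy : dec 1 (fun s : seq R => expR (- (1 * s`_0 + r * x) ^+ 2)).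
    apply: dec_eq (decZ cx^-1 (dec_consl x dgg)) => -[//|y []// _].
    by rewrite E mulrA (mulVf cx0) !mul1r.
  rewrite (eq_rint (G := fun s => cx * expR (- (1 * s`_0 + r * x) ^+ 2))); last first.
    by move=> -[//|y []// _]; rewrite /= E.
  rewrite rintZ// (rint1_affine (h := fun z => expR (- z ^+ 2)) (r * x) (oner_neq0 R) d1).
    rewrite normr1 invr1 mul1r -/gaussJ mulrC /cx; congr (_ * expR (- _)).
    by rewrite /= addr0 exprMn sqr_sqrtr// ltW.
  by move=> z; exact: expR_ge0.
rewrite rintZ; last first.
  apply: dec_eq (dec_gauss1 r2) => s _; rewrite addr0 exprMn sqr_sqrtr//.
  exact: ltW.
rewrite (rint1_affine (h := fun x => expR (- x ^+ 2)) 0 c0 d1); last first.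
  by move=> x; exact: expR_ge0.
by rewrite -/gaussJ expr2 ger0_norm ?sqrtr_ge0// mulrCA mulrC.
Qed.

Definition monogauss (j : nat) (x : R) : R := x ^+ j * expR (- (2^-1 * x ^+ 2)).

Definition taylor2 (r : R) N (x y : R) : R :=
  \sum_(j < N) ((- r) ^+ j / j`!%:R * monogauss j x) * monogauss j y.

Lemma dec_monogauss j : dec 1 (fun s => monogauss j s`_0).
Proof.
split.
  apply: measurable_funM.
    by apply: measurable_funX; exact: measurable_nth_tuple.
  apply: measurableT_comp => //; apply: measurableT_comp => //.
  by apply: measurable_funM => //; apply: measurable_funX; exact: measurable_nth_tuple.
(* Half of the exponent absorbs the monomial: [|x|^j <= 1 + x^(2 j)], and
   [x^(2 j) <= 4^j j! exp (x^2 / 4)] from a single term of the exponential series. *)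
exists (1 + 4 ^+ j * j`!%:R), (4^-1); split.
- by rewrite addr_ge0// mulr_ge0// exprn_ge0.
- by rewrite invr_gt0.
move=> s ss; rewrite sqn1//; set x := s`_0.
have e1 : 1 <= expR (4^-1 * x ^+ 2).
  by rewrite -expR0 ler_expR mulr_ge0// sqr_ge0.
have hj : `|x| ^+ j <= (1 + 4 ^+ j * j`!%:R) * expR (4^-1 * x ^+ 2).
  have h1 : `|x| ^+ j <= 1 + x ^+ 2 ^+ j.
    rewrite -[x ^+ 2]real_normK ?num_real// exprAC.
    set z := `|x| ^+ j; have : 0 <= (z - 1) ^+ 2 + z ^+ 2 by rewrite addr_ge0 ?sqr_ge0.
    by have : 0 <= z ^+ 2 := sqr_ge0 z; rewrite sqrrB; nra.
  have h2 : x ^+ 2 ^+ j <= 4 ^+ j * j`!%:R * expR (4^-1 * x ^+ 2).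
    have y0 : 0 <= 4^-1 * x ^+ 2 by rewrite mulr_ge0// sqr_ge0.
    have := exp_partial_le j.+1 y0; rewrite big_nat_recr//= => h.
    have : exp_coeff (4^-1 * x ^+ 2) j <= expR (4^-1 * x ^+ 2).
      apply: le_trans h; rewrite lerDr sumr_ge0// => i _; exact: exp_coeff_ge0.
    rewrite /exp_coeff /= exprMn => h3.
    have f0 : 0 < j`!%:R :> R by rewrite ltr0n fact_gt0.
    rewrite -ler_pdivrMl; last by rewrite mulr_gt0// exprn_gt0.
    by apply: le_trans h3; rewrite invfM exprVn mulrAC.
  by rewrite mulrDl mul1r; lra.
rewrite /monogauss normrM normrX (ger0_norm (expR_ge0 _)).
apply: le_trans (ler_wpM2r (expR_ge0 _) hj) _.
rewrite -mulrA -expRD ler_wpM2l//;  rewrite ler_expR; lra.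
Qed.

Lemma dec_taylor2 r N : dec 2 (fun2 (taylor2 r N)).
Proof.
apply: dec_sum => j.
apply: dec_eq (@dec_tensor _ 1 1 _ _ (decZ ((- r) ^+ j / j`!%:R) (dec_monogauss j)) (dec_monogauss j)).
by move=> [//|x [//|y []//]] _ /=.
Qed.

Lemma taylor2E r N x y : taylor2 r N x y =
  expR (- (2^-1 * x ^+ 2)) * expR (- (2^-1 * y ^+ 2)) *
  \sum_(0 <= j < N) exp_coeff (- (r * x * y)) j.
Proof.
rewrite big_mkord mulr_sumr; apply: eq_bigr => j _.
rewrite /monogauss /exp_coeff /= -!mulNr !exprMn; ring.
Qed.

(* By [exp_remainder] with [tau = 1 + 1 / (2 s)], the error is at most [tau ^ - N]
   times [gauss2 (tau r) + gauss2 (- tau r)], and [tau r < 1] still holds. *)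
Lemma pair_estimate r s N : 0 <= r -> 0 < s -> r * (1 + s) <= s ->
  nrm 2 (fun t => fun2 (gauss2 r) t - fun2 (taylor2 r N) t) <=
  2 / (1 + (2 * s)^-1) ^+ N * nrm 2 (fun2 (gauss2 r)).
Proof.
move=> r0 s0 rs; set tau := 1 + _.
have s1 : 0 < 1 + s by lra.
have tauE : tau = (2 * s + 1) / (2 * s) by rewrite /tau; field; lra.
have tau1 : 1 <= tau by rewrite lerDl invr_ge0; lra.
have tau0 : 0 < tau by exact: lt_le_trans tau1.
have rle : r <= s / (1 + s) by rewrite ler_pdivlMr.
have r1 : `|r| < 1.
  by rewrite ger0_norm// (le_lt_trans rle)// ltr_pdivrMr// mul1r ltrDr.
have trle : tau * r <= (2 * s + 1) / (2 * (1 + s)).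
  rewrite (_ : _ / _ = tau * (s / (1 + s))); first by rewrite ler_pM2l.
  by rewrite tauE; field; rewrite !lt0r_neq0.
have tr0 : 0 <= tau * r by rewrite mulr_ge0// ltW.
have tr1 : `|tau * r| < 1.
  rewrite ger0_norm// (le_lt_trans trle)// ltr_pdivrMr; lra.
(* By this inequality the squared norm of [gauss2 (tau r)] is at most twice that of [gauss2 r]. The
   worst case is [r = s / (1 + s)], where [(4 tau^2 - 1) r^2 = (3 s + 1) / (s + 1) <= 3]. *)
have key : 1 - r ^+ 2 <= 4 * (1 - (tau * r) ^+ 2).
  have h1 : (4 * tau ^+ 2 - 1) * r ^+ 2 <= (4 * tau ^+ 2 - 1) * (s / (1 + s)) ^+ 2.
    rewrite ler_wpM2l ?ler_pXn2r ?nnegrE ?divr_ge0 ?(ltW s0) ?(ltW s1)//.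
    by have : 1 <= tau ^+ 2 by [rewrite exprn_ege1|]; lra.
  have h2 : (4 * tau ^+ 2 - 1) * (s / (1 + s)) ^+ 2 = (3 * s + 1) / (s + 1).
    by rewrite tauE; field; rewrite !lt0r_neq0; lra.
  have h3 : (3 * s + 1) / (s + 1) <= 3 by rewrite ler_pdivrMr; lra.
  by rewrite exprMn; lra.
have dg := dec_gauss2 r1; have dtr := dec_gauss2 tr1.
have dtrN : dec 2 (fun2 (gauss2 (- (tau * r)))) by apply: dec_gauss2; rewrite normrN.
have dT := dec_taylor2 r N; have dB := decB dg dT.
have tN0 : 0 < tau ^+ N by rewrite exprn_gt0.
rewrite -(ler_pXn2r (_ : 0 < 2)%N) ?nnegrE ?nrm_ge0//; last first.
  by rewrite mulr_ge0 ?nrm_ge0// divr_ge0// ltW.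
rewrite exprMn !sqr_nrm.
have step : ip 2 (fun t => fun2 (gauss2 r) t - fun2 (taylor2 r N) t)
    (fun t => fun2 (gauss2 r) t - fun2 (taylor2 r N) t) <=
    (tau ^+ N)^-2 * (ip 2 (fun2 (gauss2 (tau * r))) (fun2 (gauss2 (tau * r))) +
      ip 2 (fun2 (gauss2 (- (tau * r)))) (fun2 (gauss2 (- (tau * r))))).
  rewrite /ip -rintD; [|exact: decM..]; rewrite -rintZ; last by apply: decD; exact: decM.
  apply: le_rint; first exact: decM.
    by apply: decZ; apply: decD; exact: decM.
  move=> t st; rewrite /fun2; set x := t`_0; set y := t`_1.
  rewrite taylor2E; set E := expR _ * expR _.
  have E0 : 0 <= E by rewrite mulr_ge0 ?expR_ge0.
  set S := \sum_(_ <= _ < _) _; set z := r * x * y in S *.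
  have gE b : gauss2 b x y = E * expR (- (b * x * y)) by [].
  rewrite !gE -/z -mulrBr.
  have -> : tau * r * x * y = tau * z by rewrite /z; ring.
  have -> : - (tau * r) * x * y = - (tau * z) by rewrite /z; ring.
  rewrite opprK.
  have := exp_remainder (- z) N tau1; rewrite -/S normrN => h.
  set d := expR (- z) - S in h *.
  (* The sign of [z] varies with the point, so [exp (tau |z|)^2] is bounded by the sum of the
     squares for both signs. *)
  have h1 : d ^+ 2 * (tau ^+ N) ^+ 2 <= expR (- (tau * z)) ^+ 2 + expR (tau * z) ^+ 2.
    apply: (@le_trans _ _ (expR (tau * `|z|) ^+ 2)).
      rewrite -exprMn -[leLHS]real_normK ?num_real//.
      rewrite ler_pXn2r ?nnegrE ?expR_ge0// normrM (ger0_norm (ltW tN0)).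
      exact: h.
    have [z0|z0] := leP 0 z; first by rewrite ger0_norm// lerDr sqr_ge0.
    by rewrite ltr0_norm// mulrN lerDl sqr_ge0.
  rewrite (_ : E * d * (E * d) = (tau ^+ N)^-2 * (E ^+ 2 * (d ^+ 2 * (tau ^+ N) ^+ 2))).
    rewrite ler_wpM2l ?exprn_ge0 ?invr_ge0 ?exprn_ge0 ?(ltW tau0)//.
    apply: le_trans (ler_wpM2l (sqr_ge0 E) h1) _.
    by rewrite le_eqVlt; apply/orP; left; apply/eqP; ring.
  by field; exact: lt0r_neq0.
apply: le_trans step _; rewrite !ip_gauss2 ?normrN// sqrrN.
have J0 := gaussJ_gt0.
have pos b : `|b| < 1 -> 0 < 1 - b ^+ 2 :> R.
  by move=> b1; rewrite subr_gt0 -[b ^+ 2]real_normK ?num_real// expr_lt1.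
have a0 : 0 < Num.sqrt (1 - r ^+ 2) by rewrite sqrtr_gt0 pos.
have b0 : 0 < Num.sqrt (1 - (tau * r) ^+ 2) by rewrite sqrtr_gt0 pos.
have ab : Num.sqrt (1 - r ^+ 2) <= 2 * Num.sqrt (1 - (tau * r) ^+ 2).
  rewrite -(ler_pXn2r (_ : 0 < 2)%N) ?nnegrE ?mulr_ge0 ?(ltW a0) ?(ltW b0)//.
  by rewrite exprMn !sqr_sqrtr ?(ltW (pos _ _))//; move: key; rewrite -natrX.
move: a0 b0 ab; set a := Num.sqrt _; set b := Num.sqrt _ => a0 b0 ab.
rewrite (_ : _ * (_ + _) = (tau ^+ N)^-2 * gaussJ ^+ 2 * (2 / b)); last by ring.
rewrite (_ : _ * (_ / a) = (tau ^+ N)^-2 * gaussJ ^+ 2 * (4 / a)); last first.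
  by field; rewrite !lt0r_neq0.
have h : 2 / b <= 4 / a by rewrite ler_pdivrMr// mulrAC ler_pdivlMr//; lra.
apply: ler_wpM2l h; apply: mulr_ge0; last exact: sqr_ge0.
by rewrite invr_ge0 sqr_ge0.
Qed.

End PairEstimate.

Section CutApprox.
Context {R : realType}.

Definition cvec n (s : seq R) : 'cV[R]_n := \col_i s`_i.

Definition gaussS n (G : 'M[R]_n) (s : seq R) : R :=
  expR (- (2^-1 * dotm (cvec n s) (G *m cvec n s))).

Lemma cvec_afseq n (A : 'M[R]_n) s : cvec n (afseq A 0 s) = A *m cvec n s.
Proof.
apply/colP => i; rewrite mxE nth_afseq !mxE addr0.
by apply: eq_bigr => j _; rewrite mxE.
Qed.

Lemma dotm_cvec n s : size s = n -> dotm (cvec n s) (cvec n s) = sqn s.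
Proof.
by move=> ss; rewrite dotmE (sqn_nth ss); apply: eq_bigr => i _; rewrite !mxE expr2.
Qed.

Lemma cvec_cat k n s t : size s = k ->
  cvec (k + n) (s ++ t) = col_mx (cvec k s) (cvec n t).
Proof.
move=> ss; apply/colP => i; rewrite mxE; case: (split_ordP i) => j ->.
  by rewrite col_mxEu mxE nth_cat /= ss ltn_ord.
by rewrite col_mxEd mxE nth_cat /= ss ltnNge leq_addr /= addKn.
Qed.

Lemma afseq_block k n (A : 'M[R]_k) (B : 'M[R]_n) s t : size s = k -> size t = n ->
  afseq (block_mx A 0 0 B) 0 (s ++ t) = afseq A 0 s ++ afseq B 0 t.
Proof.
move=> ss st; apply: (@eq_from_nth _ 0); rewrite size_afseq ?size_cat ?size_afseq// => i ikn.
have := congr1 (fun v : 'cV_(k + n) => v (Ordinal ikn) 0)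
  (cvec_afseq (block_mx A 0 0 B) (s ++ t)).
rewrite cvec_cat// mul_block_col !mul0mx addr0 add0r -!cvec_afseq -cvec_cat ?size_afseq//.
by rewrite !mxE.
Qed.

Lemma pairprod_gauss (rho : nat -> R) s1 s2 :
  pairprod (fun i => gauss2 (rho i)) s1 s2 =
  expR (- (2^-1 * (sqn s1 + sqn s2 +
     2 * \sum_(i < size s2) s2`_i * (rho i * s1`_i)))).
Proof.
elim: s1 s2 rho => [|x s1 IHs] [|y s2] rho.
- by rewrite pairprod_nil; [rewrite -expRD big_ord0; congr expR; ring|left].
- rewrite pairprod_nil; [rewrite -expRD big1|by left]; last first.
    by move=> i _; rewrite nth_nil !mulr0.
  by congr expR; ring.
- by rewrite pairprod_nil; [rewrite -expRD big_ord0; congr expR; ring|right].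
rewrite /= (IHs s2 (fun i => rho i.+1)) big_ord_recl /= /gauss2 -!expRD !sqn_cons.
by congr expR; field.
Qed.

Lemma dotm_diagrect m n (rho : nat -> R) (s t : seq R) : size s = n ->
  dotm (cvec m t) (diagrect m n rho *m cvec n s) = \sum_(i < m) t`_i * (rho i * s`_i).
Proof.
move=> ss; rewrite dotmE; apply: eq_bigr => i _.
by rewrite mxE (@diagrectM _ m n rho (nth 0 s))// => j nj; rewrite nth_default// ss.
Qed.

Lemma dotm_block k n (G : 'M[R]_(k + n)) x y : G^T = G ->
  dotm (col_mx x y) (G *m col_mx x y) =
  dotm x (ulsubmx G *m x) + 2 * dotm y (dlsubmx G *m x) + dotm y (drsubmx G *m y).
Proof.
move=> sG; rewrite -{1}[G]submxK mul_block_col /dotm tr_col_mx mul_row_col mxE.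
rewrite -!/(dotm _ _) !dotmDr (_ : ursubmx G = (dlsubmx G)^T); last first.
  by rewrite trmx_dlsub sG.
by rewrite -dotmMl [dotm (_ *m x) y]dotmC; ring.
Qed.

(* [block_mx P 0 0 Q] turns the Gaussian into a product of Gaussians of pairs of
   variables, without acting across the cut. *)
Lemma cut_approx k n (G : 'M[R]_(k + n)) lam (sg : nat -> R) (N : nat -> nat) :
  0 < lam -> G^T = G -> (forall x, lam * dotm x x <= dotm x (G *m x)) ->
  (forall i, 0 < sg i) ->
  (forall i, (i < minn n k)%N -> (singular_values (dlsubmx G))`_i <= lam * sg i) ->
  exists a u : nat -> seq R -> R,
    [/\ forall j, dec k (a j), forall j, dec n (u j) &
      nrm (k + n) (fun s => gaussS G s -
         \sum_(j < \prod_(i < minn k n) N i) a j (take k s) * u j (drop k s)) <=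
      (\prod_(i < minn k n) (1 + 2 / (1 + (2 * sg i)^-1) ^+ N i) - 1) *
        nrm (k + n) (gaussS G)].
Proof.
move=> lam0 sG Glam sg0 Gsg.
have s11 : (ulsubmx G)^T = ulsubmx G by rewrite trmx_ulsub sG.
have s22 : (drsubmx G)^T = drsubmx G by rewrite trmx_drsub sG.
have H x y : lam * (dotm x x + dotm y y) <= dotm x (ulsubmx G *m x) +
    2 * dotm y (dlsubmx G *m x) + dotm y (drsubmx G *m y).
  rewrite -dotm_block//; apply: le_trans (Glam _).
  by rewrite ler_pM2l// /dotm tr_col_mx mul_row_col [in leRHS]mxE.
have [P [Q [rho [PE QE DE [rho0 rhom] rhos]]]] := cut_normal_form lam0 s11 s22 H.
have uP : P \in unitmx by have [] := mulmx1_unit PE.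
have uQ : Q \in unitmx by have [] := mulmx1_unit QE.
(* The map [s |-> s / (lam + s)] is increasing, so the singular value may be replaced by its upper
   bound; since [rho i <= 1], this can be done without division. *)
have rsg i : rho i * (1 + sg i) <= sg i.
  have [im|im] := ltnP i (minn n k); last by rewrite rhom// mul0r ltW.
  have h1 := rhos i im; have h2 := Gsg i im; set sv := _`_i in h1 h2.
  have sv0 : 0 <= sv.
    rewrite /sv /singular_values; set l := take _ _.
    have [il|il] := ltnP i (size l); last by rewrite nth_default// size_map.
    by rewrite (nth_map 0)// sqrtr_ge0.
  have r1 : rho i <= 1.
    rewrite leNgt; apply/negP => r1; move: h1; rewrite leNgt => /negP; apply.
    by apply: (@lt_le_trans _ _ (1 * (lam + sv))); [lra|rewrite ler_wpM2r ?ltW//; lra].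
  rewrite -(ler_pM2l lam0); apply: (@le_trans _ _ (rho i * (lam + sv) + 1 * (lam * sg i - sv))).
    have : rho i * (lam * sg i - sv) <= 1 * (lam * sg i - sv).
      by rewrite ler_wpM2r// subr_ge0.
    by lra.
  by lra.
pose L : 'M[R]_(k + n) := block_mx (invmx P) 0 0 (invmx Q).
have uL : L \in unitmx.
  by rewrite unitmxE det_lblock unitrM -!unitmxE !unitmx_inv uP.
pose Hg := pairfun k (fun i => gauss2 (rho i)).
pose Ht := pairfun k (fun i => taylor2 (rho i) (N i)).
have r1 i : `|rho i| < 1.
  rewrite ger0_norm//; have := rsg i; have := sg0 i; have := rho0 i => a b c.
  by rewrite ltNge; apply/negP => d; have := ler_wpM2r (ltW (addr_gt0 ltr01 b)) d; lra.
have dHg : dec (k + n) Hg by apply: dec_pairfun => i; exact: dec_gauss2.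
have dHt : dec (k + n) Ht by apply: dec_pairfun => i; exact: dec_taylor2.
have split_s s : size s = (k + n)%N -> exists s1 s2, [/\ s = s1 ++ s2, size s1 = k & size s2 = n].
  move=> ss; exists (take k s), (drop k s); rewrite cat_take_drop size_drop ss addKn.
  by rewrite size_takel// ss leq_addr.
have GH s : size s = (k + n)%N -> gaussS G s = Hg (afseq L 0 s).
  move=> /split_s[s1 [s2 [-> s1k s2n]]]; rewrite /L afseq_block// /Hg /pairfun.
  rewrite take_size_cat ?size_afseq// drop_size_cat ?size_afseq// pairprod_gauss.
  rewrite /gaussS cvec_cat// dotm_block//; congr (expR (- (_ * _))).
  rewrite size_afseq -(@dotm_diagrect n k) ?size_afseq//.
  rewrite -(dotm_cvec (size_afseq (invmx P) 0 s1)) -(dotm_cvec (size_afseq (invmx Q) 0 s2)).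
  rewrite !cvec_afseq.
  set x := cvec k s1; set y := cvec n s2.
  rewrite -DE !mulmxA mulmxK// -(mulmxA Q^T) -dotmMl mulKVmx//.
  have E m (S W : 'M[R]_m) z : W \in unitmx -> W^T *m S *m W = 1%:M ->
      dotm (invmx W *m z) (invmx W *m z) = dotm z (S *m z).
    move=> uW WE; rewrite -[X in dotm _ X]mul1mx -WE -!mulmxA mulKVmx// -dotmMl.
    by rewrite mulKVmx.
  by rewrite (E _ _ _ x uP PE) (E _ _ _ y uQ QE); ring.
have [a0 [u0 [da du Hsep]]] := pairprod_separable k n (T := fun i => taylor2 (rho i) (N i)) (N := N)
  (phi := fun i j x => (- rho i) ^+ j / j`!%:R * monogauss j x)
  (psi := fun i j y => monogauss j y)
  (fun i j => decZ _ (dec_monogauss j)) (fun i j => dec_monogauss j) (fun i x y => erefl).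
exists (fun j s => a0 j (afseq (invmx P) 0 s)), (fun j s => u0 j (afseq (invmx Q) 0 s)).
split=> [j|j|]; [by apply: dec_lin; rewrite ?unitmx_inv|by apply: dec_lin; rewrite ?unitmx_inv|].
(* The change of variables multiplies all norms by one constant, which cancels because the error is
   relative. *)
have [c c0 cE] := ip_lin uL.
have nE F : dec (k + n) F -> nrm (k + n) (fun s => F (afseq L 0 s)) = Num.sqrt c * nrm (k + n) F.
  by move=> dF; rewrite /nrm cE// sqrtrM// ltW.
rewrite (eq_nrm (F' := fun s => Hg (afseq L 0 s) - Ht (afseq L 0 s))); last first.
  move=> s ss; rewrite GH//; congr (_ - _); move: ss => /split_s[s1 [s2 [-> s1k s2n]]].
  rewrite /L afseq_block// /Ht /pairfun.
  rewrite !take_size_cat ?size_afseq// !drop_size_cat ?size_afseq//.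
  by rewrite Hsep ?size_afseq.
rewrite (nE (fun s => Hg s - Ht s)); last exact: decB.
rewrite (eq_nrm GH) nE// mulrCA ler_wpM2l ?sqrtr_ge0//.
apply: (@nrm_pairfunB _ k n (fun i => gauss2 (rho i))
  (fun i => taylor2 (rho i) (N i)) (fun i => 2 / (1 + (2 * sg i)^-1) ^+ N i)) => i;
  [exact: dec_gauss2|exact: dec_taylor2| |].
  by rewrite divr_ge0// exprn_ge0// addr_ge0// invr_ge0 mulr_ge0// ltW.
by apply: pair_estimate.
Qed.

End CutApprox.

(** * Choice of the truncation orders *)

Section Numerics.
Context {R : realType}.

(** Amounts to [exp (10/3) < 32]. Five squarings of [exp (5/96) <= 96/91], rounded up each time,
    give [exp (5/3) <= 5.6], and [5.6^2 = 31.36]. *)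
Lemma ge_5_3_expR (L : R) : 32 <= expR L ^+ 2 -> 5 / 3 <= L.
Proof.
move=> h; rewrite leNgt; apply/negP => L53.
pose z : R := expR (5 / 96); have z0 : 0 <= z by exact: expR_ge0.
have z1 : z <= 96 / 91.
  rewrite /z -[5 / 96]opprK expRN -[leRHS]invrK ler_pV2; last 2 first.
  - by rewrite inE unitfE gt_eqF ?expR_gt0.
  - by rewrite inE unitfE invr_eq0 gt_eqF//= invr_gt0; lra.
  by rewrite (le_trans _ (expR_ge1Dx _))//; lra.
have sq (x b c : R) : x <= b -> 0 <= x -> b ^+ 2 <= c -> x ^+ 2 <= c.
  by move=> xb x0; apply: le_trans; rewrite ler_pXn2r ?nnegrE// (le_trans x0).
have z2 : z ^+ 2 <= 1113 / 1000 by apply: (sq _ _ _ z1) => //; rewrite expr2; lra.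
have z4 : (z ^+ 2) ^+ 2 <= 1239 / 1000.
  by apply: (sq _ _ _ z2); rewrite ?exprn_ge0// expr2; lra.
have z8 : ((z ^+ 2) ^+ 2) ^+ 2 <= 1536 / 1000.
  by apply: (sq _ _ _ z4); rewrite ?exprn_ge0// expr2; lra.
have z16 : (((z ^+ 2) ^+ 2) ^+ 2) ^+ 2 <= 236 / 100.
  by apply: (sq _ _ _ z8); rewrite ?exprn_ge0// expr2; lra.
have z32 : ((((z ^+ 2) ^+ 2) ^+ 2) ^+ 2) ^+ 2 <= 56 / 10.
  by apply: (sq _ _ _ z16); rewrite ?exprn_ge0// expr2; lra.
have : expR L ^+ 2 <= (56 / 10) ^+ 2.
  rewrite ler_pXn2r ?nnegrE ?expR_ge0//.
  apply: le_trans z32; rewrite -!exprM -expRM_natl ler_expR.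
  by rewrite (_ : (2 * 2 * 2 * 2 * 2)%N%:R = 32 :> R)//; lra.
by rewrite [X in _ <= X -> _]expr2; lra.
Qed.

(** With [q = exp (- t)], the inequality [1 + t <= exp t] reads [t q <= 1 - q], so the sum is at
    most [(1 - q^m) / t], the form proved by induction. *)
Lemma geometric_le (t : R) m : 0 < t ->
  \sum_(i < m) expR (- (t * i.+1%:R)) <= t^-1.
Proof.
move=> t0; pose q := expR (- t).
have q0 : 0 <= q by exact: expR_ge0.
have qt : t * q <= 1 - q.
  have := expR_ge1Dx t; rewrite -(ler_pM2r (expR_gt0 (- t))) -expRD subrr expR0.
  by rewrite -/q mulrDl mul1r; lra.
have E i : expR (- (t * i.+1%:R)) = q ^+ i.+1.
  by rewrite -mulNr expRM_natr.
suff : \sum_(i < m) expR (- (t * i.+1%:R)) <= (1 - q ^+ m) / t.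
  move=> /le_trans; apply; rewrite ler_pdivrMr// mulVf ?lt0r_neq0//.
  by rewrite gerBl exprn_ge0.
elim: m => [|m IHm]; first by rewrite big_ord0 expr0 subrr mul0r.
rewrite big_ord_recr /= E (le_trans (lerD IHm (lexx _)))//.
rewrite ler_pdivlMr// mulrDl divfK ?lt0r_neq0// exprS.
have qm : 0 <= q ^+ m by exact: exprn_ge0.
have := ler_wpM2r qm qt; lra.
Qed.

Lemma geometric_tail_le (t : R) l m : 0 < t ->
  \sum_(i < m) (if (i < l)%N then 0 else expR (- (t * i.+1%:R))) <=
  expR (- (t * l.+1%:R)) / (1 - expR (- t)).
Proof.
move=> t0; pose q := expR (- t).
have q0 : 0 <= q by exact: expR_ge0.
have q1 : q < 1 by rewrite -expR0 ltr_expR; lra.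
have E i : expR (- (t * i.+1%:R)) = q ^+ i.+1.
  by rewrite -mulNr expRM_natr.
have q1' : 0 < 1 - q by rewrite subr_gt0.
rewrite E -/q.
(* The exact telescoped value, zero as long as [m <= l], is what the induction carries. *)
suff : \sum_(i < m) (if (i < l)%N then 0 else expR (- (t * i.+1%:R))) <=
    (q ^+ l.+1 - (if (m <= l)%N then q ^+ l.+1 else q ^+ m.+1)) / (1 - q).
  move=> /le_trans; apply; rewrite ler_pM2r ?invr_gt0// gerBl.
  by case: ifP => _; exact: exprn_ge0.
elim: m => [|m IHm]; first by rewrite big_ord0 leq0n subrr mul0r.
rewrite big_ord_recr /= (le_trans (lerD IHm (lexx _)))//.
have [ml|lm|ml] := ltngtP m l; rewrite ?E.
- by rewrite addr0.
- rewrite ler_pdivlMr// mulrDl divfK ?lt0r_neq0// !exprS; lra.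
- rewrite subrr mul0r add0r ml ler_pdivlMr// !exprS; lra.
Qed.

End Numerics.

Section TruncationOrder.
Context {R : realType}.
Variables (c t L : R).

(* [c], [t] and [L] stand for alpha / lambda_min, theta and log (C d / eps), and
   [i] is counted from 0. *)
Definition sv_ratio (i : nat) : R := c * expR (- (t * i.+1%:R)).
Definition cutoff : nat := Num.truncn (2 * L / t).
Definition trunc_order (i : nat) : nat :=
  if (i < cutoff)%N then Num.truncn (3 * L * (1 + 3 * sv_ratio i)) else 1%N.

Lemma sv_ratio_gt0 i : 0 < c -> 0 < sv_ratio i.
Proof. by move=> c0; rewrite mulr_gt0 ?expR_gt0. Qed.

(** Each order is at most [3 L exp (3 s_i)]. The exponentials multiply to at most [exp (3 c / t)] by
    the geometric series, and the factor [3 L] occurs at most [2 L / t] times. *)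
Lemma prod_trunc_order_le m : 0 < c -> 0 < t -> 5 / 3 <= L ->
  (\prod_(i < m) trunc_order i)%N%:R <=
  expR (3 * c / t) * (3 * L) `^ (2 / t * L).
Proof.
move=> c0 t0 L53.
have L1 : 1 <= 3 * L by lra.
have h1 i : (trunc_order i)%:R <=
    expR (3 * sv_ratio i) * (if (i < cutoff)%N then 3 * L else 1).
  have si := sv_ratio_gt0 i c0; have e := expR_ge1Dx (3 * sv_ratio i).
  rewrite /trunc_order; case: ifP => _; last by lra.
  have y0 : 0 <= 3 * L * (1 + 3 * sv_ratio i) by rewrite mulr_ge0//; lra.
  have /andP[h _] := truncn_itv y0.
  by rewrite (le_trans h)// mulrC ler_wpM2r//; lra.
rewrite natr_prod.
apply: (@le_trans _ _ (\prod_(i < m) (expR (3 * sv_ratio i) * (if (i < cutoff)%N then 3 * L else 1)))).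
  by apply: ler_prod => i _; rewrite ler0n h1.
rewrite big_split /= ler_pM//.
- by rewrite prodr_ge0// => i _; exact: expR_ge0.
- by rewrite prodr_ge0// => i _; case: ifP => _; lra.
- rewrite -expR_sum ler_expR -mulr_sumr -mulrA ler_pM2l// -mulr_sumr ler_pM2l//.
  exact: geometric_le.
apply: (@le_trans _ _ ((3 * L) ^+ minn m cutoff)).
  elim: m {h1} => [|m IHm]; first by rewrite big_ord0 min0n.
  rewrite big_ord_recr /=; case: ifPn => [ml|]; last first.
    by rewrite -leqNgt mulr1 => lm; rewrite (le_trans IHm)// !(minn_idPr _)// ltnW.
  rewrite (minn_idPl ml) exprSr ler_wpM2r//; first by lra.
  by rewrite (le_trans IHm)// (minn_idPl (ltnW ml)).
rewrite (le_trans (ler_weXn2l L1 (geq_minr m cutoff)))// -powR_mulrn; last by lra.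
rewrite ler_powR//; have y0 : 0 <= 2 * L / t by rewrite divr_ge0//; lra.
by have /andP[h _] := truncn_itv y0; rewrite (le_trans h)//; lra.
Qed.

(** Rounding down keeps at least [8/10] of [y >= 5], and [log (1 + 1 / (2 s)) >= 5 / (4 (1 + 3 s))];
    these two lower bounds multiply to [3 L]. *)
Lemma head_error i : 0 < c -> 5 / 3 <= L -> (i < cutoff)%N ->
  2 / (1 + (2 * sv_ratio i)^-1) ^+ trunc_order i <= 2 * expR (- (3 * L)).
Proof.
move=> c0 L53 il; rewrite /trunc_order il; move: (sv_ratio_gt0 i c0); move: (sv_ratio i) => s s0.
set y := 3 * L * (1 + 3 * s).
have y5 : 5 <= y.
  rewrite -[leLHS]mulr1; apply: ler_pM => //; lra.
have yN : 8 / 10 * y <= (Num.truncn y)%:R.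
  have := @real_truncnS_gt _ y (num_real _).
  rewrite -natr1; lra.
rewrite ler_pM2l// expRN lef_pV2 ?posrE ?expR_gt0//; last first.
  by rewrite exprn_gt0// addr_gt0// invr_gt0 mulr_gt0.
pose x := 5 / (4 * (1 + 3 * s)).
have d0 : 0 < 1 + 3 * s by lra.
(* Use [exp (x / 2) <= 1 / (1 - x / 2)] and square. Halving is required because [x] may exceed 1. *)
have xe : expR x <= 1 + (2 * s)^-1.
  have -> : x = 2%:R * (x / 2) by lra.
  have u0 : 0 < 1 - x / 2.
    by rewrite /x subr_gt0 ltr_pdivrMr// ltr_pdivrMr ?mulr_gt0//; lra.
  rewrite expRM_natl; apply: (@le_trans _ _ ((1 - x / 2)^-1 ^+ 2)).
    rewrite ler_pXn2r ?nnegrE ?expR_ge0 ?invr_ge0 ?(ltW u0)//.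
    rewrite -[x / 2 in leLHS]opprK expRN lef_pV2 ?posrE ?expR_gt0//.
    exact: expR_ge1Dx.
  have -> : 1 - x / 2 = 3 * (1 + 8 * s) / (8 * (1 + 3 * s)).
    by rewrite /x; field; lra.
  have -> : 1 + (2 * s)^-1 = (2 * s + 1) / (2 * s) by field; lra.
  rewrite invf_div expr_div_n ler_pdivlMr ?mulr_gt0//.
  rewrite mulrAC.
  rewrite ler_pdivrMr; last by rewrite exprn_gt0//; lra.
  have s2 : 0 <= s ^+ 2 by exact: sqr_ge0.
  rewrite -subr_ge0.
  have -> : (2 * s + 1) * (3 * (1 + 8 * s)) ^+ 2 - (8 * (1 + 3 * s)) ^+ 2 * (2 * s) =
      9 + 34 * s + 96 * s ^+ 2 by ring.
  lra.
apply: (@le_trans _ _ (expR x ^+ Num.truncn y)); last first.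
  rewrite lerXn2r ?nnegrE ?expR_ge0//.
  by rewrite addr_ge0 ?invr_ge0 ?mulr_ge0 ?(ltW s0).
rewrite -expRM_natl ler_expR.
have -> : 3 * L = 8 / 10 * y * x by rewrite /x /y; field; lra.
by rewrite ler_wpM2r// /x divr_ge0// mulr_ge0// ltW.
Qed.

(** With a single term the bound equals [4 s / (2 s + 1)]. *)
Lemma tail_error i : 0 < c -> (i < cutoff)%N = false ->
  2 / (1 + (2 * sv_ratio i)^-1) ^+ trunc_order i <= 4 * sv_ratio i.
Proof.
move=> c0 il; rewrite /trunc_order il expr1; move: (sv_ratio_gt0 i c0); move: (sv_ratio i) => s s0.
have -> : 1 + (2 * s)^-1 = (2 * s + 1) / (2 * s) by field; lra.
rewrite invf_div mulrA ler_pdivrMr; last by lra.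
by have := mulr_gt0 s0 s0; lra.
Qed.

End TruncationOrder.

Section TruncationError.
Context {R : realType}.
Variables (c t L : R).

Lemma sum_ltn_le (x : R) l m : 0 <= x ->
  \sum_(i < m) (if (i < l)%N then x else 0) <= l%:R * x.
Proof.
move=> x0; apply: (@le_trans _ _ ((minn m l)%:R * x)); last first.
  by rewrite ler_wpM2r// ler_nat geq_minr.
elim: m => [|m IHm]; first by rewrite big_ord0 min0n mul0r.
rewrite big_ord_recr /=; case: ifPn => [ml|]; last first.
  by rewrite -leqNgt addr0 => lm; rewrite (le_trans IHm)// !(minn_idPr _)// ltnW.
by rewrite (minn_idPl ml) -natr1 mulrDl mul1r lerD2r (le_trans IHm)// (minn_idPl (ltnW ml)).
Qed.

(** The product is at most [exp S], and [exp S <= 1 / (1 - S) <= 1 + 2 S] for [S <= 1/2]. *)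
Lemma prodD1_le m (E : nat -> R) h : (forall i, 0 <= E i) ->
  \sum_(i < m) E i <= h / 2 -> h <= 1 / 2 ->
  \prod_(i < m) (1 + E i) - 1 <= h.
Proof.
move=> E0; set S := \sum_(i < m) E i => Sh h2.
have S0 : 0 <= S by exact: sumr_ge0.
have : \prod_(i < m) (1 + E i) <= expR S.
  rewrite expR_sum; apply: ler_prod => i _.
  by rewrite addr_ge0// expR_ge1Dx.
have eS : expR S <= 1 + 2 * S.
  have e := expR_ge1Dx (- S).
  rewrite -[S in leLHS]opprK expRN -[leRHS]invrK lef_pV2 ?posrE ?expR_gt0//; last first.
    by rewrite invr_gt0; lra.
  rewrite (le_trans _ e)// -[leLHS]mul1r ler_pdivrMr; last by lra.
  have : S ^+ 2 <= S * (1 / 2) by rewrite expr2 ler_wpM2l//; lra.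
  by rewrite expr2; lra.
by clearbody S; lra.
Qed.

Lemma ge_5_3_ln h C : 8 <= C ^+ 2 -> 0 < h -> h <= 1 / 2 -> expR L = C / h ->
  5 / 3 <= L.
Proof.
move=> C8 h0 h2 eL; apply: ge_5_3_expR; rewrite eL expr_div_n ler_pdivlMr ?exprn_gt0//.
rewrite (le_trans _ C8)// expr2.
have : h * h <= (1 / 2) * (1 / 2) by apply: ler_pM => //; exact: ltW.
lra.
Qed.

(* The indices below [cutoff] contribute at most [h / 10], the others, a geometric
   series starting at [expR (- 2 L) = (h / C) ^+ 2], at most [2 h / 5]. *)
Lemma sum_trunc_error m h C : 0 < c -> 0 < t -> 0 < h -> h <= 1 / 2 ->
  0 < C -> 8 <= C ^+ 2 -> 5 / t <= C -> 4 * c / (1 + expR (- t)) <= C ->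
  expR L = C / h ->
  \sum_(i < m) 2 / (1 + (2 * sv_ratio c t i)^-1) ^+ trunc_order c t L i <= h / 2.
Proof.
move=> c0 t0 h0 h2 C0 C8 C5 CA eL.
have L53 : 5 / 3 <= L by exact: (ge_5_3_ln C8 h0 h2 eL).
pose l := cutoff t L.
have l0 : 0 <= 2 * L / t by rewrite divr_ge0//; lra.
have /andP[lL Ll] := truncn_itv l0; rewrite -/(cutoff t L) -/l in lL Ll.
set q := expR (- t) in CA *; have q0 : 0 < q by exact: expR_gt0.
have q1 : q < 1 by rewrite -expR0 ltr_expR; lra.
set e := expR (- L); have e0 : 0 < e by exact: expR_gt0.
have eh : C * e = h by rewrite /e expRN eL invf_div mulrC divfK ?gt_eqF.
(* Follows from [exp L >= 4] and [exp L >= (1 + L / 2)^2 >= 2 L]. *)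
have e8 : 8 * L * e ^+ 2 <= 1.
  rewrite /e expRN exprVn ler_pdivrMr ?exprn_gt0 ?expR_gt0// mul1r.
  have E4 : 4 <= expR L.
    apply: (@le_trans _ _ (1 + 1 + 1 + 1)); first by lra.
    rewrite eL ler_pdivlMr//.
    have : 2 <= C by rewrite -(@ler_pXn2r _ 2) ?nnegrE ?(ltW C0)// expr2; lra.
    by lra.
  have E2 : 2 * L <= expR L.
    have -> : expR L = expR (L / 2) ^+ 2.
      by rewrite -expRM_natl; congr expR; lra.
    apply: (@le_trans _ _ ((1 + L / 2) ^+ 2)).
      have := sqr_ge0 (1 - L / 2); rewrite !expr2; lra.
    by rewrite ler_pXn2r ?nnegrE ?expR_ge0 ?expR_ge1Dx//; lra.
  rewrite expr2; have : 4 * (2 * L) <= expR L * expR L by apply: ler_pM => //; lra.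
  lra.
have qt : q * (1 + t) <= 1.
  have := expR_ge1Dx t; rewrite -(ler_pM2l q0) => /le_trans; apply.
  by rewrite /q -expRD addNr expR0.
have Ct : 5 <= C * t by rewrite -ler_pdivrMr.
(* Turns [C t >= 5] into a lower bound for [1 - q], the denominator of the geometric tail. For
   [t > 2] the entry [sqrt 8 >= 2.8] takes over. *)
have Cq : 5 / 4 * (1 + q) <= C * (1 - q).
  rewrite -(@ler_pM2r _ (1 + t)); last by lra.
  have C2 : 28 / 10 <= C.
    by rewrite -(@ler_pXn2r _ 2) ?nnegrE ?(ltW C0)// expr2; lra.
  have h1 : 5 / 4 * (2 + t) <= C * t.
    have [t2|t2] := leP t 2; first by lra.
    have : 28 / 10 * t <= C * t by rewrite ler_wpM2r//; exact: ltW.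
    lra.
  have h3 : (5 / 4 + C) * (q * (1 + t)) <= (5 / 4 + C) * 1.
    by rewrite ler_wpM2l//; lra.
  lra.
(* Combined with the third entry of [C], this bounds the tail [4 c e^2 / (1 - q)] by
   [(4/5) (C e)^2 = (4/5) h^2]. *)
have Cc : 5 * c <= C ^+ 2 * (1 - q).
  rewrite ler_pdivrMr in CA; last by lra.
  have : C * (5 / 4 * (1 + q)) <= C * (C * (1 - q)) by rewrite ler_pM2l.
  by rewrite expr2; lra.
apply: (@le_trans _ _ (\sum_(i < m) ((if (i < l)%N then 2 * expR (- (3 * L)) else 0)
   + 4 * c * (if (i < l)%N then 0 else expR (- (t * i.+1%:R)))))).
  apply: ler_sum => i _; have [il|il] := boolP (i < l)%N.
    by rewrite mulr0 addr0 head_error.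
  by rewrite add0r -mulrA tail_error//; exact/negbTE.
rewrite big_split /= -mulr_sumr.
have hd : \sum_(i < m) (if (i < l)%N then 2 * expR (- (3 * L)) else 0) <= h / 10.
  apply: (le_trans (sum_ltn_le _ _ _)); first by rewrite mulr_ge0// expR_ge0.
  have -> : expR (- (3 * L)) = e ^+ 3 by rewrite /e -expRM_natl mulrN.
  apply: (@le_trans _ _ (2 * L / t * (2 * e ^+ 3))).
    by rewrite ler_wpM2r// mulr_ge0// exprn_ge0// ltW.
  apply: (@le_trans _ _ (2 / 5 * C * L * (2 * e ^+ 3))).
    rewrite ler_wpM2r//; first by rewrite mulr_ge0// exprn_ge0// ltW.
    rewrite mulrAC ler_wpM2r//; first by lra.
    by rewrite ler_pdivrMr//; lra.
  rewrite -eh.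
  have : C * e * (8 * L * e ^+ 2) <= C * e * 1 by rewrite ler_wpM2l// eh ltW.
  by rewrite (exprS _ 2) mulr1; lra.
have tl : 4 * c * (\sum_(i < m) (if (i < l)%N then 0 else expR (- (t * i.+1%:R)))) <= 2 / 5 * h.
  apply: (@le_trans _ _ (4 * c * (e ^+ 2 / (1 - q)))).
    rewrite ler_wpM2l ?mulr_ge0 ?(ltW c0)//.
    apply: (le_trans (geometric_tail_le _ _ t0)).
    rewrite -/q ler_wpM2r ?invr_ge0 ?subr_ge0 ?(ltW q1)//.
    rewrite /e -expRM_natl ler_expR mulrN lerN2.
    by have := ltW Ll; rewrite ler_pdivrMr// [_ * t]mulrC.
  rewrite mulrA ler_pdivrMr ?subr_gt0//.
  have p1 : 0 <= e ^+ 2 by exact: sqr_ge0.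
  have p2 : e ^+ 2 * (5 * c) <= e ^+ 2 * (C ^+ 2 * (1 - q)) by rewrite ler_wpM2l.
  have p3 : (C * e) ^+ 2 * (1 - q) <= h / 2 * (1 - q).
    by rewrite ler_wpM2r ?subr_ge0 ?(ltW q1)// eh expr2 ler_wpM2l ?(ltW h0)//; lra.
  rewrite exprMn in p3; lra.
lra.
Qed.

Lemma trunc_error_le m h C : 0 < c -> 0 < t -> 0 < h -> h <= 1 / 2 ->
  0 < C -> 8 <= C ^+ 2 -> 5 / t <= C -> 4 * c / (1 + expR (- t)) <= C ->
  expR L = C / h ->
  \prod_(i < m) (1 + 2 / (1 + (2 * sv_ratio c t i)^-1) ^+ trunc_order c t L i) - 1 <= h.
Proof.
move=> c0 t0 h0 h2 C0 C8 C5 CA eL.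
apply: (@prodD1_le m (fun i => 2 / (1 + (2 * sv_ratio c t i)^-1) ^+ trunc_order c t L i)) => //.
  move=> i; rewrite divr_ge0// exprn_ge0// addr_ge0// invr_ge0 mulr_ge0//.
  exact/ltW/sv_ratio_gt0.
exact: (@sum_trunc_error _ _ C).
Qed.

End TruncationError.

(** * Conclusion *)

Section Assembly.
Context {R : realType}.
Local Notation TR := (measurableTypeR R).

Lemma Lnorm_nrm d (H : seq R -> R) : dec d H ->
  Lnorm (lebesgue_tuple d) 2%:E (EFin \o (fun t : d.-tuple TR => H t)) =
  (nrm d H)%:E.
Proof.
move=> dH; rewrite unlock /Lnorm.
under eq_integral => t _.
  rewrite /= powR_mulrn// real_normK ?num_real//. over.
rewrite -/(eint d (fun s => ((H s) ^+ 2)%:E)) /nrm /ip.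
have dHH : dec d (fun s => H s * H s) by exact: decM.
rewrite (eq_eint (G := EFin \o (fun s => H s * H s))); last by move=> s _; rewrite /= expr2.
by rewrite -EFin_rint// poweR_EFin powR12_sqrt// ip_ge0.
Qed.

Lemma dec_Lfun d (H : seq R -> R) : dec d H ->
  (fun t : d.-tuple TR => H t) \in Lfun (lebesgue_tuple d) 2%:E.
Proof.
move=> dH; rewrite inE; apply/andP; split; rewrite inE /=; first exact: dH.1.
by rewrite /finite_norm Lnorm_nrm// ltry.
Qed.

Lemma smallest_eigenvalue_gt0 n (G : 'M[R]_n) l :
  posdefmx G -> smallest_eigenvalue G l -> 0 < l.
Proof.
move=> pG [/eigenvalueP[v Gv v0] _].
have := pG v^T; rewrite trmx_eq0 => /(_ v0).
rewrite trmxK Gv -scalemxAl mxE pmulr_lgt0//.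
have /matrix0Pn[i [j vij]] := v0; rewrite mxE.
rewrite (bigD1 j)//= mxE (ord1 i) in vij *.
rewrite ltr_wpDr//; first by apply: sumr_ge0 => k _; rewrite mxE -expr2 sqr_ge0.
by rewrite -expr2 exprn_even_gt0.
Qed.

Lemma gaussian_gaussS d (G : 'M[R]_d) (t : d.-tuple TR) :
  gaussian G t = gaussS G t.
Proof.
rewrite /gaussian /gaussS /dotm mulmxA; do 3! congr (_ _).
have -> // : cvec d t = \col_i tnth t i.
by apply/colP => i; rewrite !mxE (tnth_nth 0).
Qed.

Lemma dec_gaussS d (G : 'M[R]_d) lam : 0 < lam ->
  (forall x, lam * dotm x x <= dotm x (G *m x)) -> dec d (gaussS G).
Proof.
move=> l0 lG; split.
  apply: measurableT_comp => //; apply: measurableT_comp => //.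
  apply: measurable_funM => //.
  rewrite (_ : (fun _ => _) = (fun t : d.-tuple TR =>
      \sum_i tnth t i * \sum_j G i j * tnth t j)); last first.
    apply/funext => t; rewrite dotmE; apply: eq_bigr => i _.
    rewrite !mxE (tnth_nth 0); congr (_ * _); apply: eq_bigr => j _.
    by rewrite mxE (tnth_nth 0).
  apply: measurable_sum => i; apply: measurable_funM; first exact: measurable_tnth.
  apply: measurable_sum => j; apply: measurable_funM => //; exact: measurable_tnth.
exists 1, (lam / 2); split=> //; first by rewrite divr_gt0.
move=> s ss; rewrite mul1r ger0_norm ?expR_ge0// ler_expR lerN2.
by have := lG (cvec d s); rewrite dotm_cvec//; lra.
Qed.

Lemma castmx_gaussS d m (e : d = m) (G : 'M[R]_d) lam :
  G^T = G -> (forall x, lam * dotm x x <= dotm x (G *m x)) ->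
  let G' := castmx (e, e) G in
  [/\ G'^T = G', forall x, lam * dotm x x <= dotm x (G' *m x) &
      gaussS G' = gaussS G].
Proof. by case: _ / e => GT lG; rewrite castmx_id. Qed.

(** Transports [cut_approx] along [d = k + (d - k)]; the cast that defines [subdiag_block] leaves
    the Gaussian unchanged. *)
Lemma subdiag_approx d (G : 'M[R]_d) lam (sg : nat -> R) (N : nat -> nat)
    (k : 'I_d.+1) :
  0 < lam -> G^T = G -> (forall x, lam * dotm x x <= dotm x (G *m x)) ->
  (forall i, 0 < sg i) ->
  (forall i, (i < minn (d - k) k)%N ->
    (singular_values (subdiag_block k G))`_i <= lam * sg i) ->
  exists a u : nat -> seq R -> R,
    [/\ forall j, dec k (a j), forall j, dec (d - k) (u j) &
      nrm d (fun s => gaussS G s -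
         \sum_(j < \prod_(i < minn k (d - k)) N i) a j (take k s) * u j (drop k s)) <=
      (\prod_(i < minn k (d - k)) (1 + 2 / (1 + (2 * sg i)^-1) ^+ N i) - 1) *
        nrm d (gaussS G)].
Proof.
move=> l0 GT lG sg0 Gsg.
have [GT' lG' EG] := castmx_gaussS (esym (subnKC (leq_ord k))) GT lG.
have [a [u [da du]]] := cut_approx N l0 GT' lG' sg0 Gsg.
rewrite EG; move: (subnKC (leq_ord k)) => e.
by rewrite e => h; exists a, u.
Qed.

(** A bond of size 0 admits no index, so the sum over bond assignments is empty. *)
Lemma has_ftt0 d (r : 'I_d.+1 -> nat) (k : 'I_d.+1) :
  r ord0 = 1%N -> r ord_max = 1%N -> r k = 0%N ->
  has_ftt r (fun _ : d.-tuple TR => 0).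
Proof.
move=> r0 rm rk; split=> //.
exists (fun _ _ _ _ => 0); split; first by move=> *; exact: measurable_cst.
apply: aeW => t _; rewrite /ftt_eval big1// => a _.
by case: (a k) => i; rewrite rk.
Qed.

End Assembly.

Theorem theorem3p2 (R : realType) (d : nat) (G : 'M[R]_d)
    (lmin alpha theta : R) :
  (2 <= d)%N ->
  G \is symmetricmx ->
  posdefmx G ->
  smallest_eigenvalue G lmin ->
  0 < alpha ->
  0 < theta ->
  (forall k : 'I_d.+1, (0 < k < d)%N ->
    forall i : nat, (1 <= i <= minn (d - k) k)%N ->
      (singular_values (subdiag_block k G))`_i.-1
        <= alpha * expR (- (theta * i%:R))) ->
  let C : R := Num.max (Num.sqrt 8) (Num.max (5 / theta)
      (expR theta / (1 + expR theta) * (4 * alpha / lmin))) in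
  forall eps : R, 0 < eps ->
    let L : R := ln (C * (d%:R / eps)) in
    let bound : R := expR (3 * alpha / (lmin * theta))
                       * (3 * L) `^ (2 / theta * L) in
    let bound' : R := expR (3 * alpha / (lmin * theta))
                       * (C * (d%:R / eps)) `^ (2 / theta * ln (3 * L)) in
    bound = bound' /\
    exists (fhat : d.-tuple (measurableTypeR R) -> R) (r : 'I_d.+1 -> nat),
      [/\ fhat \in Lfun (lebesgue_tuple d) 2%:E,
          ('N[lebesgue_tuple d]_2%:E[EFin \o (gaussian G \- fhat)%R]
             <= eps%:E * 'N[lebesgue_tuple d]_2%:E[EFin \o gaussian G])%E,
          has_ftt r fhat &
          forall k : 'I_d.+1, (0 < k < d)%N -> (r k)%:R <= bound].
Proof.
move=> d2 symG posG eigG alpha0 theta0 svG C eps eps0 L bound bound'.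
have lmin0 := smallest_eigenvalue_gt0 posG eigG.
have GT := symmetricmx_tr symG.
have lG := rayleigh_min GT eigG.
have dG := dec_gaussS lmin0 lG.
have sC : Num.sqrt 8 <= C by rewrite le_max lexx.
have C0 : 0 < C by rewrite (lt_le_trans _ sC)// sqrtr_gt0.
have d0 : 0 < d%:R :> R by rewrite ltr0n (leq_trans _ d2).
have X0 : 0 < C * (d%:R / eps) by rewrite mulr_gt0// divr_gt0.
split.
  rewrite /bound /bound' /powR (gt_eqF X0) -/L.
  (* Both powers have exponent [2 / theta * L * ln (3 L)], except that a zero base is special: if
     [L = 0], both equal 1. *)
  case: eqP => [/eqP|_]; last by rewrite /=; congr (_ * expR _); rewrite mulrAC.
  rewrite mulf_eq0 pnatr_eq0 /= => /eqP L0.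
  by rewrite L0 !mulr0 eqxx expR0.
have gaussE : gaussian G = (fun t : d.-tuple (measurableTypeR R) => gaussS G t).
  by apply/funext => t; exact: gaussian_gaussS.
pose h := eps / d%:R.
have h0 : 0 < h by rewrite divr_gt0.
pose c := alpha / lmin; have c0 : 0 < c by rewrite divr_gt0.
(* For [1 <= eps] the zero function, with empty inner bonds, is good enough. *)
have [eps1|eps1] := leP 1 eps.
  exists (fun t => 0), (fun k => if (0 < k < d)%N then 0%N else 1%N); split.
  - by have := dec_Lfun (@dec0 R d).
  - rewrite [in leLHS](_ : _ \- _ = gaussian G); last by apply/funext => t; rewrite /= subr0.
    by rewrite -[leLHS]mul1e lee_wpmul2r ?lee_fin ?Lnorm_ge0.
  - by apply: (@has_ftt0 _ _ _ (Ordinal (leqW d2))); rewrite /= ?ltnn ?andbF// d2.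
  - by move=> k ->; rewrite mulr_ge0 ?expR_ge0 ?powR_ge0.
have h2 : h <= 1 / 2.
  have d2' : 2 <= d%:R :> R by rewrite ler_nat.
  by rewrite ler_pdivrMr//; lra.
have eL : expR L = C / h by rewrite lnK ?posrE// /h invf_div.
have C8 : 8 <= C ^+ 2.
  rewrite -[leLHS](@sqr_sqrtr _ 8)//.
  by rewrite lerXn2r// nnegrE ltW.
have C5 : 5 / theta <= C by rewrite !le_max lexx orbT.
have CA : 4 * c / (1 + expR (- theta)) <= C.
  rewrite (le_trans _ (_ : expR theta / (1 + expR theta) * (4 * alpha / lmin) <= C))//.
    rewrite /c expRN; have := expR_gt0 theta; move: (expR theta) => x x0.
    by rewrite le_eqVlt (_ : _ == _)//; apply/eqP; field; lra.
  by rewrite !le_max lexx !orbT.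
have L53 : 5 / 3 <= L by exact: ge_5_3_ln C8 h0 h2 eL.
have cut k : exists au : (nat -> seq R -> R) * (nat -> seq R -> R),
    (0 < k < d)%N ->
    [/\ forall j, dec k (au.1 j), forall j, dec (d - k) (au.2 j) &
      nrm d (fun s => gaussS G s -
         \sum_(j < \prod_(i < minn k (d - k)) trunc_order c theta L i)
           au.1 j (take k s) * au.2 j (drop k s)) <=
      h * nrm d (gaussS G)].
  have [/andP[k0 kd]|] := boolP (0 < k < d)%N; last by exists (fun _ _ => 0, fun _ _ => 0).
  have kd1 : (k < d.+1)%N by rewrite ltnS ltnW.
  have [|i im|a [u [da du E]]] := @subdiag_approx _ _ G lmin (sv_ratio c theta)
    (trunc_order c theta L) (Ordinal kd1) lmin0 GT lG.
  - by move=> i; exact: sv_ratio_gt0.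
  (* Singular values are numbered from 1 in the hypothesis and from 0 in [sv_ratio], whose exponent
     contains the shift. *)
  - have /= := svG (Ordinal kd1) _ i.+1; rewrite k0 kd => /(_ isT im)/le_trans; apply.
    by rewrite /sv_ratio /c mulrA mulrC [alpha / _]mulrC mulrA divff ?mul1r ?gt_eqF// mulrC.
  - exists (a, u) => _; split=> //; apply: (le_trans E).
    by rewrite ler_wpM2r ?nrm_ge0// (@trunc_error_le _ c theta L _ _ C).
have /choice[au auP] := cut.
have dgt0 : (0 < d)%N by exact: leq_trans d2.
have [fhat [dfhat fhat_err fhat_ftt]] := @tt_approx _ d (gaussS G)
  (h * nrm d (gaussS G)) (fun k => \prod_(i < minn k (d - k)) trunc_order c theta L i)%N
  (fun k => (au k).1) (fun k => (au k).2) dgt0 dG auP.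
exists (fun t => fhat t), (fun k : 'I_d.+1 => if (0 < k < d)%N
  then (\prod_(i < minn k (d - k)) trunc_order c theta L i)%N else 1%N); split; last 1 first.
- move=> k kd; rewrite kd /bound.
  rewrite (_ : 3 * alpha / (lmin * theta) = 3 * c / theta); last first.
    by rewrite /c; field; rewrite !gt_eqF.
  exact: prod_trunc_order_le.
- exact: dec_Lfun.
- rewrite gaussE.
  have dB : dec d (fun s => gaussS G s - fhat s) by exact: decB.
  rewrite (_ : _ \- _ = (fun t : d.-tuple (measurableTypeR R) => gaussS G t - fhat t))//.
  rewrite (Lnorm_nrm dB) (Lnorm_nrm dG) -EFinM lee_fin (le_trans fhat_err)//.
  rewrite mulrA ler_wpM2r ?nrm_ge0// /h mulrA ler_pdivrMr// mulrC ler_pM2l//.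
  by rewrite ler_nat leq_pred.
- exact: fhat_ftt.
Qed.
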